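(* Consider the properties BPBp, BPBpp, BPBop, $\mathbf{L}_{p,p}$, $\mathbf{L}_{o,o}$, $\mathbf{L}_{p,o}$, $\mathbf{L}_{o,p}$, $\mathbf{L}_{p}$, $\mathbf{L}_{o}$ of pairs $(X,Y)$ of Banach spaces. Say that a property $A$ implies a property $B$ if every pair $(X,Y)$ of Banach spaces having $A$ has $B$. (i) All of the following implications hold: (1) BPBpp implies $\mathbf{L}_{p,o}$; (2) BPBpp implies $\mathbf{L}_{p,p}$; (3) BPBpp implies BPBp; (4) $\mathbf{L}_{p,o}$ implies $\mathbf{L}_{o}$; (5) $\mathbf{L}_{p,p}$ implies $\mathbf{L}_{p}$; (6) BPBop implies $\mathbf{L}_{o,o}$; (7) BPBop implies $\mathbf{L}_{o,p}$; (8) $\mathbf{L}_{o,o}$ implies $\mathbf{L}_{o}$; (9) $\mathbf{L}_{o,p}$ implies $\mathbf{L}_{p}$; (10) BPBop implies BPBp; (11) BPBp implies $\mathbf{L}_{o}$; (12) BPBp implies $\mathbf{L}_{p}$. On the other hand, none of the reverse implications of (1)–(12) is true. (ii) BPBp does not imply any of $\mathbf{L}_{p,p}$, $\mathbf{L}_{p,o}$, $\mathbf{L}_{o,p}$, $\mathbf{L}_{o,o}$. (iii) $\mathbf{L}_{o,p}$ does not imply $\mathbf{L}_{p,o}$, and $\mathbf{L}_{p,o}$ does not imply $\mathbf{L}_{o,p}$. (iv) $\mathbf{L}_{p,p}$ does not imply $\mathbf{L}_{p,o}$. (v) $\mathbf{L}_{o,o}$ does not imply $\mathbf{L}_{o,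p}$.
   Context: Banach spaces are over $\mathbb{K}$, which is $\mathbb{R}$ or $\mathbb{C}$. $S_X$ denotes the unit sphere of $X$, and $\mathcal{L}(X,Y)$ the space of bounded linear operators from $X$ to $Y$ with the operator norm; $S_{\mathcal{L}(X,Y)}$ is its unit sphere. Let $(X,Y)$ be a pair of Banach spaces. Uniform properties. For each of these: given $\varepsilon>0$ there is $\eta(\varepsilon)>0$ such that whenever $T\in S_{\mathcal{L}(X,Y)}$ and $x\in S_X$ satisfy $\|T(x)\|>1-\eta(\varepsilon)$, - BPBp: there are $S\in S_{\mathcal{L}(X,Y)}$ and $x_0\in S_X$ with $\|S(x_0)\|=1$, $\|x_0-x\|<\varepsilon$ and $\|S-T\|<\varepsilon$; - BPBpp: there is $S\in S_{\mathcal{L}(X,Y)}$ with $\|S(x)\|=1$ and $\|S-T\|<\varepsilon$; - BPBop: there is $x_0\in S_X$ with $\|T(x_0)\|=1$ and $\|x_0-x\|<\varepsilon$. Local properties with $\eta$ depending on the point. For each of these: given $\varepsilon>0$ and $x\in S_X$ there is $\eta(\varepsilon,x)>0$ such that whenever $T\in S_{\mathcal{L}(X,Y)}$ satisfies $\|T(x)\|>1-\eta(\varepsilon,x)$, - $\mathbf{L}_{p}$: there are $S\in S_{\mathcal{L}(X,Y)}$ and $x_0\in S_X$ with $\|S(x_0)\|=1$, $\|x_0-x\|<\varepsilon$ and $\|S-T\|<\varepsilon$; - $\mathbf{L}_{p,p}$: there is $S\in S_{\mathcal{L}(X,Y)}$ with $\|S(x)\|=1$ and $\|S-T\|<\varepsilon$;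 - $\mathbf{L}_{o,p}$: there is $x_0\in S_X$ with $\|T(x_0)\|=1$ and $\|x_0-x\|<\varepsilon$. Local properties with $\eta$ depending on the operator. For each of these: given $\varepsilon>0$ and $T\in S_{\mathcal{L}(X,Y)}$ there is $\eta(\varepsilon,T)>0$ such that whenever $x\in S_X$ satisfies $\|T(x)\|>1-\eta(\varepsilon,T)$, - $\mathbf{L}_{o}$: there are $S\in S_{\mathcal{L}(X,Y)}$ and $x_0\in S_X$ with $\|S(x_0)\|=1$, $\|x_0-x\|<\varepsilon$ and $\|S-T\|<\varepsilon$; - $\mathbf{L}_{p,o}$: there is $S\in S_{\mathcal{L}(X,Y)}$ with $\|S(x)\|=1$ and $\|S-T\|<\varepsilon$; - $\mathbf{L}_{o,o}$: there is $x_0\in S_X$ with $\|T(x_0)\|=1$ and $\|x_0-x\|<\varepsilon$. *)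

(* Defs.v *)
From HB Require Import structures.
From mathcomp Require Import all_boot all_order all_algebra.
From mathcomp Require Import complex.
From mathcomp Require Import all_classical all_reals all_analysis.

Set Implicit Arguments.
Unset Strict Implicit.
Unset Printing Implicit Defensive.

Import Order.TTheory GRing.Theory Num.Theory.
Import numFieldNormedType.Exports.

Local Open Scope classical_set_scope.
Local Open Scope ring_scope.

(* Everything is stated over K : numFieldType, to be instantiated by R or by
   R[i] for R : realType.  On R[i] the order is the partial order in which
   x <= y means that y - x is real and nonnegative, and norms are
   nonnegative elements of R[i]; thus [0 < eps] says that eps is a positive
   real number, and the comparisons below are comparisons of reals. *)

Section Operators.
Variables (K : numFieldType) (X Y : normedModType K).

Definition unit_sphere : set X := [set x | `|x| = 1].

(* [supremum] is the least upper bound for the order of K; on R[i], the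
   upper bounds of a nonempty set of reals are all real, so this is the
   usual real supremum.  The value on an unbounded T is the default 0, but
   [opnorm] is only used on bounded operators. *)
Definition opnorm (T : X -> Y) : K :=
  supremum 0 [set `|T x| | x in [set x : X | `|x| <= 1]].

(* Boundedness is expressed as continuity, see [linear_bounded_continuous]. *)
Definition op_sphere : set {linear X -> Y} :=
  [set T : {linear X -> Y} | continuous T /\ opnorm T = 1].

End Operators.

Arguments unit_sphere {K} X.
Arguments op_sphere {K} X Y.

Section Properties.
Variables (K : numFieldType) (X Y : completeNormedModType K).
Implicit Types (T : {linear X -> Y}) (x : X).

(* The three conclusions occurring in the properties, for given eps, T, x. *)

Definition approx_op_point (eps : K) T x : Prop :=
  exists (S : {linear X -> Y}) (x0 : X),
    [/\ op_sphere X Y S, unit_sphere X x0, `|S x0| = 1,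
        `|x0 - x| < eps & opnorm (S \- T) < eps].

Definition approx_op (eps : K) T x : Prop :=
  exists S : {linear X -> Y},
    [/\ op_sphere X Y S, `|S x| = 1 & opnorm (S \- T) < eps].

Definition approx_point (eps : K) T x : Prop :=
  exists x0 : X, [/\ unit_sphere X x0, `|T x0| = 1 & `|x0 - x| < eps].

(* The three dependences of eta, for a given conclusion C. *)

Definition uniform_prop (C : K -> {linear X -> Y} -> X -> Prop) : Prop :=
  forall eps : K, 0 < eps ->
  exists2 eta : K, 0 < eta &
  forall T x, op_sphere X Y T -> unit_sphere X x ->
    1 - eta < `|T x| -> C eps T x.

Definition point_prop (C : K -> {linear X -> Y} -> X -> Prop) : Prop :=
  forall eps : K, 0 < eps -> forall x, unit_sphere X x ->
  exists2 eta : K, 0 < eta &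
  forall T, op_sphere X Y T -> 1 - eta < `|T x| -> C eps T x.

Definition operator_prop (C : K -> {linear X -> Y} -> X -> Prop) : Prop :=
  forall eps : K, 0 < eps -> forall T, op_sphere X Y T ->
  exists2 eta : K, 0 < eta &
  forall x, unit_sphere X x -> 1 - eta < `|T x| -> C eps T x.

Definition BPBp := uniform_prop approx_op_point.
Definition BPBpp := uniform_prop approx_op.
Definition BPBop := uniform_prop approx_point.

Definition Lp := point_prop approx_op_point.
Definition Lpp := point_prop approx_op.
Definition Lop := point_prop approx_point.

Definition Lo := operator_prop approx_op_point.
Definition Lpo := operator_prop approx_op.
Definition Loo := operator_prop approx_point.

End Properties.

Arguments BPBp K X Y : clear implicits.
Arguments BPBpp K X Y : clear implicits.
Arguments BPBop K X Y : clear implicits.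
Arguments Lp K X Y : clear implicits.
Arguments Lpp K X Y : clear implicits.
Arguments Lop K X Y : clear implicits.
Arguments Lo K X Y : clear implicits.
Arguments Lpo K X Y : clear implicits.
Arguments Loo K X Y : clear implicits.

Definition pair_property (K : numFieldType) : Type :=
  completeNormedModType K -> completeNormedModType K -> Prop.

Definition pair_implies (K : numFieldType) (A B : pair_property K) : Prop :=
  forall X Y : completeNormedModType K, A X Y -> B X Y.

(* Main.v *)
Require Import Defs.
From HB Require Import structures.
From mathcomp Require Import all_boot all_order all_algebra.
From mathcomp Require Import complex ring lra.
From mathcomp Require Import all_classical all_reals all_analysis.

Set Implicit Arguments.
Unset Strict Implicit.
Unset Printing Implicit Defensive.

Import Order.TTheory GRing.Theory Num.Theory.
Import numFieldNormedType.Exports.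

Local Open Scope classical_set_scope.
Local Open Scope ring_scope.

                                                                             
                                                                               
                                                                            
                                                                             
                                                                       
                                                                                

                                                                                
                                                                               
                                                                      
                                                                                
                                        
                                                                                
          
                                                                             
                                                                               
                                                                                
              
                                                                          
                                                                               
                                                                                
                                                                            
                                                                             

                                                           

(** The implications are formal: a uniform [eta] serves for every point and every operator, and
    keeping the point ([attain_op]) or the operator ([attain_point]) is a special case of
    approximating both. The content lies in the counterexamples, built from four Banach spaces
    defined alike over real and complex scalars.

    [rsup] is ℓ2 renormed by adding, in square, the supremum over n of |(1 - 1/(n+2)) v_0 +
    v_{n+1}|. It is uniformly convex, so an almost norming point of a form lies near one where the
    norm is attained. Hence [rsup] has BPBop with the scalars ([uc_BPBop_unit]) and BPBp with ℓ∞
    ([uc_BPBp_linf]). The supremum is not attained at e_0, and support forms near e_0 vary abruptly,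
    which destroys [Lpo] and [Lpp] for scalar targets ([rsup_not_Lpo], [rsup_not_Lpp]). With ℓ∞ as
    target, a component of norm one that vanishes at the given point destroys [Lop], and components
    whose norms increase to one without reaching it destroy [Loo] ([rsup_not_Lop], [rsup_not_Loo]).

    [ell1] is the two-dimensional ℓ1. Compactness gives [Loo] with every target and [Lpp] with the
    scalars; the edges of its ball destroy [Lpo] and [Lop].

    [blocks] is the ℓ2-sum of planes with smooth and rotund norms that tend to the ℓ1 norm. A single
    point or form is concentrated on finitely many blocks, so local properties survive: local
    uniform rotundity ([blocks_lur]) gives [Lop] with the scalars, smoothness ([blocks_form_smooth])
    gives [Lpo] with the two-dimensional ℓ∞. A uniform [eta] would have to serve planes arbitrarily
    close to ℓ1, whence [blocks_not_BPBop] and [blocks_not_BPBpp].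

    [mixed] is the ℓ∞-sum of strictly convex planes tending to ℓ∞ planes. An operator attaining its
    norm inside an edge of an ℓ1 ball, with values in a strictly convex plane, is constant along the
    edge; the operator with components a + b and a - b is far from that. Made quantitative, this is
    [planes_not_BPBp], valid for [ell1] and for [blocks]. Yet [ell1] has [Lo] with every target, and
    [blocks] has [Lp] with [mixed] by a Lindenstrauss perturbation ([blocks_mixed_Lp]).

    The other failures follow by composing a supposed converse with a proved implication. Every
    space consists of scalar functions with bounded [good] seminorms; ultrafilter limits of
    coordinates supply completeness, weak compactness and weak-star compactness. *)

Section UltraLimits.

(** * Limits along an ultrafilter, and the scalar fields *)

Variable R : realType.

(** An ultrafilter finer than the cofinite filter. Limits along it replace the extraction of
    subsequences, and one choice serves all coordinates at once. *)
Definition ultra : set_system nat :=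
  sval (cid (ultraFilterLemma eventually_filter)).

#[global] Instance ultra_ultra : UltraFilter ultra.
Proof. exact: (svalP (cid (ultraFilterLemma eventually_filter))).1. Qed.

#[global] Instance ultra_properfilter : ProperFilter ultra.
Proof. exact: ultra_proper. Qed.

Lemma ultra_eventually (P : set nat) N :
  (forall n, (N <= n)%N -> P n) -> ultra P.
Proof.
move=> h; apply: (svalP (cid (ultraFilterLemma eventually_filter))).2.
by exists N.
Qed.

Definition ulim (u : nat -> R) (l : R) :=
  forall e, 0 < e -> ultra [set n | `|u n - l| < e].

Lemma ulim_ex (u : nat -> R) M : (forall n, `|u n| <= M) -> exists l, ulim u l.
Proof.
move=> hu.
have := @segment_compact R (- M) M; rewrite compact_ultra /=.
(* The image of an ultrafilter is an ultrafilter, so the compact segment contains a limit of it. *)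
have ULu : UltraFilter (u @ ultra).
  split=> [|G GF sG]; first exact: fmap_proper_filter.
  rewrite predeqE => A; split=> [GA|]; last exact: sG.
  have [//|nA] := in_ultra_setVsetC (u @^-1` A) ultra_ultra.
  have GnA : G (~` A) by apply: sG.
  by have [x [? ?]] := filter_ex (filterI GA GnA).
move=> /(_ _ ULu) []; first apply: filterS (@filterT _ ultra _).
  by move=> n _ /=; have := hu n; rewrite ler_norml in_itv.
move=> l [_ /cvgrPdist_lt ul]; exists l => e e0.
by apply: filterS (ul _ e0) => n /=; rewrite distrC.
Qed.

Lemma ulim_cst c : ulim (fun _ => c) c.
Proof. by move=> e e0; apply: filterS (filterT) => n _ /=; rewrite subrr normr0. Qed.

Lemma ulimD u v l m : ulim u l -> ulim v m -> ulim (fun n => u n + v n) (l + m).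
Proof.
move=> hu hv e e0; have e2 : 0 < e / 2 by rewrite divr_gt0.
apply: filterS2 (hu _ e2) (hv _ e2) => n /= h1 h2.
rewrite opprD addrACA (splitr e); apply: le_lt_trans (ler_normD _ _) _.
exact: ltrD.
Qed.

Lemma ulimZ c u l : ulim u l -> ulim (fun n => c * u n) (c * l).
Proof.
move=> hu e e0; have c1 : 0 < `|c| + 1 by rewrite ltr_wpDl.
have ec : 0 < e / (`|c| + 1) by rewrite divr_gt0.
apply: filterS (hu _ ec) => n /=; rewrite ltr_pdivlMr // -mulrBr normrM => h.
apply: le_lt_trans h; rewrite mulrC ler_wpM2l //; lra.
Qed.

Lemma ulimN u l : ulim u l -> ulim (fun n => - u n) (- l).
Proof.
move=> /(ulimZ (-1)); rewrite mulN1r => h e e0.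
by apply: filterS (h _ e0) => n /=; rewrite mulN1r.
Qed.

Lemma ulimB u v l m : ulim u l -> ulim v m -> ulim (fun n => u n - v n) (l - m).
Proof. by move=> hu hv; apply: ulimD => //; apply: ulimN. Qed.

Lemma ulim_le u v l m : ultra [set n | u n <= v n] ->
  ulim u l -> ulim v m -> l <= m.
Proof.
move=> h hu hv; rewrite leNgt; apply/negP => ml.
have e0 : 0 < (l - m) / 2 by rewrite divr_gt0 // subr_gt0.
have [n [/= h1 h2]] := filter_ex (filterI h (filterI (hu _ e0) (hv _ e0))).
move: h2 => []; rewrite /= !ltr_norml => /andP[? ?] /andP[? ?]; lra.
Qed.

Lemma ulim_ext u v l : u =1 v -> ulim u l -> ulim v l.
Proof. by move=> /funext ->. Qed.

Lemma ulim_unique u l m : ulim u l -> ulim u m -> l = m.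
Proof.
move=> h1 h2; apply/eqP; rewrite eq_le.
by apply/andP; split; [apply: ulim_le h1 h2|apply: ulim_le h2 h1];
  apply: filterS (filterT) => n _ /=.
Qed.

Lemma ulim_squeeze0 u v : (forall n, `|u n| <= v n) -> ulim v 0 -> ulim u 0.
Proof.
move=> h hv e e0; apply: filterS (hv _ e0) => n /=; rewrite !subr0 => hn.
exact: le_lt_trans (le_trans (h n) (ler_norm _)) hn.
Qed.

Lemma ulim_dist u v l : (forall n, `|u n - l| <= v n) -> ulim v 0 -> ulim u l.
Proof.
move=> h hv e e0; apply: filterS (hv _ e0) => n /=; rewrite !subr0 => hn.
exact: le_lt_trans (le_trans (h n) (ler_norm _)) hn.
Qed.

Lemma ulim_nat u l :
  (forall e, 0 < e -> exists N, forall n, (N <= n)%N -> `|u n - l| < e) ->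
  ulim u l.
Proof. by move=> h e e0; have [N hN] := h e e0; apply: ultra_eventually hN. Qed.

Lemma ulim_inv : ulim (fun n => n.+1%:R^-1) 0.
Proof.
apply: ulim_nat => e e0; have [N hN] := ltr_add_invr e0.
exists N => n Nn; rewrite subr0 ger0_norm ?invr_ge0 //.
rewrite add0r in hN; apply: le_lt_trans hN.
by rewrite lef_pV2 ?posrE ?ltr0n // ler_nat.
Qed.

End UltraLimits.

(** What the constructions use of the field: [io] embeds the reals and [rn] is the modulus read as a
    real number. The parallelogram law is the source of rotundity and smoothness below, and
    [rn_ulim] is the compactness of bounded sets. Real and complex pairs thereby share one proof. *)
Record scalars (K : numFieldType) (R : realType) := Scalars {
  io : R -> K;
  rn : K -> R;
  ioD : forall a b, io (a + b) = io a + io b;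
  ioM : forall a b, io (a * b) = io a * io b;
  io1 : io 1 = 1;
  io_le : forall a b, (io a <= io b) = (a <= b);
  rnE : forall z, `|z| = io (rn z);
  rn_parallelogram : forall z w,
    rn (z + w) ^+ 2 + rn (z - w) ^+ 2 = 2 * rn z ^+ 2 + 2 * rn w ^+ 2;
  rn_ulim : forall (u : nat -> K) (M : R), (forall n, rn (u n) <= M) ->
    exists l, ulim (fun n => rn (u n - l)) 0 }.

Lemma real_scalars (R : realType) : scalars R R.
Proof.
apply: (@Scalars _ _ id (fun x => `|x|)) => // [z w|u M h].
  by rewrite !real_normK ?num_real //; ring.
have [l ul] := ulim_ex h; exists l => e e0.
by apply: filterS (ul _ e0) => n /=; rewrite subr0 normr_id.
Qed.

Lemma le_Re_normc (R : realType) (z : R[i]) : `|complex.Re z| <= Normc.normc z.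
Proof. by case: z => a b /=; rewrite -sqrtr_sqr ler_wsqrtr // lerDl sqr_ge0. Qed.

Lemma le_Im_normc (R : realType) (z : R[i]) : `|complex.Im z| <= Normc.normc z.
Proof. by case: z => a b /=; rewrite -sqrtr_sqr ler_wsqrtr // lerDr sqr_ge0. Qed.

Lemma normc_le_ReIm (R : realType) (z : R[i]) :
  Normc.normc z <= `|complex.Re z| + `|complex.Im z|.
Proof.
case: z => a b /=.
rewrite -[leRHS]ger0_norm ?addr_ge0 // -sqrtr_sqr ler_wsqrtr // sqrrD.
by rewrite !real_normK ?num_real // lerD2r lerDl mulrn_wge0 // mulr_ge0.
Qed.

Lemma normc_ge0 (R : realType) (z : R[i]) : 0 <= Normc.normc z.
Proof. by case: z => a b /=; rewrite sqrtr_ge0. Qed.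

Lemma complex_scalars (R : realType) : scalars R[i] R.
Proof.
apply: (@Scalars R[i] R (real_complex R) (@Normc.normc R)).
- by move=> a b; exact: rmorphD.
- by move=> a b; exact: rmorphM.
- by [].
- by move=> a b; exact: lecR.
- by [].
- move=> [a b] [c d]; rewrite /Normc.normc /=.
  by rewrite !sqr_sqrtr ?addr_ge0 ?sqr_ge0 //; ring.
move=> u M h.
have [a ha] := ulim_ex (fun n => le_trans (le_Re_normc (u n)) (h n)).
have [b hb] := ulim_ex (fun n => le_trans (le_Im_normc (u n)) (h n)).
exists (Complex a b).
apply: (@ulim_squeeze0 _ _
  (fun n => `|complex.Re (u n) - a| + `|complex.Im (u n) - b|)).
  move=> n; rewrite ger0_norm ?normc_ge0 //.
  by apply: le_trans (normc_le_ReIm _) _; case: (u n).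
rewrite -[X in ulim _ X]addr0; apply: ulimD => e e0.
  by apply: filterS (ha _ e0) => n /=; rewrite subr0 normr_id.
by apply: filterS (hb _ e0) => n /=; rewrite subr0 normr_id.
Qed.

                                                

(** * Moduli, norms and operator norms as real numbers *)

Section ScalarTheory.
Variables (K : numFieldType) (R : realType) (sc : scalars K R).
Local Notation io := (io sc).
Local Notation rn := (rn sc).

Lemma io0 : io 0 = 0.
Proof. by apply/(addrI (io 0)); rewrite -ioD !addr0. Qed.

Lemma ioN a : io (- a) = - io a.
Proof. by apply/(addrI (io a)); rewrite -ioD !subrr io0. Qed.

Lemma ioB a b : io (a - b) = io a - io b.
Proof. by rewrite ioD ioN. Qed.

Lemma io_inj : injective io.
Proof. by move=> a b ab; apply/eqP; rewrite eq_le -!(io_le sc) ab lexx. Qed.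

Lemma io_lt a b : (io a < io b) = (a < b).
Proof. by rewrite !lt_neqAle io_le (inj_eq io_inj). Qed.

Lemma io_ge0 a : (0 <= io a) = (0 <= a).
Proof. by rewrite -io0 io_le. Qed.

Lemma io_gt0 a : (0 < io a) = (0 < a).
Proof. by rewrite -io0 io_lt. Qed.

Lemma rn_ge0 z : 0 <= rn z.
Proof. by rewrite -io_ge0 -rnE. Qed.

Lemma ge0_io z : 0 <= z -> z = io (rn z).
Proof. by move=> z0; rewrite -rnE ger0_norm. Qed.

Lemma gt0_io z : 0 < z -> exists2 r, 0 < r & z = io r.
Proof.
by move=> z0; exists (rn z); rewrite -?io_gt0 -?ge0_io ?ltW.
Qed.

Lemma rn_io a : rn (io a) = `|a|.
Proof.
apply: io_inj; rewrite -rnE.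
have [a0|a0] := leP 0 a; first by rewrite !ger0_norm ?io_ge0.
by rewrite (ltr0_norm a0) -normrN -ioN ger0_norm // io_ge0 oppr_ge0 ltW.
Qed.

Lemma rn0 : rn 0 = 0. Proof. by rewrite -io0 rn_io normr0. Qed.
Lemma rn1 : rn 1 = 1. Proof. by rewrite -(io1 sc) rn_io normr1. Qed.

Lemma rn0_eq0 z : rn z = 0 -> z = 0.
Proof. by move=> z0; apply/eqP; rewrite -normr_eq0 (rnE sc) z0 io0. Qed.

Lemma rnM z w : rn (z * w) = rn z * rn w.
Proof. by apply: io_inj; rewrite ioM -!rnE normrM. Qed.

Lemma rnN z : rn (- z) = rn z.
Proof. by apply: io_inj; rewrite -!rnE normrN. Qed.

Lemma rnD z w : rn (z + w) <= rn z + rn w.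
Proof. by rewrite -(io_le sc) ioD -!rnE ler_normD. Qed.

Lemma rnBC z w : rn (z - w) = rn (w - z).
Proof. by rewrite -rnN opprB. Qed.

Lemma rnB z w : rn z - rn w <= rn (z - w).
Proof. by rewrite lerBlDr (le_trans _ (rnD _ _)) // subrK. Qed.

Lemma rn_dist z w : `|rn z - rn w| <= rn (z - w).
Proof.
rewrite ler_norml rnB andbT lerNl opprB rnBC; exact: rnB.
Qed.

Lemma rnV z : rn z^-1 = (rn z)^-1.
Proof.
have [->|z0] := eqVneq z 0; first by rewrite invr0 rn0 invr0.
have r0 : rn z != 0 by apply: contra_neq z0; apply: rn0_eq0.
by apply: (mulfI r0); rewrite -rnM !divff // rn1.
Qed.

Lemma rn_eq0 z : (rn z == 0) = (z == 0).
Proof. by apply/eqP/eqP => [/rn0_eq0//|->]; rewrite rn0. Qed.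

Lemma phase z : exists2 t, rn t = 1 & t * z = io (rn z).
Proof.
have [->|z0] := eqVneq z 0; first by exists 1; rewrite ?rn1 // mul1r rn0 io0.
have r0 : rn z != 0 by rewrite rn_eq0.
exists (io (rn z) / z); last by rewrite divfK.
by rewrite rnM rnV rn_io ger0_norm ?rn_ge0 // divff.
Qed.

Section Norm.
Variable X : normedModType K.
Implicit Types x y : X.

Definition nx x : R := rn `|x|.

Lemma nxE x : `|x| = io (nx x).
Proof. by rewrite -rnE normr_id. Qed.

Lemma nx_ge0 x : 0 <= nx x. Proof. exact: rn_ge0. Qed.

Lemma nx0 : nx 0 = 0. Proof. by rewrite /nx normr0 rn0. Qed.

Lemma nx0_eq0 x : nx x = 0 -> x = 0.
Proof. by move=> h; apply/eqP; rewrite -normr_eq0 nxE h io0. Qed.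

Lemma nxD x y : nx (x + y) <= nx x + nx y.
Proof. by rewrite -(io_le sc) ioD -!nxE ler_normD. Qed.

Lemma nxN x : nx (- x) = nx x. Proof. by rewrite /nx normrN. Qed.

Lemma nxBC x y : nx (x - y) = nx (y - x).
Proof. by rewrite -nxN opprB. Qed.

Lemma nxZ a x : nx (a *: x) = rn a * nx x.
Proof. by apply: io_inj; rewrite ioM -nxE normrZ (rnE sc) nxE. Qed.

Lemma nxZr a x : 0 <= a -> nx (io a *: x) = a * nx x.
Proof. by move=> a0; rewrite nxZ rn_io ger0_norm. Qed.

Lemma nxB x y : nx x - nx y <= nx (x - y).
Proof. by rewrite lerBlDr (le_trans _ (nxD _ _)) // subrK. Qed.

Lemma nx_triangle x y z : nx (x - z) <= nx (x - y) + nx (y - z).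
Proof. by rewrite (le_trans _ (nxD _ _)) // addrA subrK. Qed.

Lemma nx_normalize x : nx x != 0 -> nx (io (nx x)^-1 *: x) = 1.
Proof. by move=> x0; rewrite nxZr ?invr_ge0 ?nx_ge0 // mulVf. Qed.

End Norm.

Section Operator.
Variables X Y : normedModType K.
Implicit Types S T : {linear X -> Y}.

Definition bdd_by (T : X -> Y) (c : R) := forall x, nx (T x) <= c * nx x.

(** Norm exactly one, free of suprema in [K]: the bound one holds and is almost reached on the
    ball. *)
Definition norm_one (T : X -> Y) :=
  bdd_by T 1 /\ forall e, 0 < e -> exists2 x, nx x <= 1 & 1 - e < nx (T x).

(** The bound [c] lies strictly below [e], so that the operator norm is less than [e] and not merely
    at most [e]. *)
Definition op_near (e : R) (S T : X -> Y) :=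
  exists2 c, c < e & bdd_by (S \- T) c.

(** Norms lie in the image of [io], where the order of [K] is that of the reals, so the supremum in
    [K] is the image of a real supremum. A bound [d] can be negative only on the zero space, hence
    [Num.max d 0]. *)
Lemma opnormE (T : X -> Y) c : (forall a x, T (a *: x) = a *: T x) ->
  bdd_by T c -> exists r, [/\ opnorm T = io r, bdd_by T r,
    forall d, bdd_by T d -> r <= Num.max d 0 &
    forall e, 0 < e -> exists2 x, nx x <= 1 & r - e < nx (T x)].
Proof.
move=> Tz Tc.
pose B := [set nx (T x) | x in [set x : X | nx x <= 1]].
have B0 : B (nx (T 0)) by exists 0 => //=; rewrite nx0 ler01.
have Bub d : bdd_by T d -> ubound B (Num.max d 0).
  move=> Td _ [x /= x1 <-]; apply: le_trans (Td x) _.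
  have [c0|c0] := leP d 0; last by rewrite ler_piMr // ltW.
  by rewrite mulr_le0_ge0 // nx_ge0.
have hB : has_sup B by split; [exists (nx (T 0))|exists (Num.max c 0); apply: Bub].
have r0 : 0 <= sup B.
  by apply: le_trans (sup_upper_bound hB B0); exact: nx_ge0.
exists (sup B); split.
- rewrite /opnorm /supremum.
  set A := [set _ | _ in _].
  have AE y : A y <-> exists2 b, B b & y = io b.
    split=> [[x /=]|[b [x /= x1 <-] ->]].
      rewrite nxE -(io1 sc) io_le => x1 <-; exists (nx (T x)); last exact: nxE.
      by exists x.
    by exists x => /=; rewrite nxE -?(io1 sc) ?io_le.
  have A0 : A (io (nx (T 0))) by apply/AE; exists (nx (T 0)).
  (* The default value is reserved for the empty set; here the set contains the norm of [T 0]. *)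
  case: ifPn => [/eqP AA|_]; first by rewrite AA in A0.
  have supA : supremums A (io (sup B)).
    split; first by move=> _ /AE[b Bb ->]; rewrite io_le sup_upper_bound.
    move=> y uy; have y0 : 0 <= y.
      by apply: le_trans (uy _ A0); rewrite io_ge0 nx_ge0.
    rewrite (ge0_io y0) io_le; apply: sup_le_ub; first by exists (nx (T 0)).
    move=> b Bb; rewrite -(io_le sc) -ge0_io //; apply: uy; apply/AE.
    by exists b.
  case: xgetP => [y -> sy|/(_ _ supA)//].
  exact: (is_subset1_supremums sy supA).
- move=> x; have [x0|x0] := eqVneq (nx x) 0.
    have -> : x = 0 by apply: nx0_eq0.
    by rewrite -[0 : X](scale0r 0) Tz !scale0r !nx0 mulr0.
  have xp : 0 < nx x by rewrite lt_neqAle eq_sym x0 nx_ge0.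
  have : B (nx (T (io (nx x)^-1 *: x))).
    by exists (io (nx x)^-1 *: x) => //=; rewrite nx_normalize.
  move/(sup_upper_bound hB); rewrite Tz nxZr ?invr_ge0 ?nx_ge0 //.
  by rewrite mulrC ler_pdivrMr.
- by move=> d Td; apply: sup_le_ub; [exists (nx (T 0))|exact: Bub].
- by move=> e e0; have [_ [x /= x1 <-] h] := sup_adherent e0 hB; exists x.
Qed.

Lemma bdd_linear_continuous T c : bdd_by T c -> continuous T.
Proof.
move=> Tc; apply/linear_bounded_continuous/linear_boundedP.
exists (io c); split; first by rewrite realE io_ge0 -io0 io_le le_total.
move=> r; rewrite -subr_gt0 => rc x.
rewrite nxE; apply: (@le_trans _ _ (io c * `|x|)).
  by rewrite nxE -ioM io_le Tc.
by rewrite ler_wpM2r // -subr_ge0 ltW.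
Qed.

Lemma op_sphereP T : op_sphere X Y T <-> norm_one T.
Proof.
split=> [[cT T1]|[T1 sT]].
  have [c Tc] : exists c, bdd_by T c.
    have /linear_boundedP[r [rr]] := (iffRL (linear_bounded_continuous T)) cT.
    have r1 : r < io (rn r + 1).
      apply: (@le_lt_trans _ _ (io (rn r))); last by rewrite io_lt ltrDl ltr01.
      by rewrite -rnE real_ler_norm.
    by move=> /(_ _ r1) h; exists (rn r + 1) => x; rewrite -(io_le sc) ioM -!nxE.
  have [r [Tr rb _ rs]] := opnormE (linearZ_LR T) Tc.
  have r1 : r = 1 by apply: io_inj; rewrite -Tr T1 io1.
  by subst r; split.
split; first exact: bdd_linear_continuous T1.
have [r [-> rb r1 _]] := opnormE (linearZ_LR T) T1.
suff -> : r = 1 by rewrite io1.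
apply/eqP; rewrite eq_le; apply/andP; split.
  by apply: (le_trans (r1 _ T1)); rewrite ge_max lexx ler01.
(* If [r] were below 1, the point of the ball that [sT] provides, with image of norm above [r],
   would violate the bound [r]. A negative [r] is excluded by [sT] applied to 1. *)
rewrite leNgt; apply/negP => rlt; have e0 : 0 < 1 - r by rewrite subr_gt0.
have [x x1] := sT _ e0; rewrite ltNge => /negP; apply; rewrite opprB addrC subrK.
apply: (le_trans (rb x)); rewrite ler_piMr // leNgt; apply/negP => r0.
have [y _] := sT _ ltr01; have := rb y; have := nx_ge0 y; nra.
Qed.

Lemma op_nearP (e : R) S T c : 0 < e -> bdd_by (S \- T) c ->
  opnorm (S \- T) < io e <-> op_near e S T.
Proof.
move=> e0 ST.
have hz : forall a x, (S \- T) (a *: x) = a *: (S \- T) x.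
  move=> a x; rewrite /= scalerBr; congr (_ - _); exact: linearZ_LR.
have [r [-> rb rmin _]] := opnormE hz ST.
rewrite io_lt; split=> [re|[d de /rmin rd]]; first by exists r.
by apply: le_lt_trans rd _; rewrite gt_max de e0.
Qed.

End Operator.
End ScalarTheory.

(** * The properties with real parameters *)

Section Properties.
Variables (K : numFieldType) (R : realType) (sc : scalars K R).
Local Notation io := (io sc).
Local Notation nx := (nx sc).
Variables X Y : completeNormedModType K.
Implicit Types (S T : {linear X -> Y}) (x : X).
Local Notation norm_one := (@norm_one _ _ sc X Y).
Local Notation op_near := (@op_near _ _ sc X Y).

Lemma nx_eq1 (Z : normedModType K) (z : Z) : (nx z = 1) <-> (`|z| = 1).
Proof.
rewrite (nxE sc) -(io1 sc); split=> [->//|h]; exact: (@io_inj _ _ sc).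
Qed.

Lemma nx_lt (Z : normedModType K) (z : Z) a : (`|z| < io a) = (nx z < a).
Proof. by rewrite (nxE sc) io_lt. Qed.

Lemma norm_one_near (e : R) S T : 0 < e -> norm_one S -> norm_one T ->
  opnorm (S \- T) < io e <-> op_near e S T.
Proof.
move=> e0 [S1 _] [T1 _]; apply: (@op_nearP _ _ sc _ _ _ _ _ 2) => // x /=.
apply: le_trans (nxD _ _ _) _; rewrite nxN.
by have := S1 x; have := T1 x; lra.
Qed.

Lemma approx_op_pointP (e : R) T x : 0 < e -> norm_one T ->
  approx_op_point (io e) T x <-> exists S x0,
    [/\ norm_one S, nx x0 = 1, nx (S x0) = 1, nx (x0 - x) < e & op_near e S T].
Proof.
move=> e0 T1; split=> -[S [x0 []]].
  move=> /(op_sphereP sc) S1 /nx_eq1 x01 /nx_eq1 Sx0; rewrite nx_lt => xx0 ST.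
  by exists S, x0; split=> //; apply/norm_one_near.
move=> S1 x01 Sx0 xx0 ST; exists S, x0; split=> //.
- exact/(op_sphereP sc).
- exact/nx_eq1.
- exact/nx_eq1.
- by rewrite nx_lt.
- exact/norm_one_near.
Qed.

Lemma approx_opP (e : R) T x : 0 < e -> norm_one T ->
  approx_op (io e) T x <-> exists S,
    [/\ norm_one S, nx (S x) = 1 & op_near e S T].
Proof.
move=> e0 T1; split=> -[S []].
  move=> /(op_sphereP sc) S1 /nx_eq1 Sx ST.
  by exists S; split=> //; apply/norm_one_near.
move=> S1 Sx ST; exists S; split.
- exact/(op_sphereP sc).
- exact/nx_eq1.
- exact/norm_one_near.
Qed.

Lemma approx_pointP (e : R) T x :
  approx_point (io e) T x <-> exists x0,
    [/\ nx x0 = 1, nx (T x0) = 1 & nx (x0 - x) < e].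
Proof.
split=> -[x0 []].
  by move=> /nx_eq1 x01 /nx_eq1 Sx0; rewrite nx_lt => xx0; exists x0.
move=> x01 Sx0 xx0; exists x0; split.
- exact/nx_eq1.
- exact/nx_eq1.
- by rewrite nx_lt.
Qed.

Variables (C : K -> {linear X -> Y} -> X -> Prop).
Variables (D : R -> {linear X -> Y} -> X -> Prop).
Hypothesis CD : forall e T x, 0 < e -> norm_one T -> C (io e) T x <-> D e T x.

(** Positive elements of [K] are images of positive reals, so eps and eta may be taken real. The
    transfer is made once for each dependence of eta, for any conclusion [C] with a real form
    [D]. *)
Lemma uniform_propP : uniform_prop C <-> forall e, 0 < e ->
  exists2 d, 0 < d & forall T x, norm_one T -> nx x = 1 -> 1 - d < nx (T x) ->
  D e T x.
Proof.
split=> h e e0.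
  have [|_ /(gt0_io sc)[d d0 ->] hd] := h (io e); first by rewrite io_gt0.
  exists d => // T x T1 x1 Tx; apply/(CD _ e0 T1)/hd.
  - exact/(op_sphereP sc).
  - exact/nx_eq1.
  - by rewrite (nxE sc) -(io1 sc) -ioB io_lt.
have [r r0 ->] := gt0_io sc e0; have [d d0 hd] := h r r0.
exists (io d); first by rewrite io_gt0.
move=> T x /(op_sphereP sc) T1 /nx_eq1 x1.
by rewrite (nxE sc) -(io1 sc) -ioB io_lt => Tx; apply/(CD _ r0 T1)/hd.
Qed.

Lemma point_propP : point_prop C <-> forall e x, 0 < e -> nx x = 1 ->
  exists2 d, 0 < d & forall T, norm_one T -> 1 - d < nx (T x) -> D e T x.
Proof.
split=> [h e x e0 /nx_eq1 x1|h e e0 x /nx_eq1 x1].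
  have [|_ /(gt0_io sc)[d d0 ->] hd] := h (io e) _ x x1.
    by rewrite io_gt0.
  exists d => // T T1 Tx; apply/(CD _ e0 T1)/hd; first exact/(op_sphereP sc).
  by rewrite (nxE sc) -(io1 sc) -ioB io_lt.
have [r r0 ->] := gt0_io sc e0; have [d d0 hd] := h r x r0 x1.
exists (io d); first by rewrite io_gt0.
move=> T /(op_sphereP sc) T1.
by rewrite (nxE sc) -(io1 sc) -ioB io_lt => Tx; apply/(CD _ r0 T1)/hd.
Qed.

Lemma operator_propP : operator_prop C <-> forall e T, 0 < e -> norm_one T ->
  exists2 d, 0 < d & forall x, nx x = 1 -> 1 - d < nx (T x) -> D e T x.
Proof.
split=> [h e T e0 T1|h e e0 T /(op_sphereP sc) T1].
  have [||_ /(gt0_io sc)[d d0 ->] hd] := h (io e) _ T; first by rewrite io_gt0.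
    exact/(op_sphereP sc).
  exists d => // x x1 Tx; apply/(CD _ e0 T1)/hd; first exact/nx_eq1.
  by rewrite (nxE sc) -(io1 sc) -ioB io_lt.
have [r r0 ->] := gt0_io sc e0; have [d d0 hd] := h r T r0 T1.
exists (io d); first by rewrite io_gt0.
move=> x /nx_eq1 x1.
by rewrite (nxE sc) -(io1 sc) -ioB io_lt => Tx; apply/(CD _ r0 T1)/hd.
Qed.

End Properties.

Lemma linear_ex (K : numFieldType) (X Y : lmodType K) (f : X -> Y) :
  (forall a x y, f (a *: x + y) = a *: f x + f y) ->
  exists F : {linear X -> Y}, F =1 f.
Proof.
move=> fl.
pose m := GRing.isLinear.Build K X Y *:%R f fl.
pose F : {linear X -> Y} := HB.pack f m.
by exists F.
Qed.

Section RealForms.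
Variables (K : numFieldType) (R : realType) (sc : scalars K R).
Variables X Y : completeNormedModType K.
Implicit Types (S T : {linear X -> Y}) (x : X).
Local Notation nx := (nx sc).
Local Notation norm_one := (@norm_one _ _ sc X Y).
Local Notation op_near := (@op_near _ _ sc X Y).

Definition attain_op_point (e : R) T x := exists S x0,
  [/\ norm_one S, nx x0 = 1, nx (S x0) = 1, nx (x0 - x) < e & op_near e S T].

Definition attain_op (e : R) T x := exists S,
  [/\ norm_one S, nx (S x) = 1 & op_near e S T].

Definition attain_point (e : R) T x := exists x0,
  [/\ nx x0 = 1, nx (T x0) = 1 & nx (x0 - x) < e].

Lemma BPBpP : BPBp K X Y <-> forall e, 0 < e -> exists2 d, 0 < d & forall T x,
  norm_one T -> nx x = 1 -> 1 - d < nx (T x) -> attain_op_point e T x.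
Proof. by apply: uniform_propP => e T x; exact: approx_op_pointP. Qed.

Lemma BPBppP : BPBpp K X Y <-> forall e, 0 < e -> exists2 d, 0 < d & forall T x,
  norm_one T -> nx x = 1 -> 1 - d < nx (T x) -> attain_op e T x.
Proof. by apply: uniform_propP => e T x; exact: approx_opP. Qed.

Lemma BPBopP : BPBop K X Y <-> forall e, 0 < e -> exists2 d, 0 < d & forall T x,
  norm_one T -> nx x = 1 -> 1 - d < nx (T x) -> attain_point e T x.
Proof. by apply: uniform_propP => e T x _ _; exact: approx_pointP. Qed.

Lemma LpP : Lp K X Y <-> forall e x, 0 < e -> nx x = 1 ->
  exists2 d, 0 < d & forall T, norm_one T -> 1 - d < nx (T x) ->
  attain_op_point e T x.
Proof. by apply: point_propP => e T x; exact: approx_op_pointP. Qed.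

Lemma LppP : Lpp K X Y <-> forall e x, 0 < e -> nx x = 1 ->
  exists2 d, 0 < d & forall T, norm_one T -> 1 - d < nx (T x) -> attain_op e T x.
Proof. by apply: point_propP => e T x; exact: approx_opP. Qed.

Lemma LopP : Lop K X Y <-> forall e x, 0 < e -> nx x = 1 ->
  exists2 d, 0 < d & forall T, norm_one T -> 1 - d < nx (T x) ->
  attain_point e T x.
Proof. by apply: point_propP => e T x _ _; exact: approx_pointP. Qed.

Lemma LpoP : Lpo K X Y <-> forall e T, 0 < e -> norm_one T ->
  exists2 d, 0 < d & forall x, nx x = 1 -> 1 - d < nx (T x) -> attain_op e T x.
Proof. by apply: operator_propP => e T x; exact: approx_opP. Qed.

Lemma LooP : Loo K X Y <-> forall e T, 0 < e -> norm_one T ->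
  exists2 d, 0 < d & forall x, nx x = 1 -> 1 - d < nx (T x) ->
  attain_point e T x.
Proof. by apply: operator_propP => e T x _ _; exact: approx_pointP. Qed.

End RealForms.

(** * The formal implications *)

Section Implications.
Variables (K : numFieldType) (R : realType) (sc : scalars K R).

Lemma uniform_point (X Y : completeNormedModType K) C :
  @uniform_prop K X Y C -> point_prop C.
Proof.
move=> h e e0 x x1; have [d d0 hd] := h e e0.
by exists d => // T T1; apply: hd.
Qed.

Lemma uniform_operator (X Y : completeNormedModType K) C :
  @uniform_prop K X Y C -> operator_prop C.
Proof.
move=> h e e0 T T1; have [d d0 hd] := h e e0.
by exists d => // x x1; apply: hd.
Qed.

Lemma attain_op_weaken (X Y : completeNormedModType K) e (T : {linear X -> Y}) x : 0 < e ->
  nx sc x = 1 -> attain_op sc e T x -> attain_op_point sc e T x.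
Proof.
move=> e0 x1 [S [S1 Sx ST]]; exists S, x; split=> //.
by rewrite subrr nx0.
Qed.

Lemma attain_point_weaken (X Y : completeNormedModType K) e (T : {linear X -> Y}) x : 0 < e ->
  norm_one sc T -> attain_point sc e T x -> attain_op_point sc e T x.
Proof.
move=> e0 T1 [x0 [x01 Tx0 xx0]]; exists T, x0; split=> //.
by exists 0 => // z /=; rewrite subrr nx0 mul0r.
Qed.

Lemma BPBpp_BPBp : pair_implies (BPBpp K) (BPBp K).
Proof.
move=> X Y /(BPBppP sc) h; apply/(BPBpP sc) => e e0; have [d d0 hd] := h e e0.
by exists d => // T x T1 x1 Tx; apply: attain_op_weaken (hd _ _ T1 x1 Tx).
Qed.

Lemma BPBop_BPBp : pair_implies (BPBop K) (BPBp K).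
Proof.
move=> X Y /(BPBopP sc) h; apply/(BPBpP sc) => e e0; have [d d0 hd] := h e e0.
by exists d => // T x T1 x1 Tx; apply: attain_point_weaken (hd _ _ T1 x1 Tx).
Qed.

Lemma Lpp_Lp : pair_implies (Lpp K) (Lp K).
Proof.
move=> X Y /(LppP sc) h; apply/(LpP sc) => e x e0 x1.
have [d d0 hd] := h e x e0 x1.
by exists d => // T T1 Tx; apply: attain_op_weaken (hd _ T1 Tx).
Qed.

Lemma Lop_Lp : pair_implies (Lop K) (Lp K).
Proof.
move=> X Y /(LopP sc) h; apply/(LpP sc) => e x e0 x1.
have [d d0 hd] := h e x e0 x1.
by exists d => // T T1 Tx; apply: attain_point_weaken (hd _ T1 Tx).
Qed.

Lemma Lpo_Lo : pair_implies (Lpo K) (Lo K).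
Proof.
move=> X Y h e e0 T T1; have [d d0 hd] := h e e0 T T1.
exists d => // x x1 Tx; have [S [S1 Sx ST]] := hd x x1 Tx.
by exists S, x; split=> //; rewrite subrr normr0.
Qed.

Lemma Loo_Lo : pair_implies (Loo K) (Lo K).
Proof.
move=> X Y h; suff : forall e, 0 < e -> forall T, op_sphere X Y T ->
    exists2 d : K, 0 < d & forall x, unit_sphere X x -> 1 - d < `|T x| ->
    approx_op_point e T x by [].
move=> _ /(gt0_io sc)[e e0 ->] T T1.
have [||d d0 hd] := h (io sc e) _ T => //; first by rewrite io_gt0.
exists d => // x x1 Tx; apply/(approx_op_pointP x e0).
  exact/(op_sphereP sc).
apply: attain_point_weaken => //; first exact/(op_sphereP sc).
by apply/approx_pointP/hd.
Qed.

End Implications.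

(** * Seminorms with support forms *)

Section Seminorms.
Variables (K : numFieldType) (R : realType) (sc : scalars K R).
Local Notation io := (io sc).
Local Notation rn := (rn sc).

Definition hyp (a b : R) := Num.sqrt (a ^+ 2 + b ^+ 2).

Lemma hyp_ge0 a b : 0 <= hyp a b. Proof. exact: sqrtr_ge0. Qed.

Lemma sqr_hyp a b : hyp a b ^+ 2 = a ^+ 2 + b ^+ 2.
Proof. by rewrite sqr_sqrtr // addr_ge0 ?sqr_ge0. Qed.

Lemma le_of_sqr (a b : R) : 0 <= b -> a ^+ 2 <= b ^+ 2 -> a <= b.
Proof.
move=> b0 h; have [a0|a0] := leP 0 a; last by rewrite ltW // (lt_le_trans a0).
by rewrite -(@ler_sqr _ a b) // nnegrE.
Qed.

Lemma hyp_le a b c d : 0 <= a -> 0 <= b -> a <= c -> b <= d ->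
  hyp a b <= hyp c d.
Proof.
move=> a0 b0 ac bd; apply: le_of_sqr; rewrite ?hyp_ge0 // !sqr_hyp.
by apply: lerD; rewrite ler_sqr ?nnegrE // (le_trans _ ac, le_trans _ bd).
Qed.

Lemma hyp_leD a b : 0 <= a -> 0 <= b -> hyp a b <= a + b.
Proof.
move=> a0 b0; apply: le_of_sqr; rewrite ?addr_ge0 // sqr_hyp; nra.
Qed.

Lemma hyp_gel a b : 0 <= a -> a <= hyp a b.
Proof. move=> a0; apply: le_of_sqr; rewrite ?hyp_ge0 // sqr_hyp; nra. Qed.

Lemma hyp_ger a b : 0 <= b -> b <= hyp a b.
Proof. move=> a0; apply: le_of_sqr; rewrite ?hyp_ge0 // sqr_hyp; nra. Qed.

Lemma cauchy_schwarz2 a b c d : a * c + b * d <= hyp a b * hyp c d.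
Proof.
apply: le_of_sqr; first by rewrite mulr_ge0 ?hyp_ge0.
rewrite exprMn !sqr_hyp; have := sqr_ge0 (a * d - b * c); nra.
Qed.

Variable I : Type.
Implicit Types (p q : (I -> K^o) -> R) (v w : I -> K^o).

Definition lin_form (V : lmodType K) (f : V -> K) :=
  forall a (v w : V), f (a *: v + w) = a * f v + f w.

(** A Hahn-Banach form is given at each point, together with continuity for coordinatewise
    ultralimits. The first clause alone makes [p] a seminorm ([goodD], [goodZ]). Both clauses pass
    to sums, maxima and Euclidean combinations, from which all the norms below are made. *)
Record good p : Prop := Good {
  good_support : forall v, exists f, [/\ lin_form f,
    forall w, rn (f w) <= p w & f v = io (p v)];
  good_ulim : forall (u : nat -> I -> K^o) v,
    (forall i, ulim (fun n => rn (u n i - v i)) 0) ->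
    ulim (fun n => p (u n - v)) 0 }.

Lemma good_ge0 p v : good p -> 0 <= p v.
Proof.
by move=> gp; have [f [_ fp _]] := good_support gp v;
  apply: le_trans (fp v); rewrite rn_ge0.
Qed.

Lemma good_abs p v : good p -> `|p v| = p v.
Proof. by move=> gp; rewrite ger0_norm // good_ge0. Qed.

Lemma lin_formD (V : lmodType K) (f : V -> K) (v w : V) : lin_form f -> f (v + w) = f v + f w.
Proof. by move=> /(_ 1 v w); rewrite scale1r mul1r. Qed.

Lemma lin_form0 (V : lmodType K) (f : V -> K) : lin_form f -> f 0 = 0.
Proof.
by move=> /(lin_formD 0 0) /eqP; rewrite addr0 addrC -subr_eq subrr => /eqP.
Qed.

Lemma lin_formZ (V : lmodType K) (f : V -> K) a (v : V) : lin_form f -> f (a *: v) = a * f v.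
Proof.
by move=> fl; rewrite -[a *: v]addr0 fl lin_form0 // addr0.
Qed.

Lemma lin_formB (V : lmodType K) (f : V -> K) (v w : V) : lin_form f -> f (v - w) = f v - f w.
Proof.
by move=> fl; rewrite lin_formD // -scaleN1r lin_formZ // mulN1r.
Qed.

Lemma goodD p v w : good p -> p (v + w) <= p v + p w.
Proof.
move=> gp; have [f [fl fp E]] := good_support gp (v + w).
rewrite -[leLHS]ger0_norm ?good_ge0 // -(rn_io sc) -E lin_formD //.
by apply: le_trans (rnD _ _ _) _; rewrite lerD.
Qed.

Lemma goodZ_le p a v : good p -> p (a *: v) <= rn a * p v.
Proof.
move=> gp; have [f [fl fp E]] := good_support gp (a *: v).
rewrite -[leLHS]ger0_norm ?good_ge0 // -(rn_io sc) -E lin_formZ // rnM.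
by rewrite ler_wpM2l // rn_ge0.
Qed.

Lemma good0 p : good p -> p 0 = 0.
Proof.
move=> gp; apply/eqP; rewrite eq_le good_ge0 // andbT.
by have := goodZ_le 0 0 gp; rewrite scale0r rn0 mul0r.
Qed.

Lemma goodZ p a v : good p -> p (a *: v) = rn a * p v.
Proof.
move=> gp; apply/eqP; rewrite eq_le goodZ_le //=.
have [->|a0] := eqVneq a 0; first by rewrite rn0 mul0r good_ge0.
rewrite -[in leLHS](scalerK a0 v).
apply: le_trans (ler_wpM2l (rn_ge0 _ _) (goodZ_le _ _ gp)) _.
by rewrite mulrA rnV divff ?mul1r // rn_eq0.
Qed.

Lemma goodN p v : good p -> p (- v) = p v.
Proof. by move=> gp; rewrite -scaleN1r goodZ // rnN rn1 mul1r. Qed.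

Lemma goodB p v w : good p -> p v - p w <= p (v - w).
Proof. by move=> gp; rewrite lerBlDr (le_trans _ (goodD _ _ gp)) // subrK. Qed.

Lemma good_dist p v w : good p -> `|p v - p w| <= p (v - w).
Proof.
by move=> gp; rewrite ler_norml goodB // andbT lerNl opprB -(goodN (v - w)) //
  opprB goodB.
Qed.

Lemma good_ulim_val p (u : nat -> I -> K^o) v : good p ->
  (forall i, ulim (fun n => rn (u n i - v i)) 0) -> ulim (fun n => p (u n)) (p v).
Proof.
move=> gp h; apply: ulim_dist (good_ulim gp h) => n; exact: good_dist.
Qed.

Lemma good_form (f : (I -> K^o) -> K) : lin_form f ->
  (forall (u : nat -> I -> K^o) v,
    (forall i, ulim (fun n => rn (u n i - v i)) 0) ->
    ulim (fun n => rn (f (u n - v))) 0) -> good (fun v => rn (f v)).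
Proof.
move=> fl fc; split=> // v; have [t t1 tf] := phase sc (f v).
exists (fun w => t * f w); split=> //.
- by move=> a x y; rewrite fl mulrDr mulrCA.
- by move=> w; rewrite rnM t1 mul1r.
Qed.

Lemma good_coord i : good (fun v => rn (v i)).
Proof. by apply: good_form => // u v; exact. Qed.

Lemma good_add p q : good p -> good q -> good (fun v => p v + q v).
Proof.
move=> gp gq; split=> [v|u v h].
  have [f [fl fp fv]] := good_support gp v.
  have [g [gl gq' gv]] := good_support gq v.
  exists (fun w => f w + g w); split.
  - by move=> a x y; rewrite fl gl mulrDr addrACA.
  - by move=> w; apply: le_trans (rnD _ _ _) _; rewrite lerD.
  - by rewrite fv gv ioD.
by rewrite -[X in ulim _ X]addr0; apply: ulimD; apply: good_ulim.
Qed.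

Lemma good_scale p c : 0 <= c -> good p -> good (fun v => c * p v).
Proof.
move=> c0 gp; split=> [v|u v h].
  have [f [fl fp fv]] := good_support gp v.
  exists (fun w => io c * f w); split.
  - by move=> a x y; rewrite fl mulrDr mulrCA.
  - by move=> w; rewrite rnM rn_io ger0_norm // ler_wpM2l.
  - by rewrite fv ioM.
by rewrite -[X in ulim _ X](mulr0 c); apply: ulimZ; apply: good_ulim.
Qed.

Lemma good_le_ulim p q : good p -> good q -> forall r : (I -> K^o) -> R,
  (forall v, 0 <= r v <= p v + q v) -> forall (u : nat -> I -> K^o) v,
    (forall i, ulim (fun n => rn (u n i - v i)) 0) ->
    ulim (fun n => r (u n - v)) 0.
Proof.
move=> gp gq r hr u v h.
apply: ulim_squeeze0 (good_ulim (good_add gp gq) h) => n.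
by have /andP[r0 rpq] := hr (u n - v); rewrite ger0_norm.
Qed.

Lemma good_max p q : good p -> good q -> good (fun v => Num.max (p v) (q v)).
Proof.
move=> gp gq; split=> [v|].
  have [f [fl fp fv]] := good_support gp v.
  have [g [gl gq' gv]] := good_support gq v.
  have [pq|qp] := leP (p v) (q v).
    by exists g; split=> // w; rewrite le_max gq' orbT.
  by exists f; split=> // w; rewrite le_max fp.
apply: (good_le_ulim gp gq (r := fun v => Num.max (p v) (q v))) => v; rewrite le_max good_ge0 //= ge_max.
by rewrite lerDl lerDr !good_ge0.
Qed.

(** The two support forms are combined with the coefficients [p v / h] and [q v / h]; Cauchy-Schwarz
    bounds the result. *)
Lemma good_hyp p q : good p -> good q -> good (fun v => hyp (p v) (q v)).
Proof.
move=> gp gq; split=> [v|]; last first.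
  by apply: (good_le_ulim gp gq (r := fun v => hyp (p v) (q v))) => v;
    rewrite hyp_ge0 hyp_leD ?good_ge0.
have [f [fl fp fv]] := good_support gp v.
have [g [gl gq' gv]] := good_support gq v.
set h := hyp _ _.
exists (fun w => io (p v / h) * f w + io (q v / h) * g w); split.
- by move=> a x y; rewrite fl gl; ring.
- move=> w; apply: le_trans (rnD _ _ _) _; rewrite !rnM !rn_io.
  rewrite !ger0_norm ?divr_ge0 ?hyp_ge0 ?good_ge0 //.
  (* When [h] is 0 both coefficients are 0, as division by 0 gives 0. *)
  have [h0|h0] := eqVneq h 0.
    by rewrite h0 !invr0 !mulr0 !mul0r addr0 hyp_ge0.
  have hp : 0 < h by rewrite lt_neqAle eq_sym h0 hyp_ge0.
  rewrite mulrAC [X in _ + X]mulrAC -mulrDl ler_pdivrMr //.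
  rewrite [leRHS]mulrC; apply: le_trans (cauchy_schwarz2 _ _ _ _).
  by apply: lerD; rewrite ler_wpM2l ?good_ge0.
- rewrite fv gv -!ioM -ioD; congr io.
  rewrite mulrAC [X in _ + X]mulrAC -mulrDl -!expr2 -sqr_hyp -/h.
  have [->|h0] := eqVneq h 0; first by rewrite invr0 mulr0.
  by rewrite expr2 mulfK.
Qed.

End Seminorms.

                                                        

(** * The Banach space of a family of seminorms *)

Record family (K : numFieldType) (R : realType) (sc : scalars K R) := Family {
  fI : Type;
  fJ : Type;
  fs : fJ -> (fI -> K^o) -> R;
  fs_good : forall j, good sc (fs j);
  fs_coord : forall i, exists c j, forall v, rn sc (v i) <= c * fs j v;
  fj0 : fJ }.

Section Space.
Variables (K : numFieldType) (R : realType) (sc : scalars K R).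
Variable F : family sc.
Local Notation io := (io sc).
Local Notation rn := (rn sc).
Local Notation fs := (@fs _ _ _ F).

Definition fbdd : {pred (fI F -> K^o)} :=
  fun v => `[< exists M, forall j, fs j v <= M >].

Lemma fbddP v : reflect (exists M, forall j, fs j v <= M) (v \in fbdd).
Proof. exact: asboolP. Qed.

Lemma fbdd_submod : submod_closed fbdd.
Proof.
split; first by apply/fbddP; exists 0 => j; rewrite (good0 (fs_good j)).
move=> a v w /fbddP[M hM] /fbddP[M' hM']; apply/fbddP.
exists (rn a * M + M') => j.
apply: le_trans (goodD _ _ (fs_good j)) _; rewrite (goodZ _ _ (fs_good j)).
by rewrite lerD // ler_wpM2l // rn_ge0.
Qed.

HB.instance Definition _ := GRing.isSubmodClosed.Build K (fI F -> K^o) fbdd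
  fbdd_submod.

(** The norm will be the supremum of the seminorms; [fs_coord] makes coordinates continuous, hence
    the norm separating, and [fj0] keeps the supremum over a nonempty set. *)
Record space := Space { coords : fI F -> K^o; coords_bdd : coords \in fbdd }.

HB.instance Definition _ := [isSub for coords].
HB.instance Definition _ := [Choice of space by <:].
HB.instance Definition _ := [SubChoice_isSubLmodule of space by <:].

Implicit Types x y : space.

Lemma coordsD x y : coords (x + y) = coords x + coords y. Proof. by []. Qed.
Lemma coordsB x y : coords (x - y) = coords x - coords y. Proof. by []. Qed.
Lemma coordsZ a x : coords (a *: x) = a *: coords x. Proof. by []. Qed.
Lemma coords0 : coords 0 = 0. Proof. by []. Qed.

Lemma coords_inj x y : coords x =1 coords y -> x = y.
Proof. by move=> /funext h; apply: val_inj. Qed.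

Definition snorm x : R := sup [set fs j (coords x) | j in setT].

Lemma has_sup_snorm x : has_sup [set fs j (coords x) | j in setT].
Proof.
split; first by exists (fs (fj0 F) (coords x)), (fj0 F).
by have /fbddP[M hM] := coords_bdd x; exists M => _ [j _ <-].
Qed.

Lemma fs_le_snorm j x : fs j (coords x) <= snorm x.
Proof. by apply: sup_upper_bound; [exact: has_sup_snorm|exists j]. Qed.

Lemma snorm_le c x : (forall j, fs j (coords x) <= c) -> snorm x <= c.
Proof.
move=> h; apply: sup_le_ub; first by exists (fs (fj0 F) (coords x)), (fj0 F).
by move=> _ [j _ <-].
Qed.

Lemma snorm_ge0 x : 0 <= snorm x.
Proof. by apply: le_trans (fs_le_snorm (fj0 F) x); apply: good_ge0 (fs_good _). Qed.

Lemma snormD x y : snorm (x + y) <= snorm x + snorm y.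
Proof.
apply: snorm_le => j; apply: le_trans (goodD _ _ (fs_good j)) _.
by rewrite lerD ?fs_le_snorm.
Qed.

Lemma snormZ a x : snorm (a *: x) = rn a * snorm x.
Proof.
apply/eqP; rewrite eq_le; apply/andP; split.
  apply: snorm_le => j; rewrite (goodZ _ _ (fs_good j)).
  by rewrite ler_wpM2l ?rn_ge0 ?fs_le_snorm.
have [->|a0] := eqVneq a 0; first by rewrite rn0 mul0r snorm_ge0.
have ra : 0 < rn a by rewrite lt_neqAle eq_sym rn_eq0 a0 rn_ge0.
rewrite mulrC -ler_pdivlMr //; apply: snorm_le => j.
rewrite ler_pdivlMr // mulrC -(goodZ _ _ (fs_good j)) -coordsZ.
exact: fs_le_snorm.
Qed.

Lemma coord_bound i : exists2 c, 0 <= c &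
  forall x, rn (coords x i) <= c * snorm x.
Proof.
have [c [j h]] := fs_coord i; exists `|c| => // x.
apply: le_trans (h _) _; apply: le_trans (ler_norm _) _; rewrite normrM.
by rewrite ler_wpM2l // (good_abs _ (fs_good j)) fs_le_snorm.
Qed.

Lemma snorm0_eq0 x : snorm x = 0 -> x = 0.
Proof.
move=> x0; apply: coords_inj => i; apply: (@rn0_eq0 _ _ sc).
have [c _ /(_ x)] := coord_bound i; rewrite x0 mulr0 => h.
by apply/eqP; rewrite eq_le h rn_ge0.
Qed.

Fact io_snormD x y : io (snorm (x + y)) <= io (snorm x) + io (snorm y).
Proof. by rewrite -ioD io_le snormD. Qed.

Fact io_snormZ a x : io (snorm (a *: x)) = `|a| * io (snorm x).
Proof. by rewrite snormZ ioM -rnE. Qed.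

Fact io_snorm0_eq0 x : io (snorm x) = 0 -> x = 0.
Proof. by rewrite -(io0 sc) => /(@io_inj _ _ sc)/snorm0_eq0. Qed.

HB.instance Definition _ :=
  Lmodule_isNormed.Build K space io_snormD io_snormZ io_snorm0_eq0.

Lemma nx_snorm x : nx sc x = snorm x.
Proof. by rewrite /nx /= rn_io ger0_norm // snorm_ge0. Qed.

(** Each seminorm is continuous for coordinatewise ultralimits, so their supremum is lower
    semicontinuous and balls are compact. This stands in for weak compactness and yields
    completeness. *)
Lemma space_ulim (u : nat -> space) (M : R) : (forall n, snorm (u n) <= M) ->
  exists x, [/\ snorm x <= M,
    forall i, ulim (fun n => rn (coords (u n) i - coords x i)) 0 &
    forall y e, ultra [set n | snorm (y - u n) <= e] -> snorm (y - x) <= e].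
Proof.
move=> hM.
have hi i : exists l, ulim (fun n => rn (coords (u n) i - l)) 0.
  have [c c0 hc] := coord_bound i.
  apply: (@rn_ulim _ _ sc _ (c * M)) => n; apply: le_trans (hc _) _.
  by rewrite ler_wpM2l.
pose v i : K^o := sval (cid (hi i)).
have hv i : ulim (fun n => rn (coords (u n) i - v i)) 0 := svalP (cid (hi i)).
have vM j : fs j v <= M.
  apply: ulim_le (good_ulim_val (fs_good j) hv) (ulim_cst M).
  apply: filterS filterT => n _ /=; exact: le_trans (fs_le_snorm _ _) (hM n).
have vb : v \in fbdd by apply/fbddP; exists M.
exists (Space vb); split=> //; first exact: snorm_le.
move=> y e h; apply: snorm_le => j.
have hy i : ulim (fun n => rn ((coords y - coords (u n)) i -
    (coords y - v) i)) 0.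
  apply: ulim_ext (hv i) => n; rewrite rnBC; congr rn.
  have E (a b : fI F -> K^o) : (a - b) i = a i - b i by [].
  by rewrite !E opprB addrC addrA subrK.
apply: ulim_le (good_ulim_val (fs_good j) hy) (ulim_cst e).
apply: filterS h => n /= h'; apply: le_trans h'.
exact: (fs_le_snorm j (y - u n)).
Qed.

(** Centres of shrinking balls belonging to the filter have an ultralimit; the last clause of
    [space_ulim] turns their mutual distances into distances to it. *)
Lemma space_complete (G : set_system space) :
  ProperFilter G -> cauchy G -> cvg G.
Proof.
move=> GP /cauchyP Gc.
have ex n : exists x, G [set y | snorm (x - y) < n.+1%:R^-1].
  have [|x hx] := Gc (io n.+1%:R^-1); first by rewrite io_gt0 invr_gt0.
  exists x; apply: filterS hx => y.
  by rewrite -ball_normE /= io_lt.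
pose u n := sval (cid (ex n)).
have hu n : G [set y | snorm (u n - y) < n.+1%:R^-1] := svalP (cid (ex n)).
have umn m n : snorm (u n - u m) <= n.+1%:R^-1 + m.+1%:R^-1.
  have [y [/= h1 h2]] := filter_ex (filterI (hu n) (hu m)).
  rewrite -(nx_snorm (u n - u m)); apply: le_trans (nx_triangle _ _ y _) _.
  by rewrite [X in _ + X]nxBC !nx_snorm lerD // ltW.
have ub n : snorm (u n) <= snorm (u 0%N) + 2.
  rewrite -(subrK (u 0%N) (u n)); apply: le_trans (snormD _ _) _.
  rewrite addrC lerD2l; apply: le_trans (umn _ _) _.
  by rewrite invr1 -[leRHS]/(1 + 1) lerD2r invf_le1 // ler1n.
have [x [_ _ hx]] := space_ulim ub.
have ux n : snorm (u n - x) <= 2 * n.+1%:R^-1.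
  apply: hx; apply: (@ultra_eventually _ n) => m nm /=.
  apply: le_trans (umn _ _) _; rewrite mulr_natl mulr2n lerD2l.
  by rewrite lef_pV2 ?posrE ?ltr0n // ler_nat.
apply/cvg_ex; exists x; apply/fcvg_ballP => _ /(gt0_io sc)[e e0 ->].
have [n hn] := ltr_add_invr (divr_gt0 e0 (ltr0n R 3)).
rewrite add0r in hn.
apply: filterS (hu n) => y /= hy; rewrite -ball_normE /=.
rewrite (nxE sc) io_lt; apply: le_lt_trans (nx_triangle _ _ (u n) _) _.
rewrite nxBC !nx_snorm; have := ux n; move: hn hy.
by move: (n.+1%:R^-1) => a; lra.
Qed.

HB.instance Definition _ := Uniform_isComplete.Build space space_complete.

End Space.

Definition banach (K : numFieldType) (R : realType) (sc : scalars K R)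
  (F : family sc) : completeNormedModType K := space F.

(** * Operators, norm attainment and rotundity *)

Section Operators.
Variables (K : numFieldType) (R : realType) (sc : scalars K R).
Local Notation io := (io sc).
Local Notation rn := (rn sc).
Local Notation nx := (nx sc).

Lemma space_op_ex (X : normedModType K) (F : family sc)
    (f : X -> fI F -> K^o) c :
  (forall a x y, f (a *: x + y) = a *: f x + f y) ->
  (forall x j, fs j (f x) <= c * nx x) ->
  exists T : {linear X -> banach F}, (forall x, coords (T x) = f x) /\
    bdd_by sc T c.
Proof.
move=> fl fc.
have fb x : f x \in @fbdd _ _ _ F by apply/fbddP; exists (c * nx x).
pose g x : space F := Space (fb x).
have [T Tg] : exists T : {linear X -> banach F}, T =1 g.
  by apply: linear_ex => a x y; apply: val_inj; exact: fl.
exists T; split=> x; rewrite Tg //.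
by rewrite nx_snorm; apply: snorm_le => j; exact: fc.
Qed.

Lemma norm_oneP (X Y : normedModType K) (T : X -> Y) x :
  bdd_by sc T 1 -> nx x <= 1 -> nx (T x) = 1 -> norm_one sc T.
Proof.
move=> T1 x1 Tx; split=> // e e0; exists x => //.
by rewrite Tx ltrBlDr ltrDl.
Qed.

Lemma norm_one_le (X Y : normedModType K) (T : X -> Y) x :
  norm_one sc T -> nx (T x) <= nx x.
Proof. by move=> [/(_ x)]; rewrite mul1r. Qed.

Lemma op_near_le (X Y : normedModType K) e (S T : X -> Y) x :
  op_near sc e S T -> nx (S x - T x) <= e * nx x.
Proof.
move=> [c ce /(_ x)] /= h; apply: le_trans h _.
by rewrite ler_wpM2r ?nx_ge0 // ltW.
Qed.

(** Rescales a contraction to norm one without computing its norm: [c] is the inverse of that norm,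
    and the value at [x] keeps [c] close to 1. *)
Lemma normalize_op (X Y : normedModType K) (T : {linear X -> Y}) x d :
  bdd_by sc T 1 -> nx x = 1 -> d < 1 -> 1 - d < nx (T x) ->
  exists T' : {linear X -> Y}, exists c : R, [/\ norm_one sc T',
    (forall z, T' z = io c *: T z), 1 <= c & c * (1 - d) < 1].
Proof.
move=> T1 x1 d1 Tx.
have [r [_ Tr rmin rsharp]] := opnormE (linearZ_LR T) T1.
have dr : 1 - d < r.
  by apply: lt_le_trans Tx _; have := Tr x; rewrite x1 mulr1.
have r0 : 0 < r by apply: lt_trans dr; rewrite subr_gt0.
have r1 : r <= 1.
  by have := rmin _ T1; rewrite (max_idPl _) // ler01.
have [T' T'E] : exists T' : {linear X -> Y}, T' =1 (fun z => io r^-1 *: T z).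
  apply: linear_ex => a y z; rewrite linearP scalerDr.
  by rewrite !scalerA [io _ * a]mulrC.
exists T', r^-1; split=> //.
- split=> [z|e e0]; first rewrite T'E nxZr ?invr_ge0 ?(ltW r0) // mul1r.
    by rewrite mulrC ler_pdivrMr // [_ * r]mulrC.
  have er : 0 < e * r by rewrite mulr_gt0.
  have [z z1 hz] := rsharp _ er; exists z => //.
  rewrite T'E nxZr ?invr_ge0 ?(ltW r0) // mulrC ltr_pdivlMr //.
  by rewrite mulrBl mul1r.
- by rewrite invf_ge1.
- by rewrite mulrC ltr_pdivrMr // mul1r.
Qed.

Lemma homogeneous_norm_ex (X : normedModType K) (g : X -> R) c :
  (forall a x, g (a *: x) = rn a * g x) -> (forall x, 0 <= g x <= c * nx x) ->
  exists r, [/\ 0 <= r, forall x, g x <= r * nx x &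
    forall e, 0 < e -> exists2 x, nx x <= 1 & r - e < g x].
Proof.
move=> gZ gc.
have g0 : g 0 = 0 by rewrite -(scale0r 0) gZ rn0 mul0r.
pose B := [set g x | x in [set x : X | nx x <= 1]].
have B0 : B 0 by exists 0 => //=; rewrite nx0 ler01.
have Bub : ubound B (Num.max c 0).
  move=> _ [x /= x1 <-]; have /andP[_ h] := gc x; apply: le_trans h _.
  have [c0|c0] := leP c 0; last by rewrite ler_piMr // ltW.
  by rewrite mulr_le0_ge0 // nx_ge0.
have hB : has_sup B by split; [exists 0|exists (Num.max c 0)].
exists (sup B); split; first exact: sup_upper_bound.
- move=> x; have [x0|x0] := eqVneq (nx x) 0.
    have -> : x = 0 by apply: nx0_eq0 x0.
    by rewrite g0 nx0 mulr0.
  have xp : 0 < nx x by rewrite lt_neqAle eq_sym x0 nx_ge0.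
  have : B (g (io (nx x)^-1 *: x)).
    by exists (io (nx x)^-1 *: x) => //=; rewrite nx_normalize.
  move/(sup_upper_bound hB); rewrite gZ rn_io ger0_norm.
    by rewrite mulrC ler_pdivrMr.
  by rewrite invr_ge0 nx_ge0.
- by move=> e e0; have [_ [x /= x1 <-] h] := sup_adherent e0 hB; exists x.
Qed.

Lemma norm_ex (X : normedModType K) (f : X -> K) c : lin_form f ->
  (forall x, rn (f x) <= c * nx x) -> exists r, [/\ 0 <= r,
    forall x, rn (f x) <= r * nx x &
    forall e, 0 < e -> exists2 x, nx x <= 1 & r - e < rn (f x)].
Proof.
move=> fl fc; apply: (@homogeneous_norm_ex X (fun x => rn (f x)) c).
  by move=> a x; rewrite lin_formZ // rnM.
by move=> x; rewrite rn_ge0 fc.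
Qed.

(** A maximizing sequence in the ball has a coordinatewise ultralimit in the ball, and [g] is still
    maximal there. *)
Lemma homogeneous_attains (F : family sc) (g : banach F -> R) c :
  (forall a x, g (a *: x) = rn a * g x) -> (forall x, 0 <= g x <= c * nx x) ->
  (forall (u : nat -> banach F) x, (forall n, nx (u n) <= 1) -> nx x <= 1 ->
    (forall i, ulim (fun n => rn (coords (u n) i - coords x i)) 0) ->
    ulim (fun n => g (u n)) (g x)) ->
  exists x0, nx x0 <= 1 /\ forall z, g z <= g x0 * nx z.
Proof.
move=> gZ gc gu; have [r [_ gr rs]] := homogeneous_norm_ex gZ gc.
have ex n : exists2 x : banach F, nx x <= 1 & r - n.+1%:R^-1 < g x.
  by apply: rs; rewrite invr_gt0.
pose u n := s2val (cid2 (ex n)).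
have u1 n : nx (u n) <= 1 := s2valP (cid2 (ex n)).
have u2 n : r - n.+1%:R^-1 < g (u n) := s2valP' (cid2 (ex n)).
have u1' n : snorm (u n) <= 1 by rewrite -nx_snorm.
have [x [x1 ux _]] := space_ulim u1'.
exists x; rewrite nx_snorm; split=> // z.
apply: le_trans (gr z) _; rewrite ler_wpM2r ?nx_ge0 //.
have glim : ulim (fun n => g (u n)) (g x) by apply: gu; rewrite ?nx_snorm.
have rlim : ulim (fun n => r - n.+1%:R^-1) r.
  by have := ulimB (ulim_cst r) (@ulim_inv R); rewrite subr0.
by apply: ulim_le rlim glim; apply: filterS filterT => n _ /=; exact: ltW.
Qed.

(** Weak-star compactness of balls in the dual, through pointwise ultralimits. *)
Lemma ulim_form (X : normedModType K) (f : nat -> X -> K) c :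
  (forall n, lin_form (f n)) -> (forall n x, rn (f n x) <= c * nx x) ->
  exists g, [/\ lin_form g, forall x, rn (g x) <= c * nx x &
    forall x, ulim (fun n => rn (f n x - g x)) 0].
Proof.
move=> fl fc.
have ex x := rn_ulim (fun n => fc n x).
pose g x := sval (cid (ex x)).
have hg x : ulim (fun n => rn (f n x - g x)) 0 := svalP (cid (ex x)).
have g_lim x l : ulim (fun n => rn (f n x - l)) 0 -> g x = l.
  move=> hl; apply/eqP; rewrite -subr_eq0 -(rn_eq0 sc); apply/eqP.
  apply: (@ulim_unique _ (fun _ => rn (g x - l))); first exact: ulim_cst.
  apply: (@ulim_squeeze0 _ _ (fun n => rn (f n x - g x) + rn (f n x - l))).
    move=> n; rewrite ger0_norm ?rn_ge0 // (rnBC _ (f n x) (g x)).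
    by apply: le_trans (rnD _ _ _); rewrite addrA subrK.
  by rewrite -[0]addr0; apply: ulimD.
exists g; split=> //.
- move=> a x y; apply: g_lim.
  apply: (@ulim_squeeze0 _ _
    (fun n => rn a * rn (f n x - g x) + rn (f n y - g y))).
    move=> n; rewrite ger0_norm ?rn_ge0 // fl -rnM.
    by apply: le_trans (rnD _ _ _); rewrite mulrBr opprD addrACA.
  by have := ulimD (ulimZ (rn a) (hg x)) (hg y); rewrite mulr0 addr0.
- move=> x; apply: (@ulim_le _ (fun _ => rn (g x))
    (fun n => rn (f n x - g x) + c * nx x)).
  + apply: filterS filterT => n _ /=; rewrite rnBC -lerBlDr.
    apply: le_trans (rnB _ _ _); first by rewrite lerB.
  + exact: ulim_cst.
  + by have := ulimD (hg x) (ulim_cst (c * nx x)); rewrite add0r.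
Qed.

Lemma ulim_form_val (u : nat -> K) l l' : ulim (fun n => rn (u n - l)) 0 ->
  ulim (fun n => rn (u n - l')) 0 -> l = l'.
Proof.
move=> h h'; apply/eqP; rewrite -subr_eq0 -(rn_eq0 sc); apply/eqP.
apply: (@ulim_unique _ (fun _ => rn (l - l'))); first exact: ulim_cst.
apply: (@ulim_squeeze0 _ _ (fun n => rn (u n - l) + rn (u n - l'))).
  move=> n; rewrite ger0_norm ?rn_ge0 // (rnBC _ (u n) l).
  by apply: le_trans (rnD _ _ _); rewrite addrA subrK.
by rewrite -[0]addr0; apply: ulimD.
Qed.

Definition lur_at (X : normedModType K) (x : X) := forall e, 0 < e ->
  exists2 d, 0 < d &
  forall y, nx y <= 1 -> 2 - d < nx (x + y) -> nx (x - y) < e.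

(** A unimodular factor brings the values at [x] and [y] onto one ray, where moduli add. *)
Lemma align_form (X : lmodType K) (f : X -> K) (x y : X) : lin_form f ->
  exists2 t, rn t = 1 & rn (f (x + t *: y)) = rn (f x) + rn (f y).
Proof.
move=> fl; have [s s1 sx] := phase sc (f x); have [t t1 ty] := phase sc (f y).
exists (s^-1 * t); first by rewrite rnM rnV s1 t1 invr1 mulr1.
have s0 : s != 0 by rewrite -(rn_eq0 sc) s1 oner_eq0.
rewrite lin_formD // lin_formZ // -mulrA ty.
rewrite -[rn (f x + _)]mul1r -s1 -rnM mulrDr sx mulrA divff // mul1r.
by rewrite -ioD rn_io ger0_norm // addr_ge0 ?rn_ge0.
Qed.

Lemma lur_form (X : normedModType K) (f : X -> K) (x y : X) d :
  lin_form f -> (forall z, rn (f z) <= nx z) -> 2 - d < rn (f x) + rn (f y) ->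
  exists2 t, rn t = 1 & 2 - d < nx (x + t *: y).
Proof.
move=> fl f1 h; have [t t1 ht] := align_form x y fl.
by exists t => //; apply: lt_le_trans h _; rewrite -ht.
Qed.

End Operators.

                                                          

(** * Targets with the supremum norm *)

Section SupremumTarget.
Variables (K : numFieldType) (R : realType) (sc : scalars K R).
Local Notation io := (io sc).
Local Notation rn := (rn sc).
Local Notation nx := (nx sc).

Lemma snorm_gt (F : family sc) (y : banach F) c : c < nx y ->
  exists j, c < fs j (coords y).
Proof.
rewrite nx_snorm => h; apply/not_existsP => hn.
by move: h; rewrite ltNge snorm_le // => j; rewrite leNgt; apply/negP/hn.
Qed.

Lemma fs_le_nx (F : family sc) (y : banach F) j : fs j (coords y) <= nx y.
Proof. by rewrite nx_snorm fs_le_snorm. Qed.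

Lemma nx_le (F : family sc) (y : banach F) c :
  (forall j, fs j (coords y) <= c) -> nx y <= c.
Proof. by rewrite nx_snorm; exact: snorm_le. Qed.

(** The space ℓ∞ over [I]. Over [unit] it is the scalar field, so that operators into it are forms;
    over [bool] it is the plane with the maximum norm. *)
Definition linf (I : eqType) (i0 : I) : family sc.
Proof.
refine (@Family _ _ sc I I (fun i v => rn (v i)) (fun i => good_coord sc i) _ i0).
by move=> i; exists 1, i => v; rewrite mul1r.
Defined.

Variables (X : normedModType K) (I : eqType) (i0 : I).
Local Notation L := (linf i0).

Lemma linf_op_ex (h : I -> X -> K) c : (forall i, lin_form (h i)) ->
  (forall i x, rn (h i x) <= c * nx x) ->
  exists T : {linear X -> banach L}, (forall x i, coords (T x) i = h i x) /\
    bdd_by sc T c.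
Proof.
move=> hl hc.
have [T [TE Tc]] := @space_op_ex _ _ sc X L (fun x i => h i x) c
  (fun a x y => funext (fun i => hl i a x y)) (fun x j => hc j x).
by exists T; split=> // x i; rewrite TE.
Qed.

Lemma linf_comp (T : {linear X -> banach L}) i :
  lin_form (fun x => coords (T x) i).
Proof. by move=> a x y; rewrite linearP. Qed.

Lemma linf_comp_le (T : {linear X -> banach L}) i x : norm_one sc T ->
  rn (coords (T x) i) <= nx x.
Proof.
move=> T1; apply: le_trans (norm_one_le x T1).
exact: (@fs_le_nx L (T x) i).
Qed.

(** A supremum norm lets one component be changed alone, so an approximation of that component by a
    form attaining its norm at [x] is already an approximation of the operator. *)
Lemma linf_replace (T : {linear X -> banach L}) k (g : X -> K) c e x :
  norm_one sc T -> lin_form g -> (forall z, rn (g z) <= nx z) ->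
  nx x = 1 -> rn (g x) = 1 -> 0 <= c < e ->
  (forall z, rn (g z - coords (T z) k) <= c * nx z) ->
  exists S : {linear X -> banach L},
    [/\ norm_one sc S, nx (S x) = 1 & op_near sc e S T].
Proof.
move=> T1 gl g1 x1 gx /andP[c0 ce] gT.
pose h i z := if i == k then g z else coords (T z) i.
have [||S [SE S1]] := @linf_op_ex h 1.
- by move=> i; rewrite /h; case: eqP => // _; exact: linf_comp.
- by move=> i z; rewrite mul1r /h; case: eqP => // _; exact: linf_comp_le.
have Sx : nx (S x) = 1.
  apply/eqP; rewrite eq_le -{1}x1 -[nx x]mul1r S1 /=.
  have := @fs_le_nx L (S x) k; by rewrite /= SE /h eqxx gx.
exists S; split=> //; first by apply: (norm_oneP S1 _ Sx); rewrite x1.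
exists c => // z; apply: nx_le => j /=.
change (rn (@coords _ _ _ L (S z) j - @coords _ _ _ L (T z) j) <= c * nx z).
rewrite SE /h.
by case: eqP => [->//|_]; rewrite subrr rn0 mulr_ge0 ?nx_ge0.
Qed.

Lemma linf_unit (y : banach (linf tt)) : nx y = rn (coords y tt).
Proof.
apply/eqP; rewrite eq_le (@fs_le_nx (linf tt) y tt) andbT.
by apply: nx_le => -[].
Qed.

End SupremumTarget.

Section Attain.
Variables (K : numFieldType) (R : realType) (sc : scalars K R).
Local Notation io := (io sc).
Local Notation rn := (rn sc).
Local Notation nx := (nx sc).

Definition attains_at (X : normedModType K) (f : X -> K) (x0 : X) :=
  nx x0 <= 1 /\ forall z, rn (f z) <= rn (f x0) * nx z.

Definition attains (X : normedModType K) := forall (f : X -> K) c, lin_form f ->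
  (forall x, rn (f x) <= c * nx x) -> exists x0, attains_at f x0.

(** The values of [f] at [x] and at the maximal point [x0] both exceed [1 - d]. After a rotation of
    [x0] the sum of the two points has norm above [2 - (d + d)], and rotundity at [x] brings them
    together. *)
Lemma attain_near (X : normedModType K) (f : X -> K) (x x0 : X) e d :
  0 < d < 1 -> 
  (forall y, nx y <= 1 -> 2 - (d + d) < nx (x + y) -> nx (x - y) < e) ->
  lin_form f -> (forall z, rn (f z) <= nx z) -> attains_at f x0 ->
  nx x = 1 -> 1 - d < rn (f x) ->
  exists x1, [/\ nx x1 = 1, rn (f x1) = rn (f x0), nx (x1 - x) < e &
    1 - d < rn (f x0) <= 1].
Proof.
move=> /andP[d0 d1] lur fl f1 [x01 fx0] x1 fx.
have fxx0 : rn (f x) <= rn (f x0) by have := fx0 x; rewrite x1 mulr1.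
have h : 2 - (d + d) < rn (f x) + rn (f x0) by lra.
have [t t1 ht] := lur_form fl f1 h.
have nx0 : nx (t *: x0) = nx x0 by rewrite nxZ t1 mul1r.
have nx01 : nx x0 = 1.
  apply/eqP; rewrite eq_le x01 /=.
  have := fx0 x0; have : 0 < rn (f x0) by lra.
  by move=> p; rewrite -[leLHS]mulr1 ler_pM2l.
exists (t *: x0); split; rewrite ?nx0 //.
- by rewrite lin_formZ // rnM t1 mul1r.
- by rewrite nxBC lur // nx0.
- by rewrite (lt_le_trans fx fxx0) -nx01 f1.
Qed.

Lemma normalized_form (X : normedModType K) (f : X -> K) x0 :
  lin_form f -> attains_at f x0 -> 0 < rn (f x0) ->
  let g := fun z => io (rn (f x0))^-1 * f z in
  [/\ lin_form g, forall z, rn (g z) <= nx z, rn (g x0) = 1 & nx x0 = 1].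
Proof.
move=> fl [x01 fx0] f0 g; split.
- by move=> a x y; rewrite /g fl mulrDr mulrCA.
- move=> z; rewrite /g rnM rn_io ger0_norm ?invr_ge0 ?rn_ge0 //.
  by rewrite mulrC ler_pdivrMr // mulrC.
- by rewrite /g rnM rn_io ger0_norm ?invr_ge0 ?rn_ge0 // mulVf ?gt_eqF.
- apply/eqP; rewrite eq_le x01 /=.
  by have := fx0 x0; rewrite -[leLHS]mulr1 ler_pM2l.
Qed.

Definition uc (X : normedModType K) := forall e, 0 < e -> exists2 d, 0 < d &
  forall x y : X, nx x <= 1 -> nx y <= 1 -> 2 - d < nx (x + y) ->
  nx (x - y) < e.

Lemma norm_one_attains_at (X : normedModType K)
    (T : {linear X -> banach (linf sc tt)}) x0 : norm_one sc T ->
  attains_at (fun z => coords (T z) tt) x0 -> rn (coords (T x0) tt) = 1.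
Proof.
move=> T1 [x01 h]; apply/eqP; rewrite eq_le; apply/andP; split.
  by apply: le_trans (linf_comp_le tt x0 T1) x01.
have [_ sh] := T1; rewrite leNgt; apply/negP => lt1.
have [|z z1] := sh (1 - rn (coords (T x0) tt)); first by rewrite subr_gt0.
rewrite linf_unit opprB addrC subrK ltNge => /negP; apply.
by apply: le_trans (h z) _; rewrite ler_piMr // rn_ge0.
Qed.

Lemma uc_BPBop_unit (X : completeNormedModType K) : uc X -> attains X ->
  BPBop K X (banach (linf sc tt)).
Proof.
move=> hu ha; apply/(BPBopP sc) => e e0; have [d d0 hd] := hu e e0.
pose d' := Num.min (d / 2) (1 / 2).
have d'0 : 0 < d' by rewrite lt_min !divr_gt0.
have d'd : d' + d' <= d.
  have : d' <= d / 2 by rewrite ge_min lexx.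
  lra.
have d'1 : d' < 1.
  have : d' <= 1 / 2 by rewrite ge_min lexx orbT.
  lra.
exists d' => // T x T1 x1; rewrite linf_unit => Tx.
pose f z := coords (T z) tt.
have fl : lin_form f by exact: linf_comp.
have f1 z : rn (f z) <= nx z by exact: linf_comp_le.
have [x0 fx0] : exists x0, attains_at f x0.
  by apply: (ha f 1 fl) => z; rewrite mul1r.
have [||y [y1 fy yx _]] := @attain_near X f x x0 e d' _ _ fl f1 fx0 x1 Tx.
- by rewrite d'0.
- move=> y y1 h; apply: hd => //; first by rewrite x1.
  by apply: le_lt_trans h; rewrite lerB.
exists y; split=> //; rewrite linf_unit -/(f y) fy.
exact: norm_one_attains_at.
Qed.

(** Some component of [T] is almost one at [x]. It attains its own norm at a point near [x], and
    dividing it by that norm, which exceeds [1 - d'], changes it by at most [d']. *)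
Lemma uc_BPBp_linf (X : completeNormedModType K) (I : eqType) (i0 : I) :
  uc X -> attains X -> BPBp K X (banach (linf sc i0)).
Proof.
move=> hu ha; apply/(BPBpP sc) => e e0; have [d d0 hd] := hu e e0.
pose d' := Num.min (d / 2) (Num.min (1 / 2) (e / 2)).
have d'0 : 0 < d' by rewrite !lt_min !divr_gt0.
have d'd : d' + d' <= d.
  have : d' <= d / 2 by rewrite ge_min lexx.
  lra.
have d'1 : d' < 1.
  have : d' <= 1 / 2 by rewrite !ge_min lexx !orbT.
  lra.
have d'e : d' < e.
  have : d' <= e / 2 by rewrite !ge_min lexx !orbT.
  lra.
exists d' => // T x T1 x1 /snorm_gt[k /= Tx].
pose f z := coords (T z) k.
have fl : lin_form f by exact: linf_comp.
have f1 z : rn (f z) <= nx z by exact: linf_comp_le.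
have [x0 fx0] : exists x0, attains_at f x0.
  by apply: (ha f 1 fl) => z; rewrite mul1r.
have [||y [y1 fy yx /andP[r1 r2]]] :=
  @attain_near X f x x0 e d' _ _ fl f1 fx0 x1 Tx.
- by rewrite d'0.
- move=> y y1 h; apply: hd => //; first by rewrite x1.
  by apply: le_lt_trans h; rewrite lerB.
have r0 : 0 < rn (f x0) by lra.
have [gl g1 _ _] := normalized_form fl fx0 r0.
set g := fun z => _ in gl g1.
have gy : rn (g y) = 1.
  by rewrite /g rnM rn_io ger0_norm ?invr_ge0 ?rn_ge0 // fy mulVf ?gt_eqF.
have [||S [S1 Sy ST]] := linf_replace (k := k) (c := d') (e := e) T1 gl g1 y1 gy.
- by rewrite ltW.
- move=> z; rewrite -/(f z) -[f z]mul1r -(io1 sc) -mulrBl -ioB rnM rn_io.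
  have [_ /(_ z) fz] := fx0.
  rewrite ger0_norm ?subr_ge0 ?invf_ge1 //.
  apply: le_trans (ler_wpM2l _ fz) _; first by rewrite subr_ge0 invf_ge1.
  rewrite mulrA mulrBl mulVf ?gt_eqF // mul1r ler_wpM2r ?nx_ge0 //; lra.
by exists S, y.
Qed.

(** The operator with components [a f] and [g], where [a] is slightly below 1, has norm one only
    through [g]. Its value at [x] is almost of norm one through [f], but within 1/2 of [x] the form
    [g] is below 1/2, so the norm is not attained there. *)
Lemma not_Lop_linf (X : completeNormedModType K) (I : eqType) (i0 i1 : I)
    (f g : X -> K) (x z : X) : i0 != i1 ->
  lin_form f -> (forall z, rn (f z) <= nx z) -> nx x = 1 -> rn (f x) = 1 ->
  lin_form g -> (forall z, rn (g z) <= nx z) -> nx z <= 1 -> rn (g z) = 1 ->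
  g x = 0 -> ~ Lop K X (banach (linf sc i0)).
Proof.
move=> i01 fl f1 x1 fx gl g1 z1 gz gx /(LopP sc) h.
have [//|d d0 hd] := h 2^-1 x _ x1.
pose a := Num.max (1 - d / 2) 0.
have a0 : 0 <= a by rewrite le_max lexx orbT.
have a1 : a < 1 by rewrite gt_max ltr01 andbT; lra.
have ad : 1 - d < a.
  have : 1 - d / 2 <= a by rewrite le_max lexx.
  lra.
pose hh i y := if i == i0 then io a * f y else if i == i1 then g y else 0.
have [||T [TE T1]] := @linf_op_ex _ _ sc X I i0 hh 1.
- move=> i; rewrite /hh => b u v; case: eqP => _.
    by rewrite fl mulrDr mulrCA.
  by case: eqP => _ //; rewrite mulr0 addr0.
- move=> i y; rewrite mul1r /hh; case: eqP => _.
    rewrite rnM rn_io ger0_norm //; apply: le_trans (f1 y).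
    by rewrite ler_piMl ?rn_ge0 // ltW.
  by case: eqP => _ //; rewrite rn0 nx_ge0.
have T1' : norm_one sc T.
  apply: (norm_oneP T1 z1); apply/eqP; rewrite eq_le.
  apply/andP; split; first by apply: le_trans (T1 z) _; rewrite mul1r.
  have := @fs_le_nx _ _ sc (linf sc i0) (T z) i1.
  by rewrite /= TE /hh eq_sym (negPf i01) eqxx gz.
have [|y [y1 Ty yx]] := hd T T1'.
  apply: lt_le_trans ad _.
  have := @fs_le_nx _ _ sc (linf sc i0) (T x) i0.
  by rewrite /= TE /hh eqxx rnM fx mulr1 rn_io ger0_norm.
have gy : rn (g y) < 2^-1.
  by apply: le_lt_trans yx; rewrite -[g y]subr0 -gx -lin_formB.
suff : nx (T y) <= Num.max a (2^-1).
  by rewrite Ty leNgt gt_max a1 /= invf_lt1 // ltr1n.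
apply: nx_le => i /=; rewrite TE /hh le_max.
case: eqP => _.
  rewrite rnM rn_io ger0_norm // ler_piMr //.
  by apply: le_trans (f1 y) _; rewrite y1.
by case: eqP => _; rewrite ?(ltW gy) ?orbT // rn0 a0.
Qed.

End Attain.

                                            

(** * Euclidean sums of seminorms *)

Section Ell2.
Variables (K : numFieldType) (R : realType) (sc : scalars K R).
Local Notation io := (io sc).
Local Notation rn := (rn sc).
Variable I : Type.
Implicit Types (p : nat -> (I -> K^o) -> R) (v : I -> K^o).

Lemma good_zero : good sc (fun _ : I -> K^o => 0).
Proof.
split=> [v|u v h]; last exact: ulim_cst.
exists (fun _ => 0); split=> [a x y|w|]; rewrite ?rn0 ?io0 //.
by rewrite mulr0 addr0.
Qed.

(** The root of the sum of the first [M] squares, built by iterating [hyp] so that [good_hyp]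
    applies at each stage. *)
Fixpoint ell2 p M v : R :=
  if M is M'.+1 then hyp (ell2 p M' v) (p M' v) else 0.

Lemma good_ell2 p M : (forall n, good sc (p n)) -> good sc (ell2 p M).
Proof.
move=> gp; elim: M => [|M IH] /=; first exact: good_zero.
exact: good_hyp.
Qed.

Lemma sqr_ell2 p M v : ell2 p M v ^+ 2 = \sum_(0 <= n < M) p n v ^+ 2.
Proof.
elim: M => [|M IH] /=; first by rewrite big_nil expr0n.
by rewrite sqr_hyp IH big_nat_recr.
Qed.

Lemma ell2_ge0 p M v : 0 <= ell2 p M v.
Proof. by case: M => //= M; exact: hyp_ge0. Qed.

Lemma ell2_mono p M M' v : (M <= M')%N -> ell2 p M v <= ell2 p M' v.
Proof.
move=> /subnK <-; elim: (M' - M)%N => // k IH.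
by apply: le_trans IH _; rewrite addSn /= hyp_gel // ell2_ge0.
Qed.

Lemma ell2_split p M M' v : (M <= M')%N ->
  ell2 p M' v ^+ 2 = ell2 p M v ^+ 2 + \sum_(M <= n < M') p n v ^+ 2.
Proof. by move=> h; rewrite !sqr_ell2 -big_cat_nat. Qed.

Lemma ell2_tail p (N : R) v e : (forall M, ell2 p M v <= N) -> 0 < e ->
  exists M, forall M', \sum_(M <= n < M') p n v ^+ 2 <= e.
Proof.
move=> hN e0.
pose B := [set ell2 p M v ^+ 2 | M in setT].
have N0 : 0 <= N by apply: le_trans (hN 0%N).
have hB : has_sup B.
  split; first by exists (ell2 p 0%N v ^+ 2), 0%N.
  by exists (N ^+ 2) => _ [M _ <-]; rewrite ler_sqr ?nnegrE ?ell2_ge0.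
have [_ [M _ <-] hM] := sup_adherent e0 hB.
exists M => M'; have [MM'|/ltnW M'M] := leqP M M'; last first.
  by rewrite big_geq // ltW.
have : ell2 p M' v ^+ 2 <= sup B by apply: sup_upper_bound => //; exists M'.
rewrite (ell2_split _ _ MM'); lra.
Qed.

End Ell2.

(** * The uniformly convex space [rsup] *)

Section RoundedSup.
Variables (K : numFieldType) (R : realType) (sc : scalars K R).
Local Notation io := (io sc).
Local Notation rn := (rn sc).
Local Notation nx := (nx sc).
Implicit Types v w : nat -> K^o.

Definition gap n : R := n.+2%:R^-1.

Lemma gap_gt0 n : 0 < gap n. Proof. by rewrite invr_gt0. Qed.

Lemma gap_le n : gap n <= 1 / 2.
Proof. by rewrite div1r lef_pV2 ?posrE ?ltr0n // ler_nat. Qed.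

Lemma gap_lt e : 0 < e -> exists N, forall n, (N <= n)%N -> gap n < e.
Proof.
move=> e0; have [N hN] := ltr_add_invr e0; rewrite add0r in hN.
exists N => n Nn; apply: le_lt_trans hN.
by rewrite lef_pV2 ?posrE ?ltr0n // ler_nat; apply: leq_trans Nn _.
Qed.

Definition p_coord n v : R := rn (v n).
(** At e_0 the tilts take the values [1 - gap n], whose supremum 1 is not attained; a small amount
    of e_{n+1} makes the n-th tilt dominate. *)
Definition tilt n v : K := io (1 - gap n) * v 0%N + v n.+1.

Fixpoint max_tilt M v : R :=
  if M is M'.+1 then Num.max (max_tilt M' v) (rn (tilt M' v)) else 0.

Lemma good_tilt n : good sc (fun v => rn (tilt n v)).
Proof.
apply: good_form.
  move=> a v w; have -> : tilt n (a *: v + w) = io (1 - gap n) *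
      ((a : K) * v 0%N + w 0%N) + (a * v n.+1 + w n.+1) by [].
  by rewrite /tilt; ring.
move=> u v h.
apply: (@ulim_squeeze0 _ _ (fun m =>
   (1 - gap n) * rn (u m 0%N - v 0%N) + rn (u m n.+1 - v n.+1))).
  move=> m; rewrite ger0_norm ?rn_ge0 //.
  have -> : tilt n (u m - v) =
      io (1 - gap n) * (u m 0%N - v 0%N) + (u m n.+1 - v n.+1) by [].
  apply: le_trans (rnD _ _ _) _; rewrite rnM rn_io ger0_norm //.
  by have := gap_le n; lra.
by have := ulimD (ulimZ (1 - gap n) (h 0%N)) (h n.+1); rewrite mulr0 addr0.
Qed.

Lemma good_max_tilt M : good sc (max_tilt M).
Proof.
elim: M => [|M IH] /=; first exact: good_zero.
exact: good_max IH (good_tilt M).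
Qed.

Definition rsup_seminorm M v := hyp (ell2 p_coord M v) (max_tilt M v).

Lemma good_p_coord n : good sc (p_coord n).
Proof. exact: good_coord. Qed.

Lemma good_rsup M : good sc (rsup_seminorm M).
Proof. exact: good_hyp (good_ell2 _ good_p_coord) (good_max_tilt M). Qed.

Lemma coord_le_ell2 n M v : (n < M)%N -> rn (v n) <= ell2 p_coord M v.
Proof.
move=> h; apply: le_trans (ell2_mono p_coord v h) => /=.
exact/hyp_ger/rn_ge0.
Qed.

Definition rsup : family sc.
Proof.
refine (@Family _ _ sc nat nat rsup_seminorm good_rsup _ 0%N) => i.
exists 1, i.+1 => v; rewrite mul1r; apply: le_trans (hyp_gel _ (ell2_ge0 _ _ _)).
exact: coord_le_ell2.
Defined.

Local Notation X := (banach rsup).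

Lemma max_tilt_mono M M' v : (M <= M')%N -> max_tilt M v <= max_tilt M' v.
Proof.
move=> /subnK <-; elim: (M' - M)%N => // k IH.
by apply: le_trans IH _; rewrite addSn /= le_max lexx.
Qed.

Lemma max_tilt_ge0 M v : 0 <= max_tilt M v.
Proof. exact: good_ge0 (good_max_tilt M). Qed.

Lemma tilt_le_max n M v : (n < M)%N -> rn (tilt n v) <= max_tilt M v.
Proof.
by move=> h; apply: le_trans (max_tilt_mono v h); rewrite /= le_max lexx orbT.
Qed.

Lemma rsup_mono M M' v : (M <= M')%N -> rsup_seminorm M v <= rsup_seminorm M' v.
Proof.
move=> h; apply: hyp_le; rewrite ?ell2_ge0 ?max_tilt_ge0 //.
  exact: ell2_mono.
exact: max_tilt_mono.
Qed.

(** The new norm is thus equivalent to the Hilbert norm. The index is [M.+1] because [tilt n] reads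
    coordinate [n.+1]. *)
Lemma max_tilt_le_ell2 M v : max_tilt M v <= 2 * ell2 p_coord M.+1 v.
Proof.
have e0 := ell2_ge0 p_coord.
elim: M => [|M IH] /=; first by rewrite mulr_ge0 // hyp_ge0.
rewrite ge_max; apply/andP; split.
  by apply: le_trans IH _; rewrite ler_wpM2l // hyp_gel // hyp_ge0.
apply: le_trans (rnD _ _ _) _; rewrite rnM rn_io mulr_natl mulr2n.
apply: lerD; last exact: (@coord_le_ell2 M.+1 M.+2).
apply: (@le_trans _ _ (rn (v 0%N))); last exact: (@coord_le_ell2 0%N M.+2).
rewrite ler_piMl ?rn_ge0 // ger0_norm; have := gap_le M; have := gap_gt0 M; lra.
Qed.

Lemma ell2_coord_parallelogram M v w :
  ell2 p_coord M (v + w) ^+ 2 + ell2 p_coord M (v - w) ^+ 2 =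
  2 * ell2 p_coord M v ^+ 2 + 2 * ell2 p_coord M w ^+ 2.
Proof.
elim: M => [|M IH] /=; first by rewrite expr0n /= mulr0 addr0.
rewrite !sqr_hyp addrACA IH.
have := rn_parallelogram sc (v M) (w M); rewrite /p_coord /=.
rewrite -[(v + w) M]/(v M + w M) -[(v - w) M]/(v M - w M); lra.
Qed.

Lemma good_sqrD (J : Type) (p : (J -> K^o) -> R) (v w : J -> K^o) : good sc p ->
  p (v + w) ^+ 2 <= 2 * p v ^+ 2 + 2 * p w ^+ 2.
Proof.
move=> gp; have := goodD v w gp; have := good_ge0 (v + w) gp.
have := sqr_ge0 (p v - p w); nra.
Qed.

(** The Hilbert part obeys the parallelogram law and the tilt part at least [good_sqrD]; their sum
    leaves the Hilbert distance of [x] and [y] as a gain. *)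
Lemma rsup_uc_ineq (x y : X) M M' : nx x <= 1 -> nx y <= 1 -> (M <= M')%N ->
  rsup_seminorm M' (coords (x + y)) ^+ 2 +
  ell2 p_coord M (coords (x - y)) ^+ 2 <= 4.
Proof.
move=> x1 y1 MM'.
have hx : rsup_seminorm M' (coords x) ^+ 2 <= 1.
  by rewrite expr_le1 ?hyp_ge0 //; apply: le_trans x1; exact: (@fs_le_nx _ _ _ rsup).
have hy : rsup_seminorm M' (coords y) ^+ 2 <= 1.
  by rewrite expr_le1 ?hyp_ge0 //; apply: le_trans y1; exact: (@fs_le_nx _ _ _ rsup).
move: hx hy; rewrite !sqr_hyp coordsD coordsB.
have := ell2_coord_parallelogram M' (coords x) (coords y).
have := good_sqrD (coords x) (coords y) (good_max_tilt M').
have : ell2 p_coord M (coords x - coords y) ^+ 2 <=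
       ell2 p_coord M' (coords x - coords y) ^+ 2.
  by rewrite ler_sqr ?nnegrE ?ell2_ge0 // ell2_mono.
lra.
Qed.

Lemma rsup_uc : uc sc X.
Proof.
(* The squared Hilbert distance will be at most [4 * d], and the squared norm at most five times
   this, that is [e ^+ 2 / 2], which is below the square of [e * (3 / 4)]. *)
move=> e e0; pose d := Num.min (e ^+ 2 / 40) 1.
have d0 : 0 < d by rewrite lt_min ltr01 andbT divr_gt0 // exprn_gt0.
have de : d <= e ^+ 2 / 40 by rewrite ge_min lexx.
have d1 : d <= 1 by rewrite ge_min lexx orbT.
exists d => // x y x1 y1 /snorm_gt[M0 /= hM0].
have h M : ell2 p_coord M (coords (x - y)) ^+ 2 <= 4 * d.
  have := rsup_uc_ineq x1 y1 (leq_maxl M M0).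
  have : 2 - d < rsup_seminorm (maxn M M0) (coords (x + y)).
    by apply: lt_le_trans hM0 _; apply: rsup_mono; exact: leq_maxr.
  have : 0 <= 2 - d by lra.
  nra.
apply: (@le_lt_trans _ _ (e * (3 / 4))); last by lra.
apply: nx_le => M; apply: le_of_sqr; first by lra.
rewrite /= sqr_hyp.
have h1 := h M; have h2 := h M.+1.
have h3 := max_tilt_le_ell2 M (coords (x - y)).
have h4 := max_tilt_ge0 M (coords (x - y)).
have h5 : max_tilt M (coords (x - y)) ^+ 2 <=
    4 * ell2 p_coord M.+1 (coords (x - y)) ^+ 2.
  rewrite -[4]/(2 * 2)%:R natrM -expr2 -exprMn ler_sqr ?nnegrE //.
  by rewrite mulr_ge0 // ell2_ge0.
nra.
Qed.

End RoundedSup.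

(** Rotate a maximizing sequence so that [f] is positive on it. Sums of late terms then have norm
    close to 2, uniform convexity brings these terms together, and their ultralimit is close to them
    in norm. *)
Lemma uc_attains (K : numFieldType) (R : realType) (sc : scalars K R)
  (F : family sc) : uc sc (banach F) -> attains sc (banach F).
Proof.
move=> hu f c fl fc; have [r [r0 fr rsharp]] := norm_ex fl fc.
have [r00|rn0] := eqVneq r 0.
  exists 0; split=> [|z]; first by rewrite nx0.
  by rewrite (lin_form0 fl) rn0 mul0r; have := fr z; rewrite r00 mul0r.
have rp : 0 < r by rewrite lt_neqAle eq_sym rn0.
have ex n : exists2 y : banach F, nx sc y <= 1 &
    exists2 s, f y = io sc s & r - r * n.+1%:R^-1 < s.
  have [|z z1 hz] := rsharp (r * n.+1%:R^-1); first by rewrite mulr_gt0 ?invr_gt0.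
  have [t t1 tz] := phase sc (f z).
  exists (t *: z); first by rewrite nxZ t1 mul1r.
  by exists (rn sc (f z)) => //; rewrite lin_formZ.
pose y n := s2val (cid2 (ex n)).
have y1 n : nx sc (y n) <= 1 := s2valP (cid2 (ex n)).
have fy n : exists2 s, f (y n) = io sc s & r - r * n.+1%:R^-1 < s :=
  s2valP' (cid2 (ex n)).
have y1' n : snorm (y n) <= 1 by rewrite -nx_snorm.
have [x [x1 _ hx]] := space_ulim y1'.
have key e : 0 < e -> r <= rn sc (f x) + r * e.
  move=> e0; have [d d0 hd] := hu (e / 2) (divr_gt0 e0 (ltr0n R 2)).
  pose m := Num.min (d / 2) (e / 2).
  have m0 : 0 < m by rewrite lt_min !divr_gt0.
  have [N hN] := ltr_add_invr m0; rewrite add0r in hN.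
  have hn n : (N <= n)%N -> n.+1%:R^-1 < m.
    by move=> Nn; apply: le_lt_trans hN; rewrite lef_pV2 ?posrE ?ltr0n // ler_nat.
  have yx : nx sc (y N - x) <= e / 2.
    rewrite nx_snorm; apply: hx; apply: (@ultra_eventually _ N) => n Nn /=.
    rewrite -nx_snorm; apply/ltW/hd => //; rewrite -(ltr_pM2l rp).
    have [s fs hs] := fy N; have [s' fs' hs'] := fy n.
    have := fr (y N + y n).
    rewrite lin_formD // fs fs' -ioD rn_io => h.
    have := ler_norm (s + s').
    have : r * N.+1%:R^-1 < r * (d / 2).
      by rewrite ltr_pM2l // (lt_le_trans (hn _ (leqnn _))) // ge_min lexx.
    have : r * n.+1%:R^-1 < r * (d / 2).
      by rewrite ltr_pM2l // (lt_le_trans (hn _ Nn)) // ge_min lexx.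
    move: hs hs' h; move: (r * n.+1%:R^-1) (r * N.+1%:R^-1) => a b.
    lra.
  have [s fs hs] := fy N.
  have : rn sc (f (y N)) - rn sc (f x) <= r * (e / 2).
    apply: le_trans (rnB _ _ _) _; rewrite -lin_formB //.
    by apply: le_trans (fr _) _; rewrite ler_pM2l.
  have : r * N.+1%:R^-1 < r * (e / 2).
    by rewrite ltr_pM2l // (lt_le_trans (hn _ (leqnn _))) // ge_min lexx orbT.
  rewrite fs rn_io; have := ler_norm s.
  by move: hs; move: (r * N.+1%:R^-1) => a; lra.
exists x; split; first by rewrite nx_snorm.
move=> z; apply: le_trans (fr z) _; rewrite ler_wpM2r ?nx_ge0 //.
rewrite leNgt; apply/negP => h.
have h2 : 0 < (r - rn sc (f x)) / r / 2 by rewrite !divr_gt0 // subr_gt0.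
have := key _ h2; have -> : r * ((r - rn sc (f x)) / r / 2) = (r - rn sc (f x)) / 2.
  by field; rewrite gt_eqF.
lra.
Qed.

(** * Pairs with [rsup] as domain *)

Section RoundedSupPairs.
Variables (K : numFieldType) (R : realType) (sc : scalars K R).
Local Notation io := (io sc).
Local Notation rn := (rn sc).
Local Notation nx := (nx sc).
Local Notation X := (banach (rsup sc)).
Local Notation gap := (@gap R).
Local Notation s2 := (Num.sqrt 2 : R).

Definition vec2 (a b : K) n : nat -> K^o :=
  fun i => if i == 0%N then a else if i == n.+1 then b else 0.

Lemma ell2_vec2 a b n M :
  ell2 (p_coord sc) M (vec2 a b n) ^+ 2 <= rn a ^+ 2 + rn b ^+ 2.
Proof.
suff : ell2 (p_coord sc) M (vec2 a b n) ^+ 2 <=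
    (if (0 < M)%N then rn a ^+ 2 else 0) +
    (if (n.+1 < M)%N then rn b ^+ 2 else 0).
  move=> h; apply: le_trans h _; apply: lerD; case: ifP => _ //; exact: sqr_ge0.
elim: M => [|M IH] /=; first by rewrite expr0n addr0.
rewrite sqr_hyp; apply: le_trans (lerD IH (lexx _)) _; rewrite /p_coord /vec2.
case: M {IH} => [|M] /=; first by rewrite ?ltnS ?ltn0 /= ?addr0 ?add0r.
rewrite -addrA lerD2l eqSS !ltnS; by case: (ltngtP M n) => _; rewrite ?rn0 ?expr0n ?add0r ?addr0.
Qed.

Lemma max_tilt_vec2 a b n M : max_tilt sc M (vec2 a b n) <=
  Num.max (rn a) (rn (io (1 - gap n) * a + b)).
Proof.
elim: M => [|M IH] /=; first by rewrite le_max rn_ge0.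
rewrite ge_max IH /= /tilt /vec2 /= eqSS; case: eqP => [->|_].
  by rewrite le_max lexx orbT.
rewrite addr0 rnM rn_io le_max ger0_norm.
  by rewrite ler_piMl ?rn_ge0 //; have := @gap_gt0 R M; lra.
by have := @gap_le R M; lra.
Qed.

(** Every tilt other than the n-th sees only [a], with a factor at most one; hence the maximum. *)
Lemma vec2_ex a b n : exists x : X, coords x = vec2 a b n /\
  nx x ^+ 2 <= rn a ^+ 2 + rn b ^+ 2 +
    Num.max (rn a) (rn (io (1 - gap n) * a + b)) ^+ 2.
Proof.
set m := Num.max _ _; set B := _ + m ^+ 2.
have m0 : 0 <= m by rewrite le_max rn_ge0.
have B0 : 0 <= B by rewrite !addr_ge0 ?sqr_ge0.
have h M : fs (f := rsup sc) M (vec2 a b n) <= Num.sqrt B.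
  apply: le_of_sqr; rewrite ?sqrtr_ge0 // [leRHS]sqr_sqrtr // [leLHS]sqr_hyp.
  apply: lerD; first exact: ell2_vec2.
  rewrite ler_sqr ?nnegrE ?max_tilt_ge0 //; exact: max_tilt_vec2.
have hb : vec2 a b n \in @fbdd _ _ _ (rsup sc).
  by apply/fbddP; exists (Num.sqrt B).
exists (Space hb); split=> //.
rewrite -[leRHS]sqr_sqrtr // ler_sqr ?nnegrE ?nx_ge0 ?sqrtr_ge0 //.
exact: nx_le.
Qed.

Lemma vec2_norm_ge (x : X) a b n : coords x = vec2 a b n ->
  rn a ^+ 2 + rn b ^+ 2 + rn (io (1 - gap n) * a + b) ^+ 2 <= nx x ^+ 2.
Proof.
move=> xE; have := @fs_le_nx _ _ _ (rsup sc) x n.+2.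
rewrite -(ler_sqr _ _) ?nnegrE ?hyp_ge0 ?nx_ge0 //; apply: le_trans.
rewrite [leRHS]sqr_hyp; apply: lerD.
  rewrite [leRHS]sqr_hyp; apply: lerD.
    rewrite ler_sqr ?nnegrE ?rn_ge0 ?hyp_ge0 //.
    by have := @coord_le_ell2 _ _ sc 0%N n.+1 (coords x) isT; rewrite xE.
  by rewrite /p_coord xE /vec2 eqxx.
rewrite ler_sqr ?nnegrE ?rn_ge0 ?max_tilt_ge0 //.
have := @tilt_le_max _ _ sc n n.+2 (coords x) (ltnW (ltnSn _)).
by rewrite xE {1}/tilt /vec2 !eqxx /=.
Qed.

Lemma s2_gt0 : 0 < s2. Proof. by rewrite sqrtr_gt0. Qed.
Lemma s2_sqr : s2 ^+ 2 = 2. Proof. by rewrite sqr_sqrtr. Qed.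
Lemma s2_bounds : 14 / 10 < s2 < 15 / 10.
Proof. by have := s2_gt0; have := s2_sqr => h1 h2; apply/andP; split; nra. Qed.

(** Of norm at most one, by Cauchy-Schwarz between coordinate 0 and the n-th tilt; at the unit
    vector e_0 / sqrt 2 its value is [1 - gap n / 2]. *)
Definition tilt_form n (x : X) : K :=
  io s2^-1 * (coords x 0%N + tilt sc n (coords x)).

Lemma tilt_form_lin n : lin_form (tilt_form n).
Proof.
move=> a x y; rewrite /tilt_form coordsD coordsZ.
rewrite -[(a *: coords x + coords y) 0%N]/((a : K) * coords x 0%N + coords y 0%N).
have -> : tilt sc n (a *: coords x + coords y) =
  io (1 - gap n) * (a * coords x 0%N + coords y 0%N) +
  (a * coords x n.+1 + coords y n.+1) by [].
by rewrite /tilt; ring.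
Qed.

Lemma tilt_form_le n x : rn (tilt_form n x) <= nx x.
Proof.
apply: le_trans (@fs_le_nx _ _ _ (rsup sc) x n.+1).
rewrite /tilt_form rnM rn_io ger0_norm ?invr_ge0 ?sqrtr_ge0 //.
rewrite mulrC ler_pdivrMr ?s2_gt0 //; apply: le_trans (rnD _ _ _) _.
have h := cauchy_schwarz2 (rn (coords x 0%N)) (rn (tilt sc n (coords x))) 1 1.
rewrite !mulr1 in h; apply: le_trans h _.
rewrite /hyp expr1n -[1 + 1]/2 -/(hyp _ _) ler_pM2r ?s2_gt0 //.
apply: hyp_le; rewrite ?rn_ge0 //; first exact: coord_le_ell2.
exact: tilt_le_max.
Qed.

(** The ultralimit of the forms [tilt_form m]: on a vector with two coordinates the late tilts are
    [(1 - gap m) * a] and tend to [a]. The limit attains its norm at e_0 / sqrt 2 and vanishes on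
    every other basis vector. *)
Lemma tilt_form_limit : exists f : X -> K, [/\ lin_form f,
  forall x, rn (f x) <= nx x &
  forall (x : X) a b n, coords x = vec2 a b n -> f x = io s2 * a].
Proof.
have h1 n x : rn (tilt_form n x) <= 1 * nx x by rewrite mul1r tilt_form_le.
have [f [fl f1 flim]] := ulim_form tilt_form_lin h1.
exists f; split=> [//|x|x a b n xE]; first by rewrite -[leRHS]mul1r.
apply: (@ulim_form_val _ _ sc (fun m => tilt_form m x)) => //.
have r0 : 0 <= rn a / s2 by rewrite divr_ge0 ?rn_ge0 ?sqrtr_ge0.
apply: ulim_nat => e e0.
have [|N hN] := @gap_lt R (e / (rn a / s2 + 1)).
  by rewrite divr_gt0 // ltr_wpDl.
exists (maxn N n.+1) => m; rewrite geq_max => /andP[/hN hm nm].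
rewrite subr0 ger0_norm ?rn_ge0 // /tilt_form xE /tilt /vec2 /= eqSS.
rewrite (gtn_eqF nm) addr0.
have -> : io s2^-1 * (a + io (1 - gap m) * a) - io s2 * a =
    - (io (gap m * s2^-1) * a).
  have E : io s2 = 2 * io s2^-1.
    have -> : io s2 = io (2 * s2^-1).
      by congr io; rewrite -{2}s2_sqr expr2 mulfK // gt_eqF // s2_gt0.
    by rewrite -[2]/(1 + 1) mulrDl ioD !mul1r mulrDl !mul1r.
  by rewrite E ioM ioB io1; ring.
rewrite rnN rnM rn_io ger0_norm; last first.
  by rewrite mulr_ge0 ?invr_ge0 ?sqrtr_ge0 // ltW // gap_gt0.
move: hm; rewrite ltr_pdivlMr ?ltr_wpDl // => hm.
have := @gap_gt0 R m; move: hm; rewrite -mulrA [s2^-1 * _]mulrC; nra.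
Qed.

Lemma unit_e0_ex : exists x : X, coords x = vec2 (io s2^-1) 0 0 /\ nx x = 1.
Proof.
have [x [xE x1]] := vec2_ex (io s2^-1) 0 0.
have [f [fl f1 fE]] := tilt_form_limit.
exists x; split=> //; apply/eqP; rewrite eq_le; apply/andP; split; last first.
  apply: le_trans (f1 x); rewrite (fE _ _ _ _ xE) -ioM divff ?gt_eqF ?s2_gt0 //.
  by rewrite io1 rn1.
apply: le_of_sqr => //; apply: le_trans x1 _; rewrite addr0 rnM !rn_io rn0.
have := @gap_gt0 R 0; have := @gap_le R 0 => g1 g2.
have i0 : 0 <= s2^-1 by rewrite invr_ge0 sqrtr_ge0.
rewrite !ger0_norm //; last by lra.
rewrite (max_idPl _); last by rewrite ler_piMl //; lra.
by rewrite expr0n addr0 exprVn s2_sqr expr1n; lra.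
Qed.

End RoundedSupPairs.

Section RoundedSupPairs2.
Variables (K : numFieldType) (R : realType) (sc : scalars K R).
Local Notation io := (io sc).
Local Notation rn := (rn sc).
Local Notation nx := (nx sc).
Local Notation X := (banach (rsup sc)).
Local Notation gap := (@gap R).
Local Notation s2 := (Num.sqrt 2 : R).

Lemma rsup_BPBop : BPBop K X (banach (linf sc tt)).
Proof. exact: uc_BPBop_unit (@rsup_uc _ _ sc) (uc_attains (@rsup_uc _ _ sc)). Qed.

Lemma rsup_BPBp : BPBp K X (banach (linf sc 0%N)).
Proof. exact: uc_BPBp_linf (@rsup_uc _ _ sc) (uc_attains (@rsup_uc _ _ sc)). Qed.

Lemma linf_unit_form (T : {linear X -> banach (linf sc tt)}) x :
  norm_one sc T -> nx (T x) = 1 -> nx x = 1 ->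
  exists h : X -> K, [/\ lin_form h, forall z, rn (h z) <= nx z,
    rn (h x) = 1 & h = fun z => coords (T z) tt].
Proof.
move=> T1 Tx x1; exists (fun z => coords (T z) tt); split=> //.
- exact: linf_comp.
- by move=> z; exact: linf_comp_le.
- by rewrite -linf_unit.
Qed.

Lemma gap_pick d : 0 < d -> exists n, gap n < d.
Proof. by move=> /gap_lt[N]; exists N; auto. Qed.

                                                                              
                                                              
(** Take for [T] the limit form. At e_0 + 2 g e_{n+1}, with g = [gap n], the n-th tilt dominates and
    the norm grows along e_{n+1} with slope at least 1/2. A form attaining its norm there has
    modulus at least 1/2 on e_{n+1}, where [T] vanishes. *)
Lemma rsup_not_Lpo : ~ Lpo K X (banach (linf sc tt)).
Proof.
move=> /(LpoP sc) hL.
have [f [fl f1 fE]] := tilt_form_limit sc.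
have [x0 [x0E x01]] := unit_e0_ex sc.
have [||T [TE T1]] := @linf_op_ex _ _ sc X _ tt (fun _ => f) 1.
- by [].
- by move=> _ x; rewrite mul1r.
have T1' : norm_one sc T.
  apply: (norm_oneP T1 (x := x0)); first by rewrite x01.
  rewrite linf_unit TE (fE _ _ _ _ x0E) -ioM divff ?gt_eqF ?s2_gt0 //.
  by rewrite io1 rn1.
have [|d' d'0 hd] := hL (1 / 4) T _ T1'; first by rewrite divr_gt0.
pose d := Num.min d' (1 / 2).
have d0 : 0 < d by rewrite lt_min d'0 divr_gt0.
have dd' : d <= d' by rewrite ge_min lexx.
have d1 : d <= 1 / 2 by rewrite ge_min lexx orbT.
have [n gn] : exists n, gap n < d / 7 by apply: gap_pick; rewrite divr_gt0.
have g0 := @gap_gt0 R n; set g := gap n in gn g0.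
have [y [yE y1]] := vec2_ex sc 1 (io (2 * g)) n.
have [y' [y'E y'1]] := vec2_ex sc 1 (io g) n.
have [z [zE z1]] := vec2_ex sc 0 1 n.
have y2 := vec2_norm_ge yE.
have nn2 : rn (io (1 - gap n) * 1 + io (2 * g)) = 1 + g.
  by rewrite mulr1 -ioD rn_io ger0_norm /g -/g; lra.
have nn1 : rn (io (1 - gap n) * 1 + io g) = 1.
  by rewrite mulr1 -ioD rn_io ger0_norm /g -/g; lra.
have nn0 : rn (io (1 - gap n) * 0 + 1) = 1 by rewrite mulr0 add0r rn1.
have r2 : rn (io (2 * g)) = 2 * g by rewrite rn_io ger0_norm //; lra.
have r1 : rn (io g) = g by rewrite rn_io ger0_norm // ltW.
rewrite nn2 rn1 r2 in y1 y2; rewrite nn1 rn1 r1 in y'1.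
rewrite nn0 rn1 rn0 in z1.
rewrite (max_idPr _) in y1; last by lra.
rewrite maxxx in y'1; rewrite (max_idPr _) ?ler01 // in z1.
have yge := nx_ge0 sc y; have y'ge := nx_ge0 sc y'; have zge := nx_ge0 sc z.
set N := nx y in y1 y2 yge; set N' := nx y' in y'1 y'ge.
have N2 : N <= 2 by nra.
have N'2 : N' <= 2 by nra.
have Np : 0 < N by nra.
(* The squares satisfy [1 + 4 * g ^+ 2 + (1 + g) ^+ 2 <= N ^+ 2] and [N' ^+ 2 <= 2 + g ^+ 2], and
   [N + N'] is at most 4. *)
have diff : g / 2 <= N - N'.
  have : 2 * g + 4 * g ^+ 2 <= (N - N') * (N + N') by nra.
  nra.
pose x := io N^-1 *: y.
have x1 : nx x = 1 by apply: nx_normalize; rewrite gt_eqF.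
have [|S [S1 Sx ST]] := hd x x1.
  rewrite linf_unit TE lin_formZ // (fE _ _ _ _ yE) mulr1 -ioM rn_io.
  rewrite ger0_norm ?mulr_ge0 ?invr_ge0 ?sqrtr_ge0 //.
  rewrite mulrC ltr_pdivlMr //.
  have := s2_sqr R; have := s2_gt0 R => s0 ss.
  have : ((1 - d') * N) ^+ 2 < s2 ^+ 2 \/ 1 - d' <= 0.
    have [?|h] := leP (1 - d') 0; [by right|left; rewrite ss].
    have : N ^+ 2 <= 2 + d by nra.
    have : (1 - d') ^+ 2 <= 1 - d by nra.
    have := sqr_ge0 N; have := sqr_ge0 (1 - d'); rewrite exprMn; nra.
  case=> h; nra.
have [h [hl h1 hx hE]] := linf_unit_form S1 Sx x1.
have hy : rn (h y) = N.
  move: hx; rewrite lin_formZ // rnM rn_io ger0_norm ?invr_ge0 // => h2.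
  by apply: (@mulfI _ N^-1); rewrite ?invr_eq0 ?gt_eqF // h2 mulVf // gt_eqF.
have yy' : y - y' = io g *: z.
  apply: coords_inj => i; rewrite coordsB coordsZ yE y'E zE.
  rewrite -[(vec2 1 (io (2 * g)) n - _) i]/(vec2 1 (io (2 * g)) n i -
    vec2 1 (io g) n i) -[(_ *: _) i]/(io g * vec2 0 1 n i) /vec2.
  case: eqP => _; first by rewrite subrr mulr0.
  case: eqP => _; last by rewrite subr0 mulr0.
  by rewrite mulr1 -ioB; congr io; lra.
have hz : 1 / 2 <= rn (h z).
  have := rnB sc (h y) (h y'); rewrite -lin_formB // yy' lin_formZ // rnM rn_io.
  rewrite ger0_norm ?(ltW g0) // hy; have := h1 y'; rewrite -/N'; nra.
have := op_near_le z ST; rewrite linf_unit.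
change (rn (coords (S z) tt - coords (T z) tt) <= 1 / 4 * nx z -> False).
have -> : coords (S z) tt = h z by rewrite hE.
by rewrite TE (fE _ _ _ _ zE) mulr0 subr0; nra.
Qed.

                                                                        
                                              
(** Here the point e_0 / sqrt 2 is fixed. Adding t g e_{n+1} with |t| = 1 to e_0 leaves the n-th
    tilt at most 1, so the squared norm grows from 2 to at most 2 + g^2. A form attaining its norm
    at the point is therefore of order g on e_{n+1}, whereas [tilt_form n], almost norming there,
    takes the value 1 / sqrt 2. *)
Lemma rsup_not_Lpp : ~ Lpp K X (banach (linf sc tt)).
Proof.
move=> /(LppP sc) hL.
have [x0 [x0E x01]] := unit_e0_ex sc.
have [|d d0 hd] := hL (1 / 4) x0 _ x01; first by rewrite divr_gt0.
have m0 : 0 < Num.min d (1 / 4) by rewrite lt_min d0 divr_gt0.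
have [n gn] := gap_pick m0.
have g0 := @gap_gt0 R n; set g := gap n in gn g0.
move: gn; rewrite lt_min => /andP[gd g4].
have [||T0 [T0E T01]] :=
    @linf_op_ex _ _ sc X _ tt (fun _ => @tilt_form _ _ sc n) 1.
- by move=> _; exact: tilt_form_lin.
- by move=> _ x; rewrite mul1r tilt_form_le.
have sb := s2_bounds R; have ss := s2_sqr R; have s0 := s2_gt0 R.
have T0x : nx (T0 x0) = 1 - g / 2.
  rewrite linf_unit T0E /tilt_form x0E /tilt /vec2 /= if_same addr0.
  rewrite -[X in X + _]mul1r -(io1 sc) -mulrDl -ioD mulrCA -ioM rnM !rn_io.
  rewrite -expr2 exprVn ss !ger0_norm ?invr_ge0 //; rewrite -/g; lra.
have [||T [c [T1 TE c1 cg]]] := normalize_op (d := g) T01 x01.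
- by lra.
- by rewrite T0x; lra.
have [|S [S1 Sx ST]] := hd T T1.
  rewrite TE nxZr ?T0x; nra.
have [h [hl h1 hx hE]] := linf_unit_form S1 Sx x01.
have [z [zE z1]] := vec2_ex sc 0 1 n.
have nn0 : rn (io (1 - gap n) * 0 + 1) = 1 by rewrite mulr0 add0r rn1.
rewrite nn0 rn1 rn0 (max_idPr _) ?ler01 // in z1.
have [t t1 ht] := align_form sc x0 (io (g / s2) *: z) hl.
have hz : rn (h z) * 2 <= g.
  have [y [yE y1]] := vec2_ex sc 1 (t * io g) n.
  have yx : x0 + t *: (io (g / s2) *: z) = io s2^-1 *: y.
    apply: coords_inj => i; rewrite scalerA coordsD !coordsZ x0E yE zE.
    rewrite -[(vec2 _ 0 0%N + _) i]/(vec2 (io s2^-1) 0 0%N i +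
      (t * io (g / s2)) * vec2 0 1 n i)
      -[(_ *: _) i]/(io s2^-1 * vec2 1 (t * io g) n i) /vec2.
    case: eqP => _; first by rewrite mulr0 addr0 mulr1.
    rewrite fun_if; case: eqP => _; case: eqP => _;
      rewrite ?mulr0 ?addr0 ?add0r ?mulr1 //;
      by rewrite ioM; ring.
  rewrite yx hx lin_formZ // lin_formZ // !rnM !rn_io in ht.
  rewrite !ger0_norm ?invr_ge0 ?divr_ge0 ?(ltW g0) ?(ltW s0) // in ht.
  have hy := h1 y.
  have : rn (h y) = s2 + g * rn (h z).
    apply: (@mulfI _ s2^-1); first by rewrite invr_eq0 gt_eqF.
    by rewrite ht mulrDr mulVf ?gt_eqF //; ring.
  have y2 : nx y ^+ 2 <= 2 + g ^+ 2.
    apply: le_trans y1 _; rewrite rn1 rnM t1 mul1r rn_io (ger0_norm (ltW g0)).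
    have : Num.max 1 (rn (io (1 - gap n) * 1 + t * io g)) = 1.
      apply/max_idPl; rewrite mulr1; apply: le_trans (rnD _ _ _) _.
      rewrite rnM t1 mul1r !rn_io -/g !ger0_norm; lra.
    by move=> ->; lra.
  move=> hye; rewrite hye in hy.
  have := nx_ge0 sc y; have := rn_ge0 sc (h z) => hz0 ny0.
  have : (s2 + g * rn (h z)) ^+ 2 <= 2 + g ^+ 2.
    by apply: le_trans y2; rewrite ler_sqr ?nnegrE // addr_ge0 ?mulr_ge0 ?(ltW s0) ?(ltW g0).
  move: sb => /andP[sb1 sb2].
  have : 0 <= (g * rn (h z)) ^+ 2 by exact: sqr_ge0.
  move=> q0 q1; have : g * (2 * s2 * rn (h z)) <= g * g by nra.
  rewrite ler_pM2l // => q2; nra.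
have := op_near_le z ST; rewrite linf_unit.
change (rn (coords (S z) tt - coords (T z) tt) <= 1 / 4 * nx z -> False).
have -> : coords (S z) tt = h z by rewrite hE.
have -> : coords (T z) tt = io (c * s2^-1).
  rewrite TE; change (io c * coords (T0 z) tt = io (c * s2^-1)).
  rewrite T0E ioM.
  congr (_ * _); rewrite /tilt_form zE /tilt /vec2 /= !eqxx mulr0 !add0r.
  by rewrite mulr1.
move=> q; have nz := nx_ge0 sc z.
have := rnB sc (io (c * s2^-1)) (h z); rewrite rnBC rn_io ger0_norm; last first.
  by rewrite mulr_ge0 ?invr_ge0 ?(ltW s0) //; lra.
have : c * s2^-1 >= s2^-1 by rewrite ler_peMl ?invr_ge0 ?(ltW s0).
have : s2^-1 = s2 / 2 by rewrite -{3}ss expr2 invfM mulrA divff ?mul1r ?gt_eqF.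
have := rn_ge0 sc (h z); move: sb => /andP[sb1 sb2]; nra.
Qed.

End RoundedSupPairs2.

Section RoundedSupPairs3.
Variables (K : numFieldType) (R : realType) (sc : scalars K R).
Local Notation io := (io sc).
Local Notation rn := (rn sc).
Local Notation nx := (nx sc).
Local Notation X := (banach (rsup sc)).
Local Notation gap := (@gap R).
Local Notation s2 := (Num.sqrt 2 : R).

Definition coord_form k (x : X) : K := coords x k.

Lemma coord_form_lin k : lin_form (coord_form k). Proof. by []. Qed.

Lemma coord_form_le k x : rn (coord_form k x) <= nx x.
Proof.
apply: le_trans (@fs_le_nx _ _ _ (rsup sc) x k.+1).
by apply: le_trans (hyp_gel _ (ell2_ge0 _ _ _)); exact: coord_le_ell2.
Qed.

Lemma coord_form_attains k : exists x, attains_at sc (coord_form k) x /\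
  1 <= 2 * rn (coord_form k x).
Proof.
have le1 x : rn (coord_form k x) <= 1 * nx x by rewrite mul1r coord_form_le.
have [x fx] := uc_attains (@rsup_uc _ _ sc) (coord_form_lin k) le1.
exists x; split=> //.
have [y [yk y1]] : exists y : X, coord_form k y = 1 /\ nx y ^+ 2 <= 2.
  case: k {le1 x fx} => [|k].
    have [y [yE y1]] := vec2_ex sc 1 0 0; exists y; rewrite /coord_form yE.
    split=> //; apply: le_trans y1 _; rewrite rn1 rn0 addr0 mulr1 rn_io.
    have := @gap_gt0 R 0; have := @gap_le R 0 => g1 g2.
    by rewrite (max_idPl _) ?ger0_norm; lra.
  have [y [yE y1]] := vec2_ex sc 0 1 k; exists y; rewrite /coord_form yE.
  split; first by rewrite /vec2 eqxx.
  apply: le_trans y1 _; rewrite mulr0 add0r rn1 rn0 (max_idPr _) ?ler01 //; lra.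
have [_ /(_ y)] := fx; rewrite yk rn1 => h.
have := rn_ge0 sc (coord_form k x); have := nx_ge0 sc y; nra.
Qed.

Lemma rsup_not_Lop : ~ Lop K X (banach (linf sc 0%N)).
Proof.
have [f [fl f1 fE]] := tilt_form_limit sc.
have [x0 [x0E x01]] := unit_e0_ex sc.
have [z [zA z2]] := coord_form_attains 1.
have z0 : 0 < rn (coord_form 1 z) by lra.
have [gl g1 gz nz] := normalized_form (coord_form_lin 1) zA z0.
apply: (@not_Lop_linf _ _ sc X _ 0%N 1%N f
  (fun y => io (rn (coord_form 1 z))^-1 * coord_form 1 y) x0 z) => //.
- rewrite (fE _ _ _ _ x0E) -ioM divff ?gt_eqF ?s2_gt0 //.
  by rewrite io1 rn1.
- by rewrite nz.
- by rewrite /= /coord_form x0E mulr0.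
Qed.

                                                                               
                                                            
(** The components are normalized coordinate forms, the k-th multiplied by [1 - gap k]. The norm is
    one, but the coordinates of a point tend to 0, so only finitely many components compete, each of
    norm below one: the norm is attained nowhere. *)
Lemma rsup_not_Loo : ~ Loo K X (banach (linf sc 0%N)).
Proof.
move=> /(LooP sc) hL.
pose z k := sval (cid (coord_form_attains k)).
have zA k : attains_at sc (coord_form k) (z k) := (svalP (cid (coord_form_attains k))).1.
have z2 k : 1 <= 2 * rn (coord_form k (z k)) :=
  (svalP (cid (coord_form_attains k))).2.
have z0 k : 0 < rn (coord_form k (z k)) by have := z2 k; lra.
pose g k x := io (rn (coord_form k (z k)))^-1 * coord_form k x.
have gP k := normalized_form (coord_form_lin k) (zA k) (z0 k).
have g01 k : 0 <= 1 - gap k <= 1.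
  by have := @gap_le R k; have := @gap_gt0 R k => ? ?; apply/andP; split; lra.
pose h k x := io (1 - gap k) * g k x.
have hn k x : rn (h k x) = (1 - gap k) * rn (g k x).
  by rewrite rnM rn_io ger0_norm //; case/andP: (g01 k).
have [||T [TE T1]] := @linf_op_ex _ _ sc X _ 0%N h 1.
- by move=> k a x y; have [gl _ _ _] := gP k; rewrite /h /g gl mulrDr mulrCA.
- move=> k x; rewrite mul1r hn; have [_ /(_ x) gx _ _] := gP k.
  by apply: le_trans gx; rewrite ler_piMl ?rn_ge0 //; case/andP: (g01 k).
have sharp k : 1 - gap k <= nx (T (z k)).
  apply: le_trans (@fs_le_nx _ _ _ (linf sc 0%N) (T (z k)) k).
  by rewrite /= TE hn; have [_ _ -> _] := gP k; rewrite mulr1.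
have T1' : norm_one sc T.
  split=> // e e0; have [k gk] := gap_pick e0.
  exists (z k); first by have [_ _ _ ->] := gP k.
  by apply: lt_le_trans (sharp k); rewrite ltrD2l ltrN2.
have [d d0 hd] := hL 1 T ltr01 T1'.
have [k gk] := gap_pick d0.
have [||x0 [x01 Tx0 _]] := hd (z k); first by have [_ _ _ ->] := gP k.
  by apply: lt_le_trans (sharp k); rewrite ltrD2l ltrN2.
have ell1 M : ell2 (p_coord sc) M (coords x0) <= 1.
  rewrite -x01; apply: le_trans (@fs_le_nx _ _ _ (rsup sc) x0 M).
  exact/hyp_gel/ell2_ge0.
(* From [M] on the coordinates are at most 1/4, and the normalization at most doubles them. *)
have [|M hM] := ell2_tail (e := 1 / 16) ell1; first by rewrite divr_gt0.
suff : nx (T x0) <= Num.max (1 / 2) (1 - gap M).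
  by rewrite Tx0 leNgt gt_max; have := @gap_gt0 R M => ?; apply/negP/negPn/andP; split; lra.
apply: nx_le => j; rewrite [leLHS](_ : _ = rn (h j x0)); last by rewrite -TE.
rewrite hn le_max; have /andP[p0 p1] := g01 j.
have [jM|Mj] := ltnP j M; apply/orP; [right|left].
  apply: (@le_trans _ _ (1 - gap j)).
    rewrite ler_piMr //; have [_ /(_ x0) + _ _] := gP j; rewrite x01; exact.
  rewrite lerD2l lerN2 lef_pV2 ?posrE ?ltr0n // ler_nat !ltnS; exact: ltnW.
apply: (@le_trans _ _ (rn (g j x0))); first by rewrite ler_piMl ?rn_ge0.
rewrite rnM rn_io ger0_norm ?invr_ge0 ?rn_ge0 // mulrC ler_pdivrMr //.
have : rn (coord_form j x0) ^+ 2 <= 1 / 16.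
  have := hM j.+1; rewrite big_nat_recr //=; apply: le_trans.
  by rewrite -[leLHS]add0r lerD // sumr_ge0 // => i _; rewrite sqr_ge0.
by have := z2 j; have := rn_ge0 sc (coord_form j x0); nra.
Qed.

End RoundedSupPairs3.

                        

(** * Planes close to ℓ1, and the plane ℓ1 itself *)

Section Planes.
Variables (K : numFieldType) (R : realType) (sc : scalars K R).
Local Notation io := (io sc).
Local Notation rn := (rn sc).
Local Notation nx := (nx sc).

                                                                              
                                                                          
(** A copy of the two-dimensional ℓ1 up to the factor [1 + 2 * d], with coordinate forms [a] and
    [b]. By [plane_move], changing [x] inside the plane affects its squared norm as for a summand of
    an ℓ2-sum. *)
Record plane (X : normedModType K) (d : R) (a b : X -> K) (e1 e2 : X) := Plane {
  plane_a : lin_form a;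
  plane_b : lin_form b;
  plane_a1 : a e1 = 1;
  plane_b1 : b e1 = 0;
  plane_a2 : a e2 = 0;
  plane_b2 : b e2 = 1;
  plane_le : forall x, rn (a x) + rn (b x) <= nx x;
  plane_ge : forall s t,
    nx (s *: e1 + t *: e2) <= (1 + 2 * d) * (rn s + rn t);
  plane_move : forall x s t, nx (x + (s *: e1 + t *: e2)) ^+ 2 <= nx x ^+ 2 +
    ((1 + 2 * d) ^+ 2 * (rn (a x + s) + rn (b x + t)) ^+ 2 -
     (rn (a x) + rn (b x)) ^+ 2) }.

Definition ell1_seminorm (_ : unit) (v : bool -> K^o) := rn (v true) + rn (v false).

Lemma good_ell1 j : good sc (ell1_seminorm j).
Proof. exact: good_add (good_coord sc true) (good_coord sc false). Qed.

Definition ell1 : family sc.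
Proof.
refine (@Family _ _ sc bool unit ell1_seminorm good_ell1 _ tt) => i.
by exists 1, tt => v; rewrite mul1r; case: i; rewrite ?lerDl ?lerDr rn_ge0.
Defined.

Local Notation X := (banach ell1).

Lemma ell1_nx (x : X) : nx x = rn (coords x true) + rn (coords x false).
Proof.
apply/eqP; rewrite eq_le (@fs_le_nx _ _ _ ell1 x tt) andbT.
by apply: nx_le => -[].
Qed.

Lemma ell1_vec (s t : K) : exists x : X, coords x = fun i => if i then s else t.
Proof.
have hb : ((fun i => if i then s else t) : bool -> K^o) \in @fbdd _ _ _ ell1.
  by apply/fbddP; exists (rn s + rn t).
by exists (Space hb).
Qed.

Lemma ell1_plane : exists a b : X -> K, exists e1 e2 : X,
  [/\ plane 0 a b e1 e2, forall x, x = a x *: e1 + b x *: e2 &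
    forall x, nx x = rn (a x) + rn (b x)].
Proof.
have [e1 e1E] := ell1_vec 1 0; have [e2 e2E] := ell1_vec 0 1.
pose a (x : X) : K := coords x true; pose b (x : X) : K := coords x false.
have al : lin_form a by [].
have bl : lin_form b by [].
have a1 : a e1 = 1 by rewrite /a e1E.
have b1 : b e1 = 0 by rewrite /b e1E.
have a2 : a e2 = 0 by rewrite /a e2E.
have b2 : b e2 = 1 by rewrite /b e2E.
have nE x : nx x = rn (a x) + rn (b x) := ell1_nx x.
have ab_inj x y : a x = a y -> b x = b y -> x = y.
  by move=> axy bxy; apply: coords_inj => -[].
clearbody a b.
have as_ s t : a (s *: e1 + t *: e2) = s.
  by rewrite (lin_formD _ _ al) !(lin_formZ _ _ al) a1 a2 mulr1 mulr0 addr0.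
have bs s t : b (s *: e1 + t *: e2) = t.
  by rewrite (lin_formD _ _ bl) !(lin_formZ _ _ bl) b1 b2 mulr1 mulr0 add0r.
exists a, b, e1, e2; split=> //.
  split=> //; first by move=> x; rewrite nE.
    by move=> s t; rewrite nE as_ bs mulr0 addr0 mul1r.
  move=> x s t; rewrite !nE (lin_formD x _ al) (lin_formD x _ bl) as_ bs.
  by rewrite mulr0 addr0 expr1n mul1r addrCA subrr addr0.
by move=> x; apply: ab_inj; rewrite ?as_ ?bs.
Qed.

(** Compactness of the ball: a sequence of almost norming points without a good neighbour would have
    a norm limit, and [T] attains its norm at that limit. *)
Lemma ell1_Loo (Y : completeNormedModType K) : Loo K X Y.
Proof.
apply/(LooP sc) => e T e0 T1; apply: contrapT => hn.
have hx n : exists x : X, [/\ nx x = 1, 1 - n.+1%:R^-1 < nx (T x) &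
    ~ attain_point sc e T x].
  apply: contrapT => hx; apply: hn; exists n.+1%:R^-1; first by rewrite invr_gt0.
  by move=> x x1 Tx; apply: contrapT => hp; apply: hx; exists x.
pose u n := sval (cid (hx n)).
have hu n : [/\ nx (u n) = 1, 1 - n.+1%:R^-1 < nx (T (u n)) &
    ~ attain_point sc e T (u n)] := svalP (cid (hx n)).
have u1 n : snorm (u n) <= 1 by rewrite -nx_snorm; have [-> _ _] := hu n.
have [x [_ xu _]] := space_ulim u1.
have xlim : ulim (fun n => nx (u n - x)) 0.
  apply: ulim_ext (good_ulim (good_ell1 tt) xu) => n.
  by rewrite ell1_nx.
have x1 : nx x = 1.
  apply: (@ulim_unique _ (fun _ => nx x)); first exact: ulim_cst.
  apply: ulim_dist xlim => n; have [<- _ _] := hu n.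
  by rewrite ler_norml nxBC nxB andbT lerNl opprB nxBC nxB.
have Tx : nx (T x) = 1.
  apply/eqP; rewrite eq_le -{1}x1 norm_one_le //=.
  apply: (@ulim_le _ (fun n => 1 - n.+1%:R^-1) (fun n => nx (T x) + nx (u n - x))).
  + apply: filterS filterT => n _ /=; have [_ /ltW h _] := hu n.
    apply: le_trans h _; rewrite -lerBlDl; apply: le_trans (nxB _ _ _) _.
    by rewrite -linearB norm_one_le.
  + by have := ulimB (ulim_cst (1 : R)) (@ulim_inv R); rewrite subr0.
  + by have := ulimD (ulim_cst (nx (T x))) xlim; rewrite addr0.
have [n [_ ]] := filter_ex (filterI (filterT) (xlim e e0)).
rewrite /= subr0 => hn'; have [_ _ ] := hu n; apply.
by exists x; split=> //; rewrite nxBC; apply: le_lt_trans (ler_norm _) hn'.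
Qed.

(** Compactness of the dual ball: forms almost norming at [x] accumulate at one attaining its norm
    at [x], and closeness at [e1] and [e2] is closeness in norm. *)
Lemma ell1_Lpp : Lpp K X (banach (linf sc tt)).
Proof.
have [a [b [e1 [e2 [P xE nE]]]]] := ell1_plane.
apply/(LppP sc) => e x e0 x1; apply: contrapT => hn.
have hT n : exists T : {linear X -> banach (linf sc tt)}, [/\ norm_one sc T,
    1 - n.+1%:R^-1 < nx (T x) & ~ attain_op sc e T x].
  apply: contrapT => hx; apply: hn; exists n.+1%:R^-1; first by rewrite invr_gt0.
  by move=> T T1 Tx; apply: contrapT => hp; apply: hx; exists T.
pose u n := sval (cid (hT n)).
have hu n : [/\ norm_one sc (u n), 1 - n.+1%:R^-1 < nx (u n x) &
    ~ attain_op sc e (u n) x] := svalP (cid (hT n)).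
pose f n z := coords (u n z) tt.
have fl n : lin_form (f n) by exact: linf_comp.
have f1 n z : rn (f n z) <= 1 * nx z.
  by rewrite mul1r; apply: linf_comp_le; have [] := hu n.
have [g [gl g1 glim]] := ulim_form fl f1.
have g1' z : rn (g z) <= nx z by rewrite -[leRHS]mul1r.
have gx : rn (g x) = 1.
  apply/eqP; rewrite eq_le -{1}x1 g1' /=.
  apply: (@ulim_le _ (fun n => 1 - n.+1%:R^-1)
    (fun n => rn (g x) + rn (f n x - g x))).
  + apply: filterS filterT => n _ /=; have [_ /ltW h _] := hu n.
    apply: le_trans h _; rewrite linf_unit -/(f n x) -lerBlDl; exact: rnB.
  + by have := ulimB (ulim_cst (1 : R)) (@ulim_inv R); rewrite subr0.
  + by have := ulimD (ulim_cst (rn (g x))) (glim x); rewrite addr0.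
have e2p : 0 < e / 2 by rewrite divr_gt0.
have [n [h1 h2]] := filter_ex (filterI (glim e1 _ e2p) (glim e2 _ e2p)).
move: h1 h2; rewrite /= !subr0 !ger0_norm ?rn_ge0 // => h1 h2.
have [u1 _ hn'] := hu n; apply: hn'.
apply: (linf_replace (k := tt) (g := g) (c := e / 2)) => //; first by lra.
move=> z; rewrite -/(f n z) {1 2}(xE z) rnBC.
rewrite !(lin_formD _ _ gl) !(lin_formD _ _ (fl n)) !(lin_formZ _ _ gl).
rewrite !(lin_formZ _ _ (fl n)).
have -> : a z * f n e1 + b z * f n e2 - (a z * g e1 + b z * g e2) =
  a z * (f n e1 - g e1) + b z * (f n e2 - g e2) by ring.
apply: le_trans (rnD _ _ _) _; rewrite !rnM nE.
have := rn_ge0 sc (a z); have := rn_ge0 sc (b z); nra.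
Qed.

(** The first coordinate is almost norming inside the edge, near the corner [e1]. A form attaining
    its norm inside the edge has modulus one at [e2], where the first coordinate vanishes. *)
Lemma ell1_not_Lpo : ~ Lpo K X (banach (linf sc tt)).
Proof.
have [a [b [e1 [e2 [P xE nE]]]]] := ell1_plane.
have [al bl a1 b1 a2 b2 _ _ _] := P.
have a_le x : rn (a x) <= nx x by rewrite nE lerDl rn_ge0.
move=> /(LpoP sc) hL.
have [||T [TE T1]] := @linf_op_ex _ _ sc X _ tt (fun _ => a) 1.
- by [].
- by move=> _ x; rewrite mul1r.
have e11 : nx e1 = 1 by rewrite nE a1 b1 rn0 rn1 addr0.
have e21 : nx e2 = 1 by rewrite nE a2 b2 rn0 rn1 add0r.
have T1' : norm_one sc T.
  by apply: (norm_oneP T1 (x := e1)); rewrite ?e11 // linf_unit TE a1 rn1.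
have [|d d0 hd] := hL (1 / 2) T _ T1'; first by rewrite divr_gt0.
pose s := Num.min (d / 2) (1 / 2).
have s0 : 0 < s by rewrite lt_min !divr_gt0.
have sd : s <= d / 2 by rewrite ge_min lexx.
have s1 : s <= 1 / 2 by rewrite ge_min lexx orbT.
pose x := io (1 - s) *: e1 + io s *: e2.
have ax : a x = io (1 - s).
  by rewrite (lin_formD _ _ al) !(lin_formZ _ _ al) a1 a2 mulr1 mulr0 addr0.
have bx : b x = io s.
  by rewrite (lin_formD _ _ bl) !(lin_formZ _ _ bl) b1 b2 mulr1 mulr0 add0r.
have x1 : nx x = 1 by rewrite nE ax bx !rn_io !ger0_norm; lra.
have [|S [S1 Sx ST]] := hd x x1.
  rewrite linf_unit TE ax rn_io ger0_norm; lra.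
have hl := linf_comp S tt; have h1 z := linf_comp_le tt z S1.
set h := fun z => coords (S z) tt in hl h1.
have := rnD sc (h (io (1 - s) *: e1)) (h (io s *: e2)).
rewrite -lin_formD // -/x -linf_unit Sx !lin_formZ // !rnM !rn_io.
have := h1 e1; have := op_near_le e2 ST; rewrite linf_unit.
change (rn (h e2 - coords (T e2) tt) <= 1 / 2 * nx e2 -> rn (h e1) <= nx e1 ->
  1 <= `|1 - s| * rn (h e1) + `|s| * rn (h e2) -> False).
rewrite TE a2 subr0 e11 e21 !ger0_norm; try by clear -s0 s1; lra.
by move=> h3 h4 h5; clear -h3 h4 h5 s0 s1; nra.
Qed.

(** The form [a + (1 - s) b] is [1 - s / 2] at the midpoint of the edge, but attains its norm only
    where [b] vanishes. *)
Lemma ell1_not_Lop : ~ Lop K X (banach (linf sc tt)).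
Proof.
have [a [b [e1 [e2 [P xE nE]]]]] := ell1_plane.
have [al bl a1 b1 a2 b2 _ _ _] := P.
move=> /(LopP sc) hL.
pose x := io (1 / 2) *: e1 + io (1 / 2) *: e2.
have ax : a x = io (1 / 2).
  by rewrite (lin_formD _ _ al) !(lin_formZ _ _ al) a1 a2 mulr1 mulr0 addr0.
have bx : b x = io (1 / 2).
  by rewrite (lin_formD _ _ bl) !(lin_formZ _ _ bl) b1 b2 mulr1 mulr0 add0r.
have x1 : nx x = 1 by rewrite nE ax bx !rn_io !ger0_norm; lra.
have [|d d0 hd] := hL (1 / 4) x _ x1; first by rewrite divr_gt0.
pose s := Num.min d (1 / 2).
have s0 : 0 < s by rewrite lt_min d0 divr_gt0.
have sd : s <= d by rewrite ge_min lexx.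
have s1 : s <= 1 / 2 by rewrite ge_min lexx orbT.
have [||T [TE T1]] :=
  @linf_op_ex _ _ sc X _ tt (fun _ z => a z + io (1 - s) * b z) 1.
- by move=> _ t y z; rewrite al bl; ring.
- move=> _ z; rewrite mul1r; apply: le_trans (rnD _ _ _) _; rewrite nE lerD2l.
  rewrite rnM rn_io ger0_norm; last by lra.
  by rewrite ler_piMl ?rn_ge0 //; lra.
have e11 : nx e1 = 1 by rewrite nE a1 b1 rn0 rn1 addr0.
have T1' : norm_one sc T.
  apply: (norm_oneP T1 (x := e1)); rewrite ?e11 // linf_unit TE a1 b1.
  by rewrite mulr0 addr0 rn1.
have [|y [y1 Ty yx]] := hd T T1'.
  by rewrite linf_unit TE ax bx -ioM -ioD rn_io ger0_norm; lra.
move: Ty y1; rewrite linf_unit TE nE.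
have := rnD sc (a y) (io (1 - s) * b y); rewrite rnM rn_io ger0_norm; last by lra.
have : 1 / 2 - rn (b y) < 1 / 4.
  apply: le_lt_trans yx.
  have := rnB sc (b x) (b y); rewrite {1}bx rn_io ger0_norm; last by lra.
  move=> h; apply: le_trans h _; rewrite -lin_formB // nxBC nE lerDr rn_ge0 //.
by move=> h1 h2 h3 h4; clear -h1 h2 h3 h4 s0 s1; nra.
Qed.

End Planes.

                                           

(** * Smooth and rotund planes tending to ℓ1 *)

Section Blocks.
Variables (K : numFieldType) (R : realType) (sc : scalars K R).
Local Notation io := (io sc).
Local Notation rn := (rn sc).
Local Notation nx := (nx sc).

(** The weight of the rotund term in the n-th plane of [mixed], while [dlt n] is the distortion of
    the n-th plane of [blocks]. Taking [dlt n] as the square of [kap n / 32] makes it negligible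
    against [kap n ^+ 2] in [planes_not_BPBp]. *)
Definition kap n : R := n.+4%:R^-1.
Definition dlt : nat -> R := locked (fun n => (kap n / 32) ^+ 2).

Lemma dltE n : dlt n = (kap n / 32) ^+ 2. Proof. by rewrite /dlt -lock. Qed.

Lemma kap_gt0 n : 0 < kap n. Proof. by rewrite invr_gt0. Qed.

Lemma kap_le n : kap n <= 1 / 4.
Proof. by rewrite div1r lef_pV2 ?posrE ?ltr0n // ler_nat. Qed.

Lemma kap_pick e : 0 < e -> exists n, kap n < e.
Proof.
move=> e0; have [N hN] := ltr_add_invr e0; rewrite add0r in hN.
exists N; apply: le_lt_trans hN.
by rewrite lef_pV2 ?posrE ?ltr0n // ler_nat; apply/leqW/leqW/leqW.
Qed.

Lemma dlt_gt0 n : 0 < dlt n.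
Proof. by rewrite dltE; apply/exprn_gt0/divr_gt0; rewrite ?kap_gt0 ?ltr0n. Qed.

Lemma dlt_le_kap n : dlt n <= kap n / 32.
Proof. by rewrite dltE; have := kap_gt0 n; have := kap_le n; nra. Qed.

Lemma dlt_le n : dlt n <= 1 / 32.
Proof. by have := dlt_le_kap n; have := kap_le n; lra. Qed.

Lemma sqr_kap n : kap n ^+ 2 = dlt n * 32 ^+ 2.
Proof. by rewrite dltE -exprMn divfK. Qed.

Implicit Types v w : nat * bool -> K^o.

Definition ca n v : R := rn (v (n, true)).
Definition cb n v : R := rn (v (n, false)).
Definition euc n v := hyp (ca n v) (cb n v).
Definition hypl n v := hyp (ca n v) (dlt n * cb n v).
Definition hypr n v := hyp (cb n v) (dlt n * ca n v).
(** The ℓ1 norm with both moduli smoothed: [hypl] and [hypr] are Hilbertian, so their sum is smooth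
    off the origin, and the Euclidean term adds rotundity. *)
Definition bnorm n v := hyp (hypl n v + hypr n v) (dlt n * euc n v).

Lemma good_ca n : good sc (ca n). Proof. exact: good_coord. Qed.
Lemma good_cb n : good sc (cb n). Proof. exact: good_coord. Qed.

Lemma good_dlt n (p : (nat * bool -> K^o) -> R) :
  good sc p -> good sc (fun v => dlt n * p v).
Proof. by apply: good_scale; exact/ltW/dlt_gt0. Qed.

Lemma good_euc n : good sc (euc n).
Proof. exact: good_hyp (good_ca n) (good_cb n). Qed.
Lemma good_hypl n : good sc (hypl n).
Proof. exact: good_hyp (good_ca n) (good_dlt n (good_cb n)). Qed.
Lemma good_hypr n : good sc (hypr n).
Proof. exact: good_hyp (good_cb n) (good_dlt n (good_ca n)). Qed.
Lemma good_bnorm n : good sc (bnorm n).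
Proof.
exact: good_hyp (good_add (good_hypl n) (good_hypr n)) (good_dlt n (good_euc n)).
Qed.

Lemma ca_ge0 n v : 0 <= ca n v. Proof. exact: rn_ge0. Qed.
Lemma cb_ge0 n v : 0 <= cb n v. Proof. exact: rn_ge0. Qed.
Lemma bnorm_ge0 n v : 0 <= bnorm n v. Proof. exact: hyp_ge0. Qed.

Lemma bnorm_ge n v : ca n v + cb n v <= bnorm n v.
Proof.
apply: le_trans (hyp_gel _ _); last by rewrite addr_ge0 ?hyp_ge0.
by rewrite lerD // hyp_gel ?ca_ge0 ?cb_ge0.
Qed.

Lemma bnorm_le n v : bnorm n v <= (1 + 2 * dlt n) * (ca n v + cb n v).
Proof.
have d0 := dlt_gt0 n; have a0 := ca_ge0 n v; have b0 := cb_ge0 n v.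
have da : 0 <= dlt n * ca n v by rewrite mulr_ge0 // ltW.
have db : 0 <= dlt n * cb n v by rewrite mulr_ge0 // ltW.
apply: le_trans (hyp_leD _ _) _.
- by rewrite addr_ge0 ?hyp_ge0.
- by rewrite mulr_ge0 ?hyp_ge0 // ltW.
have H1 : hypl n v <= _ := hyp_leD a0 db.
have H2 : hypr n v <= _ := hyp_leD b0 da.
have H3 : dlt n * euc n v <= dlt n * (ca n v + cb n v).
  by rewrite ler_pM2l // hyp_leD.
lra.
Qed.

Lemma bnorm_le_euc n v : bnorm n v <= 4 * euc n v.
Proof.
have d1 := dlt_le n; have a0 := ca_ge0 n v; have b0 := cb_ge0 n v.
have q := hyp_ge0 (ca n v) (cb n v).
have h : hyp 1 1 <= 3 / 2 :> R by apply: le_of_sqr; rewrite ?sqr_hyp; lra.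
have := cauchy_schwarz2 (ca n v) (cb n v) 1 1; rewrite !mulr1 => cs.
apply: (@le_trans _ _ (2 * (ca n v + cb n v))).
  by apply: le_trans (bnorm_le n v) _; rewrite ler_wpM2r ?addr_ge0 //; lra.
have : hyp (ca n v) (cb n v) * hyp 1 1 <= hyp (ca n v) (cb n v) * (3 / 2).
  by rewrite ler_wpM2l.
by rewrite /euc; lra.
Qed.

Lemma ca_parallelogram n v w :
  ca n (v + w) ^+ 2 + ca n (v - w) ^+ 2 = 2 * ca n v ^+ 2 + 2 * ca n w ^+ 2.
Proof. exact: rn_parallelogram. Qed.

Lemma cb_parallelogram n v w :
  cb n (v + w) ^+ 2 + cb n (v - w) ^+ 2 = 2 * cb n v ^+ 2 + 2 * cb n w ^+ 2.
Proof. exact: rn_parallelogram. Qed.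

Lemma euc_parallelogram n v w :
  euc n (v + w) ^+ 2 + euc n (v - w) ^+ 2 = 2 * euc n v ^+ 2 + 2 * euc n w ^+ 2.
Proof.
rewrite !sqr_hyp.
have := ca_parallelogram n v w; have := cb_parallelogram n v w; lra.
Qed.

Lemma parallelogram_comb (D A A' B B' a a' b b' : R) :
  A + A' = 2 * a + 2 * a' -> B + B' = 2 * b + 2 * b' ->
  (A + D * B) + (A' + D * B') = 2 * (a + D * b) + 2 * (a' + D * b').
Proof.
move=> h h'; have : D * (B + B') = D * (2 * b + 2 * b') by rewrite h'.
by clear h'; lra.
Qed.

Lemma hypl_parallelogram n v w :
  hypl n (v + w) ^+ 2 + hypl n (v - w) ^+ 2 = 2 * hypl n v ^+ 2 + 2 * hypl n w ^+ 2.
Proof.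
rewrite !sqr_hyp !exprMn; apply: parallelogram_comb.
  exact: ca_parallelogram.
exact: cb_parallelogram.
Qed.

Lemma hypr_parallelogram n v w :
  hypr n (v + w) ^+ 2 + hypr n (v - w) ^+ 2 = 2 * hypr n v ^+ 2 + 2 * hypr n w ^+ 2.
Proof.
rewrite !sqr_hyp !exprMn; apply: parallelogram_comb.
  exact: cb_parallelogram.
exact: ca_parallelogram.
Qed.

Lemma hypl_le_hypr n v : dlt n * hypl n v <= hypr n v.
Proof.
have d0 := dlt_gt0 n; have d1 := dlt_le n.
apply: le_of_sqr; first exact: hyp_ge0.
rewrite exprMn !sqr_hyp !exprMn.
have : dlt n ^+ 4 * cb n v ^+ 2 <= cb n v ^+ 2.
  by rewrite ler_piMl ?sqr_ge0 // expr_le1 //; lra.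
rewrite (exprD _ 2 2); lra.
Qed.

Lemma hypr_le_hypl n v : dlt n * hypr n v <= hypl n v.
Proof.
have d0 := dlt_gt0 n; have d1 := dlt_le n.
apply: le_of_sqr; first exact: hyp_ge0.
rewrite exprMn !sqr_hyp !exprMn.
have : dlt n ^+ 4 * ca n v ^+ 2 <= ca n v ^+ 2.
  by rewrite ler_piMl ?sqr_ge0 // expr_le1 //; lra.
rewrite (exprD _ 2 2); lra.
Qed.

                                                                               
                                                 
(** A sum of two Hilbertian norms is smooth where they are comparable up to [k]; [x], [y] are the
    norms of the base vector and [r], [s] those of the increment. Cauchy-Schwarz bounds the cross
    term by the root of (2x^2 + 2r^2)(2y^2 + 2s^2), and x^2 <= kxy, y^2 <= kxy absorb the mixed
    products. *)
Lemma sum_smooth (k x y r s A1 A2 B1 B2 : R) : 1 <= k ->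
  0 <= x -> 0 <= y -> 0 <= r -> 0 <= s -> x <= k * y -> y <= k * x ->
  A1 ^+ 2 + A2 ^+ 2 = 2 * x ^+ 2 + 2 * r ^+ 2 ->
  B1 ^+ 2 + B2 ^+ 2 = 2 * y ^+ 2 + 2 * s ^+ 2 ->
  (A1 + B1) ^+ 2 + (A2 + B2) ^+ 2 <=
  2 * (x + y) ^+ 2 + 6 * k * (r ^+ 2 + s ^+ 2).
Proof.
move=> k1 x0 y0 r0 s0 xy yx hA hB.
have cs : A1 * B1 + A2 * B2 <= 2 * (x * y + k * (r ^+ 2 + s ^+ 2)).
  apply: le_of_sqr.
    by rewrite mulr_ge0 // addr_ge0 ?mulr_ge0 ?addr_ge0 ?sqr_ge0 //; lra.
  have e1 : (A1 * B1 + A2 * B2) ^+ 2 <=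
      (A1 ^+ 2 + A2 ^+ 2) * (B1 ^+ 2 + B2 ^+ 2).
    by have := sqr_ge0 (A1 * B2 - A2 * B1); nra.
  apply: le_trans e1 _; rewrite hA hB.
  have p1 : x ^+ 2 * s ^+ 2 <= k * (x * y) * s ^+ 2.
    by rewrite ler_wpM2r ?sqr_ge0 // expr2 mulrCA ler_wpM2l.
  have p2 : y ^+ 2 * r ^+ 2 <= k * (x * y) * r ^+ 2.
    by rewrite ler_wpM2r ?sqr_ge0 // expr2 [x * y]mulrC mulrCA ler_wpM2l.
  have p3 : r ^+ 2 * s ^+ 2 <= k ^+ 2 * (r ^+ 2 + s ^+ 2) ^+ 2.
    apply: (@le_trans _ _ ((r ^+ 2 + s ^+ 2) ^+ 2)).
      by have := sqr_ge0 r; have := sqr_ge0 s; set a := r ^+ 2; set b := s ^+ 2; nra.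
    by rewrite ler_peMl ?sqr_ge0 // expr_ge1 //; lra.
  have p4 : 0 <= k * (x * y) * (r ^+ 2 + s ^+ 2).
    apply: mulr_ge0; last by rewrite addr_ge0 ?sqr_ge0.
    by apply: mulr_ge0; [lra|exact: mulr_ge0].
  move: p1 p2 p3 p4; clear; lra.
have : 0 <= (k - 1) * (r ^+ 2 + s ^+ 2).
  by apply: mulr_ge0; [lra|rewrite addr_ge0 ?sqr_ge0].
lra.
Qed.

(** From [sum_smooth] with [k] the inverse of [dlt n]; the constant blows up with n, which is why
    smoothness holds only where tails are small. *)
Lemma bnorm_smooth n v w : bnorm n (v + w) ^+ 2 + bnorm n (v - w) ^+ 2 <=
  2 * bnorm n v ^+ 2 + 8 / dlt n * bnorm n w ^+ 2.
Proof.
have d0 := dlt_gt0 n; have d1 := dlt_le n.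
have k1 : 1 <= (dlt n)^-1 by rewrite invf_ge1 //; lra.
have g0 m u : 0 <= hypl m u by exact: hyp_ge0.
have g0' m u : 0 <= hypr m u by exact: hyp_ge0.
rewrite !sqr_hyp !exprMn.
have := sum_smooth k1 (g0 n v) (g0' n v) (g0 n w) (g0' n w) _ _
  (hypl_parallelogram n v w) (hypr_parallelogram n v w).
have -> : hypl n v <= (dlt n)^-1 * hypr n v by rewrite mulrC ler_pdivlMr // mulrC hypl_le_hypr.
have -> : hypr n v <= (dlt n)^-1 * hypl n v by rewrite mulrC ler_pdivlMr // mulrC hypr_le_hypl.
move=> /(_ isT isT).
have := congr1 (fun x => dlt n ^+ 2 * x) (euc_parallelogram n v w); cbv beta.
move: (g0 n w) (g0' n w); set r := hypl n w; set s := hypr n w => r0 s0.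
have : 0 <= dlt n ^+ 2 * euc n w ^+ 2 by rewrite mulr_ge0 ?sqr_ge0.
move: k1; set k := (dlt n)^-1 => k1; set z := dlt n ^+ 2 * euc n w ^+ 2 => z0.
have : k * (r ^+ 2 + s ^+ 2) <= k * (r + s) ^+ 2.
  by rewrite ler_wpM2l //; nra.
have : z <= k * z by rewrite ler_peMl.
have : 0 <= k * (r + s) ^+ 2 by rewrite mulr_ge0 ?sqr_ge0 //; lra.
by move: z0; rewrite /z; lra.
Qed.

Lemma sqr_bnorm n v :
  bnorm n v ^+ 2 = (hypl n v + hypr n v) ^+ 2 + dlt n ^+ 2 * euc n v ^+ 2.
Proof. by rewrite sqr_hyp exprMn. Qed.

(** The Euclidean term obeys the parallelogram law exactly, the remaining part at least
    [good_sqrD]. *)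
Lemma bnorm_rotund n v w : dlt n ^+ 2 * euc n (v - w) ^+ 2 <=
  2 * bnorm n v ^+ 2 + 2 * bnorm n w ^+ 2 - bnorm n (v + w) ^+ 2.
Proof.
have := good_sqrD v w (good_add (good_hypl n) (good_hypr n)); cbv beta.
rewrite !sqr_bnorm.
have := congr1 (fun x => dlt n ^+ 2 * x) (euc_parallelogram n v w); cbv beta.
lra.
Qed.

Lemma bnorm_rotund_dist n v w : (bnorm n v - bnorm n w) ^+ 2 <=
  2 * bnorm n v ^+ 2 + 2 * bnorm n w ^+ 2 - bnorm n (v + w) ^+ 2.
Proof.
have := goodD v w (good_bnorm n); have := bnorm_ge0 n (v + w).
have := bnorm_ge0 n v; have := bnorm_ge0 n w; nra.
Qed.

Lemma bnorm_ext n v w : (forall b, v (n, b) = w (n, b)) -> bnorm n v = bnorm n w.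
Proof. by move=> h; rewrite /bnorm /hypl /hypr /euc /ca /cb !h. Qed.

End Blocks.

(** * The ℓ2-sum [blocks]: weak continuity, rotundity, smoothness *)

Section BlockSpace.
Variables (K : numFieldType) (R : realType) (sc : scalars K R).
Local Notation io := (io sc).
Local Notation rn := (rn sc).
Local Notation nx := (nx sc).
Local Notation bnorm := (bnorm sc).
Local Notation dlt := (@dlt R).
Implicit Types v : nat * bool -> K^o.

Lemma coord_le_bnorm n b v : rn (v (n, b)) <= bnorm n v.
Proof.
apply: le_trans (bnorm_ge sc n v); have := ca_ge0 sc n v; have := cb_ge0 sc n v.
by rewrite /ca /cb; case: b => ? ?; rewrite ?lerDl ?lerDr.
Qed.

Lemma bnorm_le_ell2 n M v : (n < M)%N -> bnorm n v <= ell2 bnorm M v.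
Proof.
move=> h; apply: le_trans (ell2_mono bnorm v h) => /=.
exact/hyp_ger/bnorm_ge0.
Qed.

Definition blocks : family sc.
Proof.
refine (@Family _ _ sc (nat * bool) nat (ell2 bnorm)
  (fun M => good_ell2 M (good_bnorm sc)) _ 0%N) => -[n b].
exists 1, n.+1 => v; rewrite mul1r; apply: le_trans (coord_le_bnorm n b v) _.
exact: bnorm_le_ell2.
Defined.

Local Notation X := (banach blocks).
Implicit Types x y z u w : X.

Lemma sum_le_nx M x : \sum_(0 <= n < M) bnorm n (coords x) ^+ 2 <= nx x ^+ 2.
Proof.
rewrite -sqr_ell2 ler_sqr ?nnegrE ?ell2_ge0 ?nx_ge0 //.
exact: (@fs_le_nx _ _ _ blocks).
Qed.

Lemma nx_le_sum c x : 0 <= c ->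
  (forall M, \sum_(0 <= n < M) bnorm n (coords x) ^+ 2 <= c ^+ 2) -> nx x <= c.
Proof.
move=> c0 h; apply: nx_le => M; apply: le_of_sqr => //.
rewrite [leLHS](_ : _ = ell2 bnorm M (coords x) ^+ 2) //; rewrite sqr_ell2; exact: h.
Qed.

Lemma sqr_nx_le c x :
  (forall M, \sum_(0 <= n < M) bnorm n (coords x) ^+ 2 <= c) -> nx x ^+ 2 <= c.
Proof.
move=> h; have c0 : 0 <= c by have := h 0%N; rewrite big_geq.
rewrite -[leRHS]sqr_sqrtr // ler_sqr ?nnegrE ?nx_ge0 ?sqrtr_ge0 //.
by apply: nx_le_sum => [|M]; rewrite ?sqrtr_ge0 // sqr_sqrtr.
Qed.

Lemma ler_sum_nat0 (f : nat -> R) M M' : (forall n, 0 <= f n) -> (M <= M')%N ->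
  \sum_(0 <= n < M) f n <= \sum_(0 <= n < M') f n.
Proof.
move=> f0 h; rewrite [leRHS](big_cat_nat (leq0n M) h) /= lerDl.
by rewrite sumr_ge0.
Qed.

Lemma blocks_vec v c : (forall M, ell2 bnorm M v <= c) -> exists x, coords x = v.
Proof.
move=> h; have hb : v \in @fbdd _ _ _ blocks by apply/fbddP; exists c.
by exists (Space hb).
Qed.

Definition cut M v : nat * bool -> K^o := fun i => if (i.1 < M)%N then v i else 0.

Lemma bnorm_zero n v : (forall b, v (n, b) = 0) -> bnorm n v = 0.
Proof.
by move=> h; rewrite -(good0 (good_bnorm sc n)); apply: bnorm_ext => b; rewrite h.
Qed.

Lemma bnorm_cut n M v : bnorm n (cut M v) = if (n < M)%N then bnorm n v else 0.
Proof.
case: ifP => h; first by apply: bnorm_ext => b; rewrite /cut /= h.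
by apply: bnorm_zero => b; rewrite /cut /= h.
Qed.

Lemma cut_ex M x : exists y, coords y = cut M (coords x) /\ nx y <= nx x.
Proof.
have h M' : ell2 bnorm M' (cut M (coords x)) <= nx x.
  apply: le_of_sqr; rewrite ?nx_ge0 // sqr_ell2.
  apply: le_trans (sum_le_nx M' x); apply: ler_sum => n _.
  by rewrite bnorm_cut; case: ifP => // _; rewrite expr0n sqr_ge0.
have [y yE] := blocks_vec h; exists y; split=> //.
by apply: nx_le => M'; rewrite yE; exact: h.
Qed.

Definition tail_in M y := forall n b, (n < M)%N -> coords y (n, b) = 0.

Lemma cut_tail M x y : coords y = cut M (coords x) -> tail_in M (x - y).
Proof.
move=> yE n b nM; rewrite coordsB yE.
by rewrite -[LHS]/(coords x (n, b) - cut M (coords x) (n, b)) /cut /= nM subrr.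
Qed.

Lemma bnorm_tail n M y : tail_in M y -> (n < M)%N -> bnorm n (coords y) = 0.
Proof. by move=> h nM; apply: bnorm_zero => b; exact: h. Qed.

Lemma disjoint_nx M x u w : coords u = cut M (coords x) -> tail_in M w ->
  nx (u + w) ^+ 2 <= nx u ^+ 2 + nx w ^+ 2.
Proof.
move=> uE wt; apply: sqr_nx_le => M'.
apply: le_trans (lerD (sum_le_nx M' u) (sum_le_nx M' w)).
rewrite -big_split /=; apply: ler_sum => n _.
have [nM|Mn] := ltnP n M.
  rewrite (_ : bnorm n (coords (u + w)) = bnorm n (coords u)) ?lerDl ?sqr_ge0 //.
  by apply: bnorm_ext => b; rewrite coordsD -[LHS]/(coords u (n, b) + coords w (n, b))
    wt // addr0.
rewrite (_ : bnorm n (coords (u + w)) = bnorm n (coords w)) ?lerDr ?sqr_ge0 //.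
apply: bnorm_ext => b; rewrite coordsD -[LHS]/(coords u (n, b) + coords w (n, b)).
by rewrite uE /cut /= ltnNge Mn add0r.
Qed.

Lemma cut_near x e : 0 < e -> exists M, forall y,
  coords y = cut M (coords x) -> nx (x - y) <= e.
Proof.
move=> e0; have hN M : ell2 bnorm M (coords x) <= nx x.
  exact: (@fs_le_nx _ _ _ blocks).
have [M hM] := ell2_tail hN (exprn_gt0 2 e0).
exists M => y yE; apply: nx_le_sum; first exact: ltW.
move=> M'; apply: le_trans (hM M').
have [MM'|M'M] := leqP M M'; last first.
  rewrite [leRHS]big_geq 1?ltnW // big_nat big1 // => n /andP[_ nM'].
  by rewrite (bnorm_tail (cut_tail yE)) ?expr0n // (ltn_trans nM').
rewrite (big_cat_nat (leq0n M) MM') /=.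
rewrite big_nat big1 ?add0r; last first.
  by move=> n /andP[_ nM]; rewrite (bnorm_tail (cut_tail yE)) ?expr0n.
rewrite !big_nat; apply: ler_sum => n /andP[Mn _].
rewrite (_ : bnorm n (coords (x - y)) = bnorm n (coords x)) //; apply: bnorm_ext => b.
rewrite coordsB yE -[LHS]/(coords x (n, b) - cut M (coords x) (n, b)).
by rewrite /cut /= ltnNge Mn subr0.
Qed.

                                                                             
                                                                          
(** Let u be a long cut of [z]. A vector w beyond the cut, scaled to norm [t] and rotated, gives |f
    u| + t |f w| / |w| <= sqrt (1 + t^2) <= 1 + t^2 / 2, while |f u| exceeds 1 - t^2 / 4. *)
Lemma form_tail (f : X -> K) z t : lin_form f -> (forall x, rn (f x) <= nx x) ->
  0 < t -> nx z <= 1 -> 1 - t ^+ 2 / 8 < rn (f z) ->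
  exists M, forall w, tail_in M w -> rn (f w) <= t * nx w.
Proof.
move=> fl f1 t0 z1 fz.
have [M hM] := cut_near z (divr_gt0 (exprn_gt0 2 t0) (ltr0n R 8)).
have [u [uE uz]] := cut_ex M z; exists M => w wt.
have fu : 1 - t ^+ 2 / 4 < rn (f u).
  have := hM u uE; have := f1 (z - u); rewrite lin_formB //.
  by have := rnB sc (f z) (f u); lra.
have [w0|w0] := eqVneq (nx w) 0.
  by rewrite (nx0_eq0 w0) lin_form0 // rn0 nx0 mulr0.
have wp : 0 < nx w by rewrite lt_neqAle eq_sym w0 nx_ge0.
have [s s1 hs] := align_form sc u (io (t / nx w) *: w) fl.
have wt' : tail_in M (s *: (io (t / nx w) *: w)).
  move=> n b nM; rewrite scalerA coordsZ.
  by rewrite -[LHS]/(_ * coords w (n, b)) wt // mulr0.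
have := disjoint_nx uE wt'; have := f1 (u + s *: (io (t / nx w) *: w)).
rewrite hs !nxZ s1 mul1r lin_formZ // rnM rn_io ger0_norm; last first.
  by rewrite divr_ge0 ?nx_ge0 // ltW.
rewrite divfK //; set N := nx (u + _) => h1 h2.
have u1 : nx u <= 1 by apply: le_trans z1.
have u2 : nx u ^+ 2 <= 1 by rewrite expr_le1 ?nx_ge0.
have N0 : 0 <= N by exact: nx_ge0.
have : N <= 1 + t ^+ 2 / 2.
  apply: le_of_sqr; first by have := sqr_ge0 t; lra.
  by have := sqr_ge0 (t ^+ 2); lra.
move=> h3; have : t / nx w * rn (f w) <= t * t by have := sqr_ge0 t; lra.
rewrite mulrAC ler_pdivrMr // -mulrA ler_pM2l //.
Qed.

Lemma form_tail_bdd (f : X -> K) c t : lin_form f ->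
  (forall x, rn (f x) <= c * nx x) -> 0 < t ->
  exists M, forall w, tail_in M w -> rn (f w) <= t * nx w.
Proof.
move=> fl fc t0; have [r [r0 fr rs]] := norm_ex fl fc.
have [r00|rn0] := eqVneq r 0.
  exists 0%N => w _; apply: le_trans (fr w) _.
  by rewrite r00 mul0r mulr_ge0 ?nx_ge0 // ltW.
have rp : 0 < r by rewrite lt_neqAle eq_sym rn0.
pose s := t / r; have s0 : 0 < s by rewrite divr_gt0.
pose g x := io r^-1 * f x.
have gE x : rn (g x) = r^-1 * rn (f x).
  by rewrite rnM rn_io ger0_norm // invr_ge0.
have [|z z1 hz] := rs (r * (s ^+ 2 / 8)).
  by rewrite mulr_gt0 // divr_gt0 // exprn_gt0.
have [|||M hM] := @form_tail g z s _ _ s0 z1.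
- by move=> a x y; rewrite /g fl mulrDr mulrCA.
- by move=> x; rewrite gE mulrC ler_pdivrMr // mulrC.
- by rewrite gE [r^-1 * _]mulrC ltr_pdivlMr // mulrBl mul1r [_ * r]mulrC.
exists M => w /hM; rewrite gE mulrC ler_pdivrMr // /s => h.
by apply: le_trans h _; rewrite mulrAC divfK.
Qed.

(** The finitely many head blocks converge in norm and [form_tail_bdd] controls the rest, so bounded
    coordinatewise limits are weak limits: the space behaves as a reflexive one. *)
Lemma form_ulim (f : X -> K) c (u : nat -> X) x (B : R) : lin_form f ->
  (forall x, rn (f x) <= c * nx x) ->
  (forall n, nx (u n) <= B) -> nx x <= B ->
  (forall i, ulim (fun n => rn (coords (u n) i - coords x i)) 0) ->
  ulim (fun n => rn (f (u n) - f x)) 0.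
Proof.
move=> fl fc uB xB ux e e0.
have B0 : 0 <= B by apply: le_trans xB; exact: nx_ge0.
have [|M hM] := @form_tail_bdd f c (e / (8 * (B + 1))) fl fc.
  by rewrite divr_gt0 // mulr_gt0 // ltr_wpDl.
have [r [r0 fr _]] := norm_ex fl fc.
have r1 : 0 < r + 1 by rewrite ltr_wpDl.
have er : 0 < e / (4 * (r + 1)) by rewrite divr_gt0 // mulr_gt0.
have gM := good_ell2 M (good_bnorm sc).
apply: filterS (good_ulim gM ux er) => n /=; rewrite !subr0.
rewrite !ger0_norm ?ell2_ge0 ?rn_ge0 // => hn.
rewrite -lin_formB //; have [y [yE yn]] := cut_ex M (u n - x).
rewrite -(subrK y (u n - x)) lin_formD //.
apply: le_lt_trans (rnD _ _ _) _.
have h1 := hM _ (cut_tail yE).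
have h2 : nx (u n - x - y) <= 2 * (B + B).
  apply: le_trans (nxD _ _ _) _; rewrite nxN; apply: le_trans (lerD (lexx _) yn) _.
  by have := nxD sc (u n) (- x); rewrite nxN; have := uB n; lra.
have h3 : nx y <= ell2 bnorm M (coords (u n) - coords x).
  apply: nx_le_sum; rewrite ?ell2_ge0 // => M'; rewrite sqr_ell2 yE.
  have [MM'|/ltnW M'M] := leqP M M'.
    rewrite (big_cat_nat (leq0n M) MM') /= [X in _ + X]big_nat [X in _ + X]big1 ?addr0.
      by rewrite !big_nat; apply: ler_sum => m /andP[_ mM]; rewrite bnorm_cut mM.
    by move=> m /andP[Mm _]; rewrite bnorm_cut ltnNge Mm expr0n.
  apply: le_trans (ler_sum_nat0 _ M'M); last by move=> m; rewrite sqr_ge0.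
  rewrite !big_nat; apply: ler_sum => m /andP[_ mM'].
  by rewrite bnorm_cut (leq_trans mM' M'M).
have h4 := fr y.
have h5 : r * nx y <= e / 4.
  have -> : e / 4 = (r + 1) * (e / (4 * (r + 1))) by field; rewrite gt_eqF.
  by apply: ler_pM; rewrite ?nx_ge0 ?lerDl // (le_trans h3 (ltW hn)).
have h6 : e / (8 * (B + 1)) * nx (u n - x - y) <= e / 2.
  have -> : e / 2 = e / (8 * (B + 1)) * (4 * (B + 1)).
    by field; rewrite gt_eqF // ltr_wpDl.
  by rewrite ler_wpM2l ?divr_ge0 ?mulr_ge0 ?addr_ge0 // ?(ltW e0) //; lra.
move: h1 h4 h5 h6; clear -e0; lra.
Qed.

End BlockSpace.

Section BlockSpace2.
Variables (K : numFieldType) (R : realType) (sc : scalars K R).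
Local Notation io := (io sc).
Local Notation rn := (rn sc).
Local Notation nx := (nx sc).
Local Notation bnorm := (bnorm sc).
Local Notation dlt := (@dlt R).
Local Notation X := (banach (blocks sc)).
Implicit Types v : nat * bool -> K^o.
Implicit Types x y z h u w : X.

Lemma blocks_attains : attains sc X.
Proof.
move=> f c fl fc.
apply: (@homogeneous_attains _ _ sc _ (fun x => rn (f x)) c).
- by move=> a x; rewrite lin_formZ // rnM.
- by move=> x; rewrite rn_ge0 fc.
- move=> u x u1 x1 ux.
  apply: ulim_dist (form_ulim fl fc u1 x1 ux) => n; exact: rn_dist.
Qed.

(** The ultralimit of support forms for the truncated norms. *)
Lemma blocks_support x : exists f : X -> K, [/\ lin_form f,
  forall z, rn (f z) <= nx z & f x = io (nx x)].
Proof.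
have ex M := good_support (good_ell2 M (good_bnorm sc)) (coords x).
pose f M (z : X) := sval (cid (ex M)) (coords z).
have fP M := svalP (cid (ex M)).
have fl M : lin_form (f M).
  by move=> a y z; have [l _ _] := fP M; rewrite /f coordsD coordsZ l.
have f1 M z : rn (f M z) <= 1 * nx z.
  rewrite mul1r; have [_ h _] := fP M; apply: le_trans (h _) _.
  exact: (@fs_le_nx _ _ _ (blocks sc)).
have fx M : f M x = io (ell2 bnorm M (coords x)) by have [_ _] := fP M.
have [g [gl g1 glim]] := ulim_form fl f1.
exists g; split=> [//|z|]; first by rewrite -[leRHS]mul1r.
apply: (@ulim_form_val _ _ sc (fun M => f M x)) => //.
apply: ulim_nat => e e0.
have [|M0 hM0] := @snorm_gt _ _ sc _ x (nx x - e); first by rewrite ltrBlDr ltrDl.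
exists M0 => M hM; rewrite subr0 fx -ioB rn_io normr_id.
have := ell2_mono bnorm (coords x) hM.
have := @fs_le_nx _ _ _ (blocks sc) x M.
rewrite /= in hM0 *; rewrite ltr_norml => ? ?; apply/andP; split; lra.
Qed.

Definition defect n x y := 2 * bnorm n (coords x) ^+ 2 + 2 * bnorm n (coords y) ^+ 2 -
  bnorm n (coords (x + y)) ^+ 2.

Lemma defect_ge0 n x y : 0 <= defect n x y.
Proof.
by apply: le_trans (bnorm_rotund_dist sc n (coords x) (coords y)); exact: sqr_ge0.
Qed.

Lemma sum_defect_le M x y d : nx x <= 1 -> nx y <= 1 -> 0 < d < 2 ->
  2 - d < nx (x + y) -> \sum_(0 <= n < M) defect n x y <= 4 * d.
Proof.
move=> x1 y1 /andP[d0 d2] /snorm_gt[M0 /= hM0].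
apply: le_trans (ler_sum_nat0 (fun n => defect_ge0 n x y) (leq_maxl M M0)) _.
rewrite /defect sumrB big_split /= -!mulr_sumr -!sqr_ell2.
set M' := maxn M M0.
have h1 : ell2 bnorm M' (coords x) ^+ 2 <= 1.
  by rewrite expr_le1 ?ell2_ge0 //; apply: le_trans x1;
    exact: (@fs_le_nx _ _ _ (blocks sc)).
have h2 : ell2 bnorm M' (coords y) ^+ 2 <= 1.
  by rewrite expr_le1 ?ell2_ge0 //; apply: le_trans y1;
    exact: (@fs_le_nx _ _ _ (blocks sc)).
have h3 : 2 - d < ell2 bnorm M' (coords (x + y)).
  by apply: lt_le_trans hM0 (ell2_mono _ _ (leq_maxr _ _)).
nra.
Qed.

Lemma ler_sum_mul (f g : nat -> R) M : (forall n, 0 <= f n) -> (forall n, 0 <= g n) ->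
  \sum_(0 <= n < M) f n * g n <=
  (\sum_(0 <= n < M) f n) * (\sum_(0 <= n < M) g n).
Proof.
move=> f0 g0; elim: M => [|M IH]; first by rewrite !big_geq // mul0r.
rewrite !big_nat_recr //=.
have s1 : 0 <= \sum_(0 <= n < M) f n by rewrite sumr_ge0.
have s2 : 0 <= \sum_(0 <= n < M) g n by rewrite sumr_ge0.
have := f0 M; have := g0 M; nra.
Qed.

(** The head is controlled by the rotundity of finitely many blocks; on the tail [x] is small, and
    then so is [y]. The length of the head depends on [x] and [dlt n] tends to 0, so the argument is
    only local. *)
Lemma blocks_lur x : nx x = 1 -> lur_at sc x.
Proof.
move=> x1 e e0.
have e2 : 0 < e ^+ 2 by rewrite exprn_gt0.
have hN M : ell2 bnorm M (coords x) <= 1.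
  by rewrite -x1; exact: (@fs_le_nx _ _ _ (blocks sc)).
have [|M hM] := ell2_tail (e := e ^+ 2 / 32) hN; first by rewrite divr_gt0.
pose C := \sum_(0 <= n < M) 16 / dlt n ^+ 2.
have c0 n : 0 <= 16 / dlt n ^+ 2 by rewrite divr_ge0 // sqr_ge0.
have C0 : 0 <= C by apply: sumr_ge0.
(* All terms with [d] add up to at most [e ^+ 2 / 8], and the tail of [x] contributes at most
   [e ^+ 2 / 4]; the total is below the square of [e * (3 / 4)]. *)
pose d := Num.min 1 (e ^+ 2 / (8 * (4 * C + 8))).
have CC : 0 < 8 * (4 * C + 8) by lra.
have d0 : 0 < d by rewrite lt_min ltr01 /= divr_gt0.
have d1 : d <= 1 by rewrite ge_min lexx.
have dC : d * (8 * (4 * C + 8)) <= e ^+ 2.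
  by rewrite -ler_pdivlMr // ge_min lexx orbT.
exists d => // y y1 hxy.
have dd : 0 < d < 2 by apply/andP; split=> //; lra.
have hD M' : \sum_(0 <= n < M') defect n x y <= 4 * d.
  by apply: sum_defect_le => //; rewrite x1.
have tailD M' : \sum_(M <= n < M') defect n x y <= 4 * d.
  have [MM'|/ltnW M'M] := leqP M M'; last by rewrite big_geq //; lra.
  apply: le_trans (hD M'); rewrite (big_cat_nat (leq0n M) MM') /= lerDr.
  by rewrite sumr_ge0 // => n _; exact: defect_ge0.
have small n : bnorm n (coords (x - y)) ^+ 2 <= 16 / dlt n ^+ 2 * defect n x y.
  have d2 : 0 < dlt n ^+ 2 by rewrite exprn_gt0 // dlt_gt0.
  have h := bnorm_rotund sc n (coords x) (coords y).
  apply: (@le_trans _ _ (16 * euc sc n (coords x - coords y) ^+ 2)).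
    rewrite -[16]/(4 * 4)%:R natrM -expr2 -exprMn.
    by rewrite ler_sqr ?nnegrE ?bnorm_ge0 ?mulr_ge0 ?hyp_ge0 // bnorm_le_euc.
  by rewrite -mulrA ler_wpM2l // ler_pdivlMl.
have large n : bnorm n (coords (x - y)) ^+ 2 <=
    8 * bnorm n (coords x) ^+ 2 + 2 * defect n x y.
  have h : (bnorm n (coords x) - bnorm n (coords y)) ^+ 2 <= defect n x y.
    exact: bnorm_rotund_dist.
  have := goodD (coords x) (- coords y) (good_bnorm sc n).
  rewrite (goodN _ (good_bnorm sc n)) => hh.
  have p0 := bnorm_ge0 sc n (coords x - coords y).
  have p1 := bnorm_ge0 sc n (coords x); have p2 := bnorm_ge0 sc n (coords y).
  apply: (@le_trans _ _ ((bnorm n (coords x) + bnorm n (coords y)) ^+ 2)).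
    by rewrite ler_sqr ?nnegrE ?addr_ge0.
  move: h p1 p2; set a := bnorm n (coords x); set b := bnorm n (coords y) => h p1 p2.
  (* Write [a + b] as [2 * a + (b - a)]; the square of [b - a] is at most the defect. *)
  have := sqr_ge0 (2 * a - (b - a)); nra.
apply: (@le_lt_trans _ _ (e * (3 / 4))); last by lra.
apply: nx_le_sum => [|M']; first by lra.
have part1 : \sum_(0 <= n < M) bnorm n (coords (x - y)) ^+ 2 <= C * (4 * d).
  apply: (@le_trans _ _ (\sum_(0 <= n < M) 16 / dlt n ^+ 2 * defect n x y)).
    by apply: ler_sum.
  apply: le_trans (ler_sum_mul _ c0 _) _; first by move=> n; exact: defect_ge0.
  by rewrite ler_wpM2l.
have [MM'|/ltnW M'M] := leqP M M'; last first.
  apply: le_trans (ler_sum_nat0 _ M'M) _; first by move=> n; exact: sqr_ge0.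
  by apply: le_trans part1 _; nra.
rewrite (big_cat_nat (leq0n M) MM') /=.
have part2 : \sum_(M <= n < M') bnorm n (coords (x - y)) ^+ 2 <=
    8 * (e ^+ 2 / 32) + 2 * (4 * d).
  apply: (@le_trans _ _ (\sum_(M <= n < M')
    (8 * bnorm n (coords x) ^+ 2 + 2 * defect n x y))); first exact: ler_sum.
  rewrite big_split /= -!mulr_sumr; have := hM M'; have := tailD M'; lra.
nra.
Qed.

End BlockSpace2.

Section BlockSpace3.
Variables (K : numFieldType) (R : realType) (sc : scalars K R).
Local Notation io := (io sc).
Local Notation rn := (rn sc).
Local Notation nx := (nx sc).
Local Notation bnorm := (bnorm sc).
Local Notation dlt := (@dlt R).
Local Notation X := (banach (blocks sc)).
Implicit Types v : nat * bool -> K^o.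
Implicit Types x y z h u w : X.

Lemma sqr_nxD_le x y B : (forall M, \sum_(0 <= n < M)
    (bnorm n (coords x) ^+ 2 + bnorm n (coords y) ^+ 2) <= B) ->
  nx x ^+ 2 + nx y ^+ 2 <= B.
Proof.
move=> hB; rewrite -lerBrDr; apply: sqr_nx_le => M; rewrite lerBrDr -lerBrDl.
apply: sqr_nx_le => M'; rewrite lerBrDl.
apply: le_trans (hB (maxn M M')); rewrite big_split /=; apply: lerD.
  by apply: ler_sum_nat0 (leq_maxl _ _) => n; exact: sqr_ge0.
by apply: ler_sum_nat0 (leq_maxr _ _) => n; exact: sqr_ge0.
Qed.

                                                                            
                               
(** Head blocks use [bnorm_smooth]. Tail blocks use only the triangle inequality, at the price of a
    first-order error proportional to the size [q] of the tail of [x]. *)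
Lemma blocks_smooth M (q : R) : 0 < q -> exists2 C, 0 <= C &
  forall x h t, nx x = 1 -> nx h <= 1 -> 0 <= t ->
  (forall M', \sum_(M <= n < M') bnorm n (coords x) ^+ 2 <= q ^+ 2) ->
  nx (x + io t *: h) + nx (x - io t *: h) <= 2 + (C + 2) * t ^+ 2 / 2 + 2 * t * q.
Proof.
move=> q0; pose C := \sum_(0 <= n < M) 8 / dlt n.
have c0 n : 0 <= 8 / dlt n by rewrite divr_ge0 // ltW // dlt_gt0.
exists C => [|x h t x1 h1 t0 xt]; first exact: sumr_ge0.
have C0 : 0 <= C by apply: sumr_ge0.
set B := (C + 2) * t ^+ 2 + 4 * t * q.
have B0 : 0 <= B by rewrite addr_ge0 ?mulr_ge0 ?addr_ge0 ?sqr_ge0 // ltW.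
suff key : nx (x + io t *: h) ^+ 2 + nx (x - io t *: h) ^+ 2 <= 2 + B.
  set a := nx _ in key *; set b := nx (_ - _) in key *.
  have : a + b <= 2 + B / 2.
    apply: le_of_sqr; first by lra.
    by have := sqr_ge0 (a - b); have := sqr_ge0 B; lra.
  by rewrite /B; lra.
have sx M' : \sum_(0 <= n < M') bnorm n (coords x) ^+ 2 <= 1.
  by apply: le_trans (sum_le_nx M' x) _; rewrite x1 expr1n.
have sh M' : \sum_(0 <= n < M') bnorm n (coords h) ^+ 2 <= 1.
  by apply: le_trans (sum_le_nx M' h) _; rewrite expr_le1 ?nx_ge0.
have st M' : \sum_(M <= n < M') bnorm n (coords h) ^+ 2 <= 1.
  have [MM'|/ltnW M'M] := leqP M M'; last by rewrite big_geq.
  apply: le_trans (sh M'); rewrite (big_cat_nat (leq0n M) MM') /= lerDr.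
  by rewrite sumr_ge0 // => n _; exact: sqr_ge0.
have pt n : bnorm n (io t *: coords h) = t * bnorm n (coords h).
  by rewrite (goodZ _ _ (good_bnorm sc n)) rn_io ger0_norm.
have bnd1 n : bnorm n (coords (x + io t *: h)) ^+ 2 +
    bnorm n (coords (x - io t *: h)) ^+ 2 <=
    2 * bnorm n (coords x) ^+ 2 + 8 / dlt n * t ^+ 2 * bnorm n (coords h) ^+ 2.
  rewrite -[_ * t ^+ 2 * _]mulrA -exprMn -pt; exact: bnorm_smooth.
have bnd2 n : bnorm n (coords (x + io t *: h)) ^+ 2 +
    bnorm n (coords (x - io t *: h)) ^+ 2 <=
    2 * bnorm n (coords x) ^+ 2 + (2 * t / q) * bnorm n (coords x) ^+ 2 +
    (2 * t ^+ 2 + 2 * t * q) * bnorm n (coords h) ^+ 2.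
  have gn := good_bnorm sc n.
  have e1 := goodD (coords x) (io t *: coords h) gn.
  have e2 := goodD (coords x) (- (io t *: coords h)) gn.
  rewrite (goodN _ gn) in e2; rewrite pt in e1 e2.
  have p0 := bnorm_ge0 sc n (coords x + io t *: coords h).
  have p0' := bnorm_ge0 sc n (coords x - io t *: coords h).
  have p1 := bnorm_ge0 sc n (coords x); have p2 := bnorm_ge0 sc n (coords h).
  set a := bnorm n (coords x) in e1 e2 p1 *; set b := bnorm n (coords h) in e1 e2 p2 *.
  have s1 : bnorm n (coords (x + io t *: h)) ^+ 2 <= (a + t * b) ^+ 2.
    by rewrite ler_sqr ?nnegrE ?addr_ge0 ?mulr_ge0.
  have s2 : bnorm n (coords (x - io t *: h)) ^+ 2 <= (a + t * b) ^+ 2.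
    by rewrite ler_sqr ?nnegrE ?addr_ge0 ?mulr_ge0.
  (* The weight [q] balances a tail of [x] of norm at most [q] against a tail of [h] of norm at most
     one. *)
  have am : 2 * (a * b) <= a ^+ 2 / q + q * b ^+ 2.
    rewrite -(ler_pM2r q0).
    have -> : (a ^+ 2 / q + q * b ^+ 2) * q = a ^+ 2 + q ^+ 2 * b ^+ 2.
      by field; rewrite gt_eqF.
    by have := sqr_ge0 (a - q * b); nra.
  have : t * (2 * (a * b)) <= t * (a ^+ 2 / q + q * b ^+ 2) by rewrite ler_wpM2l.
  have -> : 2 * t / q * a ^+ 2 = 2 * (t * (a ^+ 2 / q)) by ring.
  move: s1 s2; move: (a ^+ 2 / q) => aq; lra.
apply: sqr_nxD_le => M'.
have [MM'|/ltnW M'M] := leqP M M'.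
  rewrite (big_cat_nat (leq0n M) MM') /=.
  have P1 : \sum_(0 <= n < M) (bnorm n (coords (x + io t *: h)) ^+ 2 +
      bnorm n (coords (x - io t *: h)) ^+ 2) <=
      2 * \sum_(0 <= n < M) bnorm n (coords x) ^+ 2 + C * t ^+ 2.
    apply: (@le_trans _ _ (\sum_(0 <= n < M) (2 * bnorm n (coords x) ^+ 2 +
       8 / dlt n * (t ^+ 2 * bnorm n (coords h) ^+ 2)))).
      by apply: ler_sum => n _; rewrite [_ * (t ^+ 2 * _)]mulrA; exact: bnd1.
    rewrite big_split /= -mulr_sumr lerD2l.
    apply: le_trans (ler_sum_mul _ c0 _) _.
      by move=> n; rewrite mulr_ge0 ?sqr_ge0.
    by rewrite ler_wpM2l // -mulr_sumr ler_piMr ?sqr_ge0 ?sh.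
  have P2 : \sum_(M <= n < M') (bnorm n (coords (x + io t *: h)) ^+ 2 +
      bnorm n (coords (x - io t *: h)) ^+ 2) <=
      2 * \sum_(M <= n < M') bnorm n (coords x) ^+ 2 + 2 * t * q +
      (2 * t ^+ 2 + 2 * t * q).
    apply: (@le_trans _ _ (\sum_(M <= n < M') (2 * bnorm n (coords x) ^+ 2 +
      (2 * t / q) * bnorm n (coords x) ^+ 2 +
      (2 * t ^+ 2 + 2 * t * q) * bnorm n (coords h) ^+ 2))).
      by apply: ler_sum => n _; exact: bnd2.
    rewrite !big_split /= -!mulr_sumr; apply: lerD; first (apply: lerD => //).
      apply: (@le_trans _ _ (2 * t / q * q ^+ 2)).
        by rewrite ler_wpM2l // divr_ge0 ?mulr_ge0 // ltW.
      by rewrite expr2 mulrA divfK ?gt_eqF.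
    by rewrite ler_piMr // addr_ge0 ?mulr_ge0 ?sqr_ge0 // ltW.
  have := sx M'; rewrite (big_cat_nat (leq0n M) MM') /= => P3.
  by move: P1 P2 P3; rewrite /B; lra.
apply: (@le_trans _ _ (\sum_(0 <= n < M') (2 * bnorm n (coords x) ^+ 2 +
       8 / dlt n * (t ^+ 2 * bnorm n (coords h) ^+ 2)))).
  by apply: ler_sum => n _; rewrite [_ * (t ^+ 2 * _)]mulrA; exact: bnd1.
rewrite big_split /= -mulr_sumr.
have P4 : \sum_(0 <= n < M') 8 / dlt n * (t ^+ 2 * bnorm n (coords h) ^+ 2) <=
    C * t ^+ 2.
  apply: le_trans (ler_sum_mul _ c0 _) _.
    by move=> n; rewrite mulr_ge0 ?sqr_ge0.
  apply: ler_pM; first exact: sumr_ge0.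
  - by apply: sumr_ge0 => n _; rewrite mulr_ge0 ?sqr_ge0.
  - exact: ler_sum_nat0 c0 M'M.
  - by rewrite -mulr_sumr ler_piMr ?sqr_ge0 ?sh.
have tq : 0 <= t * q by rewrite mulr_ge0 // ltW.
have := sx M'; have := sqr_ge0 t; rewrite /B; lra.
Qed.

(** By [form_tail] all points almost norming for [f] have uniformly small tails, so the norm is
    uniformly smooth at them. Evaluating [f] at x + th and a support form of [x] at x - th, after
    rotation, and comparing with the two norms forces the two forms together. *)
Lemma blocks_form_smooth (f : X -> K) e : lin_form f ->
  (forall z, rn (f z) <= nx z) -> 0 < e -> exists2 d, 0 < d & forall x, nx x = 1 ->
  1 - d < rn (f x) -> exists g : X -> K, [/\ lin_form g,
    forall z, rn (g z) <= nx z, rn (g x) = 1 &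
    forall z, rn (g z - f z) <= e * nx z].
Proof.
move=> fl f1 e0; pose q := e / 8; have q0 : 0 < q by rewrite divr_gt0.
pose s := Num.min (q ^+ 2 / 8) 1.
have s0 : 0 < s by rewrite lt_min ltr01 andbT divr_gt0 // exprn_gt0.
have sq : s <= q ^+ 2 / 8 by rewrite ge_min lexx.
(* If no such point exists, the threshold [s ^+ 2 / 8] makes the claim vacuous. *)
have [hz|hz] := pselect (exists2 z, nx z <= 1 & 1 - s ^+ 2 / 8 < rn (f z));
    last first.
  exists (s ^+ 2 / 8); first by rewrite divr_gt0 // exprn_gt0.
  by move=> x x1 fx; case: hz; exists x; rewrite ?x1.
have [z0 z01 fz0] := hz; have [M hM] := form_tail fl f1 s0 z01 fz0.
have [C C0 hC] := blocks_smooth M q0.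
(* With this [t] both error terms of [blocks_smooth] equal [t * e / 4]; as [d] is at most that too,
   the two forms will differ by at most [e * (3 / 4)]. *)
pose t := e / (2 * (C + 2)).
have t0 : 0 < t by rewrite divr_gt0 // mulr_gt0 // ltr_wpDl.
have tC : (C + 2) * t = e / 2 by rewrite /t; field; rewrite gt_eqF // ltr_wpDl.
pose d := Num.min (t * e / 4) (Num.min (q ^+ 2 / 4) 1).
have d0 : 0 < d.
  have h4 : 0 < 4 :> R by rewrite ltr0n.
  by rewrite /d !lt_min ltr01 (divr_gt0 (mulr_gt0 t0 e0) h4)
    (divr_gt0 (exprn_gt0 2 q0) h4).
have dt : d <= t * e / 4 by rewrite ge_min lexx.
have dq : d <= q ^+ 2 / 4 by rewrite !ge_min lexx orbT.
exists d => // x x1 fx.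
(* Since [f] is at most [s] on tails, the head of [x] has norm at least [1 - d - 2 * s], which
   leaves at most [2 * d + 4 * s] for the squared tail. *)
have tail_x M' : \sum_(M <= n < M') bnorm n (coords x) ^+ 2 <= q ^+ 2.
  have [MM'|/ltnW M'M] := leqP M M'; last by rewrite big_geq // sqr_ge0.
  have [y [yE yx]] := cut_ex M x.
  have := hM _ (cut_tail yE); rewrite lin_formB // => h1.
  have h2 := rnB sc (f x) (f y); have h3 := f1 y.
  have h4 : nx (x - y) <= 2.
    by apply: le_trans (nxD _ _ _) _; rewrite nxN; lra.
  have h5 : nx y <= ell2 bnorm M (coords x).
    apply: nx_le_sum; rewrite ?ell2_ge0 // => N; rewrite sqr_ell2 yE.
    have [MN|/ltnW NM] := leqP M N.
      rewrite (big_cat_nat (leq0n M) MN) /= [X in _ + X]big_nat [X in _ + X]big1 ?addr0.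
        by rewrite !big_nat; apply: ler_sum => m /andP[_ mM]; rewrite bnorm_cut mM.
      by move=> m /andP[Mm _]; rewrite bnorm_cut ltnNge Mm expr0n.
    apply: le_trans (ler_sum_nat0 _ NM); last by move=> m; rewrite sqr_ge0.
    rewrite !big_nat; apply: ler_sum => m /andP[_ mN].
    by rewrite bnorm_cut (leq_trans mN NM).
  have h6 : s * nx (x - y) <= s * 2 by rewrite ler_pM2l.
  have h7 : 1 - d - 2 * s <= ell2 bnorm M (coords x) by lra.
  have h8 : ell2 bnorm M (coords x) ^+ 2 + \sum_(M <= n < M') bnorm n (coords x) ^+ 2 <= 1.
    rewrite -(ell2_split _ _ MM') expr_le1 ?ell2_ge0 // -x1.
    exact: (@fs_le_nx _ _ _ (blocks sc)).
  have [h9|h9] := leP 0 (1 - d - 2 * s).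
    have : (1 - d - 2 * s) ^+ 2 <= ell2 bnorm M (coords x) ^+ 2.
      by rewrite ler_sqr ?nnegrE ?ell2_ge0.
    by have := sqr_ge0 (d + 2 * s); lra.
  by have := sqr_ge0 (ell2 bnorm M (coords x)); lra.
have [g0 [g0l g01 g0x]] := blocks_support x; rewrite x1 io1 in g0x.
have [w w1 wf] := phase sc (f x).
have w0 : w != 0 by rewrite -(rn_eq0 sc) w1 oner_eq0.
exists (fun z => w^-1 * g0 z); split.
- by move=> a y z; rewrite g0l mulrDr mulrCA.
- by move=> z; rewrite rnM rnV w1 invr1 mul1r.
- by rewrite g0x mulr1 rnV w1 invr1.
have step h : nx h <= 1 -> rn (w^-1 * g0 h - f h) <= e * (3 / 4).
  move=> h1; have [p p1 pf] := phase sc (w * f h - g0 h).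
  have E : rn (w^-1 * g0 h - f h) = rn (w * f h - g0 h).
    rewrite -rnN opprB -[LHS]mul1r -w1 -rnM mulrBr mulrA mulfV //.
    by rewrite mul1r.
  rewrite E; set r := rn _ in pf *.
  have hh1 : nx (p *: h) <= 1 by rewrite nxZ p1 mul1r.
  have hs := hC x (p *: h) t x1 hh1 (ltW t0) tail_x.
  have ub : rn (w * f (x + io t *: (p *: h)) + g0 (x - io t *: (p *: h))) <=
      nx (x + io t *: (p *: h)) + nx (x - io t *: (p *: h)).
    by apply: le_trans (rnD _ _ _) _; rewrite rnM w1 mul1r lerD.
  have Eq : w * f (x + io t *: (p *: h)) + g0 (x - io t *: (p *: h)) =
      io (rn (f x) + 1 + t * r).
    rewrite (lin_formD _ _ fl) (lin_formB _ _ g0l) !(lin_formZ _ _ fl).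
    rewrite !(lin_formZ _ _ g0l) g0x !ioD (ioM _ t r) io1 -wf -pf; ring.
  rewrite Eq rn_io ger0_norm in ub; last first.
    by apply: addr_ge0; [rewrite addr_ge0 ?rn_ge0|apply: mulr_ge0; [exact: ltW|exact: rn_ge0]].
  have tC2 : (C + 2) * t ^+ 2 / 2 = t * (e / 4).
    have -> : (C + 2) * t ^+ 2 / 2 = (C + 2) * t * t / 2 by ring.
    by rewrite tC; field.
  have : t * r <= t * (e * (3 / 4)).
    move: hs ub fx dt; rewrite tC2 /q; clear; lra.
  by rewrite ler_pM2l.
move=> z; have [zz|zz] := eqVneq (nx z) 0.
  by rewrite (nx0_eq0 zz) (lin_form0 g0l) (lin_form0 fl) mulr0 subrr rn0 nx0 mulr0.
have zp : 0 < nx z by rewrite lt_neqAle eq_sym zz nx_ge0.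
have := step (io (nx z)^-1 *: z); rewrite nx_normalize // => /(_ (lexx _)).
rewrite (lin_formZ _ _ g0l) (lin_formZ _ _ fl) mulrCA -mulrBr rnM rn_io.
rewrite ger0_norm ?invr_ge0 ?nx_ge0 // mulrC ler_pdivrMr // => h.
by apply: le_trans h _; rewrite ler_wpM2r ?nx_ge0 //; lra.
Qed.

End BlockSpace3.

(** * Pairs with [blocks] as domain *)

Section BlockPlanes.
Variables (K : numFieldType) (R : realType) (sc : scalars K R).
Local Notation io := (io sc).
Local Notation rn := (rn sc).
Local Notation nx := (nx sc).
Local Notation bnorm := (bnorm sc).
Local Notation dlt := (@dlt R).
Local Notation X := (banach (blocks sc)).
Implicit Types x y z h u w : X.

Lemma sum_update (F G : nat -> R) n M B : (forall m, 0 <= F m) ->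
  (forall m, m != n -> F m = G m) ->
  (forall M, \sum_(0 <= m < M) G m <= B) ->
  \sum_(0 <= m < M) F m <= B + (F n - G n).
Proof.
move=> F0 FG GB.
have eqM N : (n < N)%N ->
    \sum_(0 <= m < N) F m = \sum_(0 <= m < N) G m + (F n - G n).
  elim: N => // N IH; rewrite ltnS leq_eqVlt !big_nat_recr //= => /predU1P[nN|nN].
    rewrite (_ : \sum_(0 <= i < N) F i = \sum_(0 <= i < N) G i).
      by rewrite nN -addrA; congr (_ + _); rewrite addrC subrK.
    by rewrite !big_nat; apply: eq_bigr => i /andP[_ iN]; rewrite FG // nN (ltn_eqF iN).
  by rewrite (IH nN) (FG N) ?(gtn_eqF nN) // addrAC.
apply: le_trans (ler_sum_nat0 F0 (leq_maxl M n.+1)) _.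
by rewrite eqM ?lerD2r // leq_maxr.
Qed.

Definition block_vec n (s t : K) : nat * bool -> K^o :=
  fun i => if i.1 == n then if i.2 then s else t else 0.

Lemma block_vec_ex n s t : exists x, coords x = block_vec n s t.
Proof.
apply: (@blocks_vec _ _ sc _ (bnorm n (block_vec n s t))) => M.
apply: le_of_sqr; rewrite ?bnorm_ge0 // sqr_ell2.
rewrite -[leRHS]add0r -[X in _ <= 0 + X]subr0.
apply: (@sum_update (fun m => bnorm m (block_vec n s t) ^+ 2) (fun _ => 0)).
- by move=> m; exact: sqr_ge0.
- by move=> m mn; rewrite bnorm_zero ?expr0n // => b; rewrite /block_vec /= (negPf mn).
- by move=> N; rewrite big1.
Qed.

Lemma block_plane n : exists a b : X -> K, exists e1 e2 : X,
  plane sc (dlt n) a b e1 e2.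
Proof.
have [e1 e1E] := block_vec_ex n 1 0; have [e2 e2E] := block_vec_ex n 0 1.
have move_ x s t : nx (x + (s *: e1 + t *: e2)) ^+ 2 <= nx x ^+ 2 +
    ((1 + 2 * dlt n) ^+ 2 * (rn (coords x (n, true) + s) +
      rn (coords x (n, false) + t)) ^+ 2 -
     (rn (coords x (n, true)) + rn (coords x (n, false))) ^+ 2).
  have uE : coords (s *: e1 + t *: e2) = block_vec n s t.
    apply/funext => -[m b]; rewrite coordsD !coordsZ e1E e2E.
    rewrite -[LHS]/(s * block_vec n 1 0 (m, b) + t * block_vec n 0 1 (m, b)).
    rewrite /block_vec /=; case: eqP => _; last by rewrite !mulr0 addr0.
    by case: b; rewrite !mulr0 !mulr1 ?addr0 ?add0r.
  apply: sqr_nx_le => M.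
  apply: le_trans (@sum_update (fun m => bnorm m (coords (x + (s *: e1 + t *: e2))) ^+ 2)
    (fun m => bnorm m (coords x) ^+ 2) n M (nx x ^+ 2) _ _ _) _.
  - by move=> m; exact: sqr_ge0.
  - move=> m mn; congr (_ ^+ 2); apply: bnorm_ext => b; rewrite coordsD uE.
    rewrite -[LHS]/(coords x (m, b) + block_vec n s t (m, b)).
    by rewrite /block_vec /= (negPf mn) addr0.
  - by move=> N; exact: sum_le_nx.
  rewrite lerD2l lerB //.
    rewrite -exprMn ler_sqr ?nnegrE ?bnorm_ge0 //; last first.
      rewrite mulr_ge0 ?addr_ge0 ?rn_ge0 //.
      by rewrite mulr_ge0 // ltW // dlt_gt0.
    apply: le_trans (bnorm_le sc n _) _.
    rewrite coordsD uE /ca /cb.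
    rewrite -[(coords x + _) (n, true)]/(coords x (n, true) + block_vec n s t (n, true)).
    rewrite -[(coords x + _) (n, false)]/(coords x (n, false) + block_vec n s t (n, false)).
    by rewrite /block_vec /= eqxx.
  rewrite ler_sqr ?nnegrE ?bnorm_ge0 ?addr_ge0 ?rn_ge0 //; exact: bnorm_ge.
exists (fun x => coords x (n, true)), (fun x => coords x (n, false)), e1, e2.
split=> //; rewrite ?e1E ?e2E /block_vec /= ?eqxx //.
- move=> x; apply: le_trans (bnorm_ge sc n (coords x)) _.
  apply: le_trans (bnorm_le_ell2 sc _ (ltnSn n)) _.
  exact: (@fs_le_nx _ _ _ (blocks sc) x n.+1).
- move=> s t; apply: le_of_sqr.
    rewrite mulr_ge0 ?addr_ge0 ?rn_ge0 //.
    by rewrite mulr_ge0 // ltW // dlt_gt0.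
  have := move_ 0 s t; rewrite coords0 add0r nx0 !add0r rn0 addr0.
  by rewrite expr0n subr0 add0r exprMn.
Qed.

(** With two components the smaller threshold serves both; the almost norming component is replaced
    by the form from [blocks_form_smooth]. *)
Lemma blocks_Lpo : Lpo K X (banach (linf sc true)).
Proof.
apply/(LpoP sc) => e T e0 T1.
have e2 : 0 < e / 2 by rewrite divr_gt0.
pose f b z := coords (T z) b.
have fl b : lin_form (f b) by exact: linf_comp.
have f1 b z : rn (f b z) <= nx z by exact: linf_comp_le.
have [d1 d10 h1] := blocks_form_smooth (fl true) (f1 true) e2.
have [d2 d20 h2] := blocks_form_smooth (fl false) (f1 false) e2.
exists (Num.min d1 d2); first by rewrite lt_min d10.
move=> x x1 /snorm_gt[b /= hb].
have [g [gl g1 gx gf]] : exists g : X -> K, [/\ lin_form g,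
    forall z, rn (g z) <= nx z, rn (g x) = 1 &
    forall z, rn (g z - f b z) <= e / 2 * nx z].
  have m1 : Num.min d1 d2 <= d1 by rewrite ge_min lexx.
  have m2 : Num.min d1 d2 <= d2 by rewrite ge_min lexx orbT.
  case: b hb => hb; [apply: h1 => //|apply: h2 => //];
    by apply: le_lt_trans hb; rewrite lerB.
by apply: (linf_replace (k := b) (g := g) (c := e / 2)) => //; lra.
Qed.

Lemma blocks_not_Lop : ~ Lop K X (banach (linf sc true)).
Proof.
have [a [b [e1 [e2 [al bl a1 b1 a2 b2 ple pge pmv]]]]] := block_plane 0.
have e10 : 0 < nx e1.
  have := ple e1; rewrite a1 b1 rn1 rn0 addr0; exact: lt_le_trans.
pose x := io (nx e1)^-1 *: e1.
have x1 : nx x = 1 by apply: nx_normalize; rewrite gt_eqF.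
have [f [fl f1 fx]] := blocks_support x.
have b_le z : rn (b z) <= 1 * nx z.
  by rewrite mul1r; apply: le_trans (ple z); rewrite lerDr rn_ge0.
have [z zb] := blocks_attains bl b_le.
have zp : 0 < rn (b z).
  have [_ /(_ e2)] := zb; rewrite b2 rn1 => h.
  by rewrite lt_neqAle rn_ge0 andbT; apply/eqP => h0; move: h; rewrite -h0; lra.
have [gl g1 gz nz] := normalized_form bl zb zp.
apply: (@not_Lop_linf _ _ sc X _ true false f
  (fun y => io (rn (b z))^-1 * b y) x z) => //.
- by rewrite fx x1 io1 rn1.
- by rewrite nz.
- by rewrite lin_formZ // b1 !mulr0.
Qed.

(** Take the normalization of (a, 0) and the direction of e1 + 8q e2 in a plane of distortion [q].
    An [S] close to it and attaining its norm there does so through its first component g, so |g| is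
    at least 1 + 8q at that vector and at most 1 + 2q at e1. Hence |g e2| >= 3/4, whereas [a]
    vanishes at e2. *)
Lemma blocks_not_BPBpp : ~ BPBpp K X (banach (linf sc true)).
Proof.
move=> /(BPBppP sc) hB.
have [|d d0 hd] := hB (1 / 4); first by rewrite divr_gt0.
pose d' := Num.min d (1 / 2).
have d'0 : 0 < d' by rewrite lt_min d0 divr_gt0.
have d'd : d' <= d by rewrite ge_min lexx.
have d'1 : d' <= 1 / 2 by rewrite ge_min lexx orbT.
have [n kn] : exists n, kap R n < d' by apply: kap_pick.
have dk := dlt_le_kap R n; have dn := dlt_gt0 R n; have dn1 := dlt_le R n.
have [a [b [e1 [e2 P]]]] := block_plane n.
have [al bl a1 b1 a2 b2 ple pge pmv] := P.
set q := dlt n in dk dn dn1 pge pmv.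
have a_le z : rn (a z) <= nx z by apply: le_trans (ple z); rewrite lerDl rn_ge0.
pose h c z := if c then a z else 0.
have [||T0 [T0E T01]] := @linf_op_ex _ _ sc X _ true h 1.
- by case=> // c y z; rewrite /h mulr0 addr0.
- by case=> z; rewrite mul1r /h ?rn0 ?nx_ge0.
pose y := 1 *: e1 + io (8 * q) *: e2.
have r8 : rn (io (8 * q)) = 8 * q by rewrite rn_io ger0_norm //; lra.
have ay : a y = 1 by rewrite (lin_formD _ _ al) !(lin_formZ _ _ al) a1 a2; ring.
have by_ : b y = io (8 * q).
  by rewrite (lin_formD _ _ bl) !(lin_formZ _ _ bl) b1 b2; ring.
have y1 : nx y <= (1 + 2 * q) * (1 + 8 * q).
  by apply: le_trans (pge _ _) _; rewrite rn1 r8.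
have y2 : 1 + 8 * q <= nx y by apply: le_trans (ple y); rewrite ay by_ rn1 r8.
have y0 : 0 < nx y by lra.
have e11 : nx e1 <= 1 + 2 * q.
  by have := pge 1 0; rewrite scale1r scale0r addr0 rn1 rn0 addr0 mulr1.
have e21 : nx e2 <= 1 + 2 * q.
  by have := pge 0 1; rewrite scale1r scale0r add0r rn1 rn0 add0r mulr1.
pose x := io (nx y)^-1 *: y.
have x1 : nx x = 1 by apply: nx_normalize; rewrite gt_eqF.
have T0x : 1 - d' < nx (T0 x).
  have := @fs_le_nx _ _ _ (linf sc true) (T0 x) true.
  rewrite /= T0E /h (lin_formZ _ _ al) ay mulr1 rn_io ger0_norm ?invr_ge0 ?nx_ge0 //.
  apply: lt_le_trans; rewrite -div1r ltr_pdivlMr //.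
  apply: (@le_lt_trans _ _ ((1 - d') * ((1 + 2 * q) * (1 + 8 * q)))).
    by rewrite ler_wpM2l //; lra.
  have qd : q <= d' / 32 by lra.
  have h1 : (1 + 2 * q) * (1 + 8 * q) <= 1 + 11 * q.
    by clear -dn dn1; nra.
  apply: (@le_lt_trans _ _ ((1 - d') * (1 + 11 * q))).
    by rewrite ler_wpM2l //; lra.
  by clear -qd d'0 d'1 dn; nra.
have d'1' : d' < 1 by lra.
have [T [c [T1 TE c1 _]]] := normalize_op T01 x1 d'1' T0x.
have [|S [S1 Sx ST]] := hd T x T1 x1.
  rewrite TE nxZr; last by lra.
  apply: (@lt_le_trans _ _ (nx (T0 x))); first by lra.
  by rewrite ler_peMl ?nx_ge0.
have SF : rn (coords (S x) false) <= 1 / 4.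
  have := op_near_le x ST; rewrite x1 mulr1; apply: le_trans.
  have := @fs_le_nx _ _ _ (linf sc true) (S x - T x) false.
  change (rn (coords (S x) false - coords (T x) false) <= nx (S x - T x) ->
    rn (coords (S x) false) <= nx (S x - T x)).
  have -> : coords (T x) false = 0.
    by rewrite TE; change (io c * coords (T0 x) false = 0); rewrite T0E mulr0.
  by rewrite subr0.
have gl := linf_comp S true; have g1 z := linf_comp_le true z S1.
set g := fun z => coords (S z) true in gl g1.
have gx : rn (g x) = 1.
  apply/eqP; rewrite eq_le -{1}x1 g1 /= leNgt; apply/negP => lt1.
  have : nx (S x) <= Num.max (rn (g x)) (1 / 4).
    by apply: nx_le => -[]; rewrite le_max ?lexx //= SF orbT.
  rewrite Sx leNgt gt_max lt1 /=; lra.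
have gy : rn (g y) = nx y.
  move: gx; rewrite (lin_formZ _ _ gl) rnM rn_io ger0_norm ?invr_ge0 ?nx_ge0 //.
  by move=> h2; apply: (@mulfI _ (nx y)^-1); rewrite ?invr_eq0 ?gt_eqF // h2 mulVf ?gt_eqF.
have ge2 : 8 * q - 2 * q <= 8 * q * rn (g e2).
  have := rnD sc (g (1 *: e1)) (g (io (8 * q) *: e2)).
  rewrite -(lin_formD _ _ gl) gy !(lin_formZ _ _ gl) mul1r rnM r8.
  by have := g1 e1; lra.
have := op_near_le e2 ST.
have := @fs_le_nx _ _ _ (linf sc true) (S e2 - T e2) true.
change (rn (coords (S e2) true - coords (T e2) true) <= nx (S e2 - T e2) ->
  nx (S e2 - T e2) <= 1 / 4 * nx e2 -> False).
have -> : coords (T e2) true = 0.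
  by rewrite TE; change (io c * coords (T0 e2) true = 0); rewrite T0E /h a2 mulr0.
rewrite subr0 -/(g e2) => h3 h4.
by clear -ge2 dn dn1 h3 h4 e21; nra.
Qed.

Lemma blocks_Lop_unit : Lop K X (banach (linf sc tt)).
Proof.
apply/(LopP sc) => e x e0 x1.
have [d d0 hd] := blocks_lur x1 e0.
pose d' := Num.min (d / 2) (1 / 2).
have d'0 : 0 < d' by rewrite lt_min !divr_gt0.
have d'd : d' + d' <= d.
  have : d' <= d / 2 by rewrite ge_min lexx.
  lra.
have d'1 : d' < 1.
  have : d' <= 1 / 2 by rewrite ge_min lexx orbT.
  lra.
exists d' => // T T1; rewrite linf_unit => Tx.
pose f z := coords (T z) tt.
have fl : lin_form f by exact: linf_comp.
have f1 z : rn (f z) <= nx z by exact: linf_comp_le.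
have [x0 fx0] : exists x0, attains_at sc f x0.
  by apply: (blocks_attains (c := 1) fl) => z; rewrite mul1r.
have [||y [y1 fy yx _]] := @attain_near _ _ sc X f x x0 e d' _ _ fl f1 fx0 x1 Tx.
- by rewrite d'0.
- move=> y y1 h; apply: hd => //.
  by apply: le_lt_trans h; rewrite lerB.
exists y; split=> //; rewrite linf_unit -/(f y) fy.
exact: norm_one_attains_at.
Qed.

End BlockPlanes.

                                                  

(** * The target [mixed] and the failure of BPBp *)

Section StrictlyConvexTarget.
Variables (K : numFieldType) (R : realType) (sc : scalars K R).
Local Notation io := (io sc).
Local Notation rn := (rn sc).
Local Notation nx := (nx sc).
Local Notation ca := (ca sc).
Local Notation cb := (cb sc).
Local Notation euc := (euc sc).
Local Notation dlt := (@dlt R).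
Local Notation kap := (@kap R).
Implicit Types v w : nat * bool -> K^o.

Definition cmax n v := Num.max (ca n v) (cb n v).
Definition mnorm n v := hyp (cmax n v) (kap n * euc n v).

Lemma good_cmax n : good sc (cmax n).
Proof. exact: good_max (good_ca sc n) (good_cb sc n). Qed.

Lemma good_mnorm n : good sc (mnorm n).
Proof.
apply: good_hyp (good_cmax n) _; apply: good_scale (good_euc sc n).
exact/ltW/kap_gt0.
Qed.

Lemma cmax_ge0 n v : 0 <= cmax n v.
Proof. by rewrite le_max rn_ge0. Qed.

Lemma ca_le_mnorm n v : ca n v <= mnorm n v.
Proof. by apply: le_trans (hyp_gel _ (cmax_ge0 n v)); rewrite le_max lexx. Qed.

Lemma cb_le_mnorm n v : cb n v <= mnorm n v.
Proof. by apply: le_trans (hyp_gel _ (cmax_ge0 n v)); rewrite le_max lexx orbT. Qed.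

Definition mixed : family sc.
Proof.
refine (@Family _ _ sc (nat * bool) nat mnorm good_mnorm _ 0%N) => -[n b].
by exists 1, n => v; rewrite mul1r; case: b; [exact: ca_le_mnorm|exact: cb_le_mnorm].
Defined.

Local Notation Y := (banach mixed).

Lemma mnorm_ext n v w : (forall b, v (n, b) = w (n, b)) -> mnorm n v = mnorm n w.
Proof. by move=> h; rewrite /mnorm /cmax /euc /ca /cb !h. Qed.

Lemma mnorm_zero n v : (forall b, v (n, b) = 0) -> mnorm n v = 0.
Proof. by move=> h; rewrite -(good0 (good_mnorm n)); apply: mnorm_ext => b; rewrite h. Qed.

Lemma sqr_mnorm n v : mnorm n v ^+ 2 = cmax n v ^+ 2 + kap n ^+ 2 * euc n v ^+ 2.
Proof. by rewrite sqr_hyp exprMn. Qed.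

(** The maximum is convex and the Euclidean term obeys the parallelogram law. So if v + w and v - w
    are hardly longer than [v], then [w] is small. *)
Lemma mnorm_rotund n v w : 2 * mnorm n v ^+ 2 + 2 * (kap n ^+ 2 * euc n w ^+ 2) <=
  mnorm n (v + w) ^+ 2 + mnorm n (v - w) ^+ 2.
Proof.
rewrite !sqr_mnorm.
have h1 := congr1 (fun x => kap n ^+ 2 * x) (euc_parallelogram sc n v w).
cbv beta in h1.
have h2 : 2 * cmax n v <= cmax n (v + w) + cmax n (v - w).
  have := goodD (v + w) (v - w) (good_cmax n).
  rewrite addrACA subrr addr0 -mulr2n -scaler_nat (goodZ _ _ (good_cmax n)).
  have -> : 2%:R = io 2 :> K by rewrite -[2 in RHS]/(1 + 1) ioD io1.
  by rewrite rn_io ger0_norm.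
have p := cmax_ge0 n v; have p1 := cmax_ge0 n (v + w).
have p2 := cmax_ge0 n (v - w).
have h3 : 2 * cmax n v ^+ 2 <= cmax n (v + w) ^+ 2 + cmax n (v - w) ^+ 2.
  by have := sqr_ge0 (cmax n (v + w) - cmax n (v - w)); clear h1; nra.
move: h1 h3; move: (euc n v ^+ 2) (euc n w ^+ 2) (euc n (v + w) ^+ 2)
  (euc n (v - w) ^+ 2) => A B C D; lra.
Qed.

                                                                            
                                                                         
                                                                          
(** [T] maps into the n-th plane with components a + b and a - b, scaled, and is almost norming at
    the middle of the edge. If [S] near [T] attains its norm at a nearby x0, then x0 moves along the
    edge in both directions with hardly any growth of norm, so [mnorm_rotund] makes [S] small on the
    edge direction u, where a - b is large. *)
Lemma planes_not_BPBp (X : completeNormedModType K) :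
  (forall n, exists d (a b : X -> K) (e1 e2 : X),
    0 <= d <= dlt n /\ plane sc d a b e1 e2) -> ~ BPBp K X Y.
Proof.
move=> hP /(BPBpP sc) hB; have h32 : 1 / 32 < 1 :> R by lra.
have [|d d0 hd] := hB (1 / 32); first by rewrite divr_gt0.
pose d' := Num.min d (1 / 2).
have d'0 : 0 < d' by rewrite lt_min d0 divr_gt0.
have d'd : d' <= d by rewrite ge_min lexx.
have d'1 : d' <= 1 / 2 by rewrite ge_min lexx orbT.
have [n kn] : exists n, kap n < d' / 8 by apply: kap_pick; rewrite divr_gt0.
have kn0 := @kap_gt0 R n; have kn4 := @kap_le R n.
have [dd [a [b [e1 [e2 [/andP[q00 qq] P]]]]]] := hP n.
have dk := dlt_le_kap R n; have ks := @sqr_kap R n.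
have [al bl a1 b1 a2 b2 ple pge pmv] := P.
set k := kap n in kn kn0 kn4 dk ks.
have ddk : dd <= k / 32 by lra.
have dd1 : dd <= 1 / 32 by have := dlt_le R n; lra.
have kk0 : 0 < 1 + 2 * k by lra.
(* The factor compensates the Euclidean term, which adds at most [2 * k] times the maximum. *)
pose f (z : X) : nat * bool -> K^o := fun i => if i.1 == n then
  io (1 + 2 * k)^-1 * (if i.2 then a z + b z else a z - b z) else 0.
have fca z : ca n (f z) = (1 + 2 * k)^-1 * rn (a z + b z).
  by rewrite /ca /f /= eqxx rnM rn_io ger0_norm // invr_ge0 ltW.
have fcb z : cb n (f z) = (1 + 2 * k)^-1 * rn (a z - b z).
  by rewrite /cb /f /= eqxx rnM rn_io ger0_norm // invr_ge0 ltW.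
have fj j z : j != n -> mnorm j (f z) = 0.
  by move=> jn; apply: mnorm_zero => c; rewrite /f /= (negPf jn).
have [||T0 [T0E T01]] := @space_op_ex _ _ sc X mixed f 1.
- move=> c y z; apply/funext => -[m c'].
  rewrite -[RHS]/(c * f y (m, c') + f z (m, c')) /f /=.
  case: eqP => _; last by rewrite mulr0 addr0.
  by rewrite al bl; case: c'; ring.
- move=> z j; rewrite mul1r /=; have [->|jn] := eqVneq j n; last first.
    by rewrite fj ?nx_ge0.
  apply: le_trans (ple z); set s := rn (a z) + rn (b z).
  have i0 : 0 <= (1 + 2 * k)^-1 by rewrite invr_ge0 ltW.
  have m1 : cmax n (f z) <= (1 + 2 * k)^-1 * s.
    rewrite ge_max fca fcb !ler_wpM2l // ?rnD //.
    by apply: le_trans (rnD _ _ _) _; rewrite rnN.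
  have m2 : euc n (f z) <= 2 * ((1 + 2 * k)^-1 * s).
    apply: le_trans (hyp_leD (rn_ge0 _ _) (rn_ge0 _ _)) _.
    rewrite -/(ca n (f z)) -/(cb n (f z)); move: m1; rewrite ge_max => /andP[]; lra.
  apply: le_trans (hyp_leD (cmax_ge0 _ _) _) _.
    by rewrite mulr_ge0 ?hyp_ge0 // ltW.
  have : k * euc n (f z) <= k * (2 * ((1 + 2 * k)^-1 * s)) by rewrite ler_wpM2l // ltW.
  have sE : s = (1 + 2 * k) * ((1 + 2 * k)^-1 * s) by rewrite mulVKf // gt_eqF.
  rewrite [in X in _ -> _ <= X]sE -/k; move: m1.
  by move: ((1 + 2 * k)^-1 * s) => S; clear; lra.
pose y := 1 *: e1 + 1 *: e2.
have ay : a y = 1 by rewrite (lin_formD _ _ al) !(lin_formZ _ _ al) a1 a2; ring.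
have by_ : b y = 1 by rewrite (lin_formD _ _ bl) !(lin_formZ _ _ bl) b1 b2; ring.
have y1 : nx y <= (1 + 2 * dd) * 2 by apply: le_trans (pge _ _) _; rewrite rn1.
have y2 : 2 <= nx y by apply: le_trans (ple y); rewrite ay by_ rn1.
have y0 : 0 < nx y by lra.
pose r := (nx y)^-1.
have ry : r * nx y = 1 by rewrite mulVf // gt_eqF.
have r1 : r <= 1 / 2 by clear -ry y2 y0; nra.
have r2 : 47 / 100 <= r by clear -ry y1 dd1 y0; nra.
pose x := io r *: y.
have x1 : nx x = 1 by apply: nx_normalize; rewrite gt_eqF.
have ax : a x = io r by rewrite (lin_formZ _ _ al) ay mulr1.
have bx : b x = io r by rewrite (lin_formZ _ _ bl) by_ mulr1.
have T0x : 1 - d' < nx (T0 x).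
  have := @fs_le_nx _ _ _ mixed (T0 x) n; apply: lt_le_trans.
  apply: lt_le_trans (ca_le_mnorm _ _); rewrite T0E fca ax bx -ioD rn_io.
  rewrite ger0_norm; last by lra.
  rewrite mulrC ltr_pdivlMr //.
  have rr : 1 - 2 * dd <= r + r by clear -ry y1 q00 y0 r2; nra.
  apply: lt_le_trans rr; clear -kn kn0 d'0 d'1 ddk; nra.
have d'1' : d' < 1 by lra.
have [T [c [T1 TE c1 _]]] := normalize_op T01 x1 d'1' T0x.
have [|S [x0 [S1 x01 Sx0 x0x ST]]] := hd T x T1 x1.
  rewrite TE nxZr; last by lra.
  apply: (@lt_le_trans _ _ (nx (T0 x))); first by lra.
  by rewrite ler_peMl ?nx_ge0.
have c00 : 0 <= c by clear -c1; lra.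
have TEc z i : coords (T z) i = io c * f z i.
  by rewrite TE; change (io c * coords (T0 z) i = io c * f z i); rewrite T0E.
have Snear z j : mnorm j (coords (S z) - coords (T z)) <= 1 / 32 * nx z.
  apply: le_trans (op_near_le z ST).
  exact: (@fs_le_nx _ _ _ mixed (S z - T z) j).
have Sother j : j != n -> mnorm j (coords (S x0)) <= 1 / 32.
  move=> jn; have := Snear x0 j; rewrite x01 mulr1; apply: le_trans.
  rewrite (_ : mnorm j (coords (S x0) - coords (T x0)) = mnorm j (coords (S x0))) //.
  apply: mnorm_ext => c'.
  rewrite -[LHS]/(coords (S x0) (j, c') - coords (T x0) (j, c')) TEc /f /=.
  by rewrite (negPf jn) mulr0 subr0.
have qS : 1 <= mnorm n (coords (S x0)).
  rewrite leNgt; apply/negP => lt1.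
  have : nx (S x0) <= Num.max (mnorm n (coords (S x0))) (1 / 32).
    apply: nx_le => j; rewrite le_max; have [->|/Sother h] := eqVneq j n.
      by rewrite lexx.
    by apply/orP; right; exact: h.
  by rewrite Sx0 leNgt gt_max lt1 h32.
have near_a : rn (a x0 - io r) <= 1 / 32.
  rewrite -ax -(lin_formB _ _ al); apply: le_trans (ltW x0x).
  by apply: le_trans (ple _); rewrite lerDl rn_ge0.
have near_b : rn (b x0 - io r) <= 1 / 32.
  rewrite -bx -(lin_formB _ _ bl); apply: le_trans (ltW x0x).
  by apply: le_trans (ple _); rewrite lerDr rn_ge0.
(* The coordinates of [x0] are close to the positive number [r]. Their phases are split off, so that
   moduli can be shifted exactly while the phases stay near 1. *)
have unimod (w : K) : rn (w - io r) <= 1 / 32 -> exists p,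
    [/\ rn p = 1, w = io (rn w) * p, 1 / 4 <= rn w & rn (p - 1) <= 14 / 100].
  move=> hw; have [s s1 sw] := phase sc w.
  have s0 : s != 0 by rewrite -(rn_eq0 sc) s1 oner_eq0.
  have rp : 0 <= r by clear -r2; lra.
  have h1 := rn_dist sc w (io r); rewrite rn_io (ger0_norm rp) in h1.
  move: h1; rewrite ler_norml => /andP[h1 h2].
  exists s^-1; split.
  - by rewrite rnV s1 invr1.
  - by rewrite -sw mulrAC mulfV // mul1r.
  - by clear -h1 r2 hw; lra.
  have E : io r * (s^-1 - 1) = (io (r - rn w) * s^-1) + (w - io r).
    by rewrite ioB mulrBl -sw [s * w * _]mulrAC mulfV // mul1r; ring.
  have := congr1 rn E; rewrite rnM rn_io ger0_norm //.
  move=> E2; have := rnD sc (io (r - rn w) * s^-1) (w - io r).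
  rewrite -E2 rnM rn_io rnV s1 invr1 mulr1.
  have : `|r - rn w| <= 1 / 32 by rewrite ler_norml; apply/andP; split; clear -h1 h2 hw; lra.
  have := rn_ge0 sc (s^-1 - 1); move: r2 hw; clear.
  move: (rn (s^-1 - 1)) (rn (w - io r)) => A B; nra.
have [pa [pa1 aE a4 pan]] := unimod _ near_a.
have [pb [pb1 bE b4 pbn]] := unimod _ near_b.
pose al_ := io (1 / 4) * pa; pose be_ := io (- (1 / 4)) * pb.
pose u := al_ *: e1 + be_ *: e2.
have au : a u = al_.
  by rewrite (lin_formD _ _ al) !(lin_formZ _ _ al) a1 a2; ring.
have bu : b u = be_.
  by rewrite (lin_formD _ _ bl) !(lin_formZ _ _ bl) b1 b2; ring.
have sig1 : rn (a x0) + rn (b x0) <= 1 by rewrite -x01.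
(* The shift raises one modulus and lowers the other by the same amount; both are at least 1/4, so
   their sum is unchanged and only the distortion [dd] enters. *)
have moved (s : R) : s = 1 / 4 \/ s = - (1 / 4) ->
    nx (x0 + (io s * pa *: e1 + io (- s) * pb *: e2)) ^+ 2 <= 1 + 8 * dd.
  move=> hs; apply: le_trans (pmv _ _ _) _; rewrite x01 expr1n lerD2l.
  rewrite {1}aE {1}bE -!mulrDl -!ioD !rnM pa1 pb1 !mulr1 !rn_io.
  rewrite !ger0_norm; [|by clear -hs a4 b4; case: hs => ->; lra|by clear -hs a4 b4; case: hs => ->; lra].
  have -> : rn (a x0) + s + (rn (b x0) - s) = rn (a x0) + rn (b x0) by ring.
  set sg := rn (a x0) + rn (b x0) in sig1 *.
  have sg0 : 0 <= sg by rewrite addr_ge0 ?rn_ge0.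
  have : sg ^+ 2 <= 1 by rewrite expr_le1.
  have := sqr_ge0 sg; move: (sg ^+ 2) => S2 S20 S21.
  have -> : (1 + 2 * dd) ^+ 2 * S2 - S2 = (4 * dd + 4 * dd ^+ 2) * S2 by ring.
  apply: (@le_trans _ _ ((4 * dd + 4 * dd ^+ 2) * 1)).
    by rewrite ler_wpM2l // addr_ge0 ?mulr_ge0 ?sqr_ge0.
  by clear -q00 dd1; nra.
have m1 : nx (x0 + u) ^+ 2 <= 1 + 8 * dd by apply: moved; left.
have m2 : nx (x0 - u) ^+ 2 <= 1 + 8 * dd.
  have -> : x0 - u = x0 + (io (- (1 / 4)) * pa *: e1 + io (- - (1 / 4)) * pb *: e2).
    rewrite /u /al_ /be_ opprK opprD; congr (_ + (_ + _)).
      by rewrite ioN mulNr scaleNr.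
    by rewrite ioN mulNr scaleNr opprK.
  by apply: moved; right.
have qle z : mnorm n (coords (S z)) ^+ 2 <= nx z ^+ 2.
  rewrite ler_sqr ?nnegrE ?nx_ge0 ?hyp_ge0 //.
  by apply: le_trans (norm_one_le z S1); exact: (@fs_le_nx _ _ _ mixed (S z) n).
have rot := mnorm_rotund n (coords (S x0)) (coords (S u)).
have E1 : coords (S (x0 + u)) = coords (S x0) + coords (S u).
  by rewrite linearD.
have E2 : coords (S (x0 - u)) = coords (S x0) - coords (S u).
  by rewrite linearB.
rewrite -E1 -E2 in rot.
have l1 := le_trans (qle (x0 + u)) m1; have l2 := le_trans (qle (x0 - u)) m2.
have qS2 : 1 <= mnorm n (coords (S x0)) ^+ 2 by rewrite expr_ge1 // hyp_ge0.
have cbS : cb n (coords (S u)) ^+ 2 <= 1 / 64.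
  apply: (@le_trans _ _ (euc n (coords (S u)) ^+ 2)).
    by rewrite sqr_hyp lerDr sqr_ge0.
  (* As [k ^+ 2] is 1024 times [dlt n] and [dd] is at most [dlt n], the Euclidean square is at most
     1/128. *)
  have kq : k ^+ 2 * euc n (coords (S u)) ^+ 2 <= 8 * dd.
    by clear -rot l1 l2 qS2; rewrite -/k in rot; lra.
  have dp := dlt_gt0 R n.
  move: kq qq dp; rewrite ks; move: (euc n (coords (S u)) ^+ 2) (dlt n).
  clear => A D h1 h2 D0; nra.
have cbT : 25 / 100 <= cb n (coords (T u)).
  rewrite /cb TEc rnM rn_io (ger0_norm c00).
  rewrite -/(cb n (f u)) fcb au bu.
  have E3 : al_ - be_ = io (1 / 4) * (pa + pb) by rewrite /al_ /be_ ioN; ring.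
  have : 17 / 10 <= rn (pa + pb).
    have E4 : io 2 = (pa + pb) - ((pa - 1) + (pb - 1)).
      by rewrite -[2]/(1 + 1) ioD io1; ring.
    have := rnB sc (io 2) (pa + pb); rewrite {2}E4.
    have -> : pa + pb - (pa - 1 + (pb - 1)) - (pa + pb) = - ((pa - 1) + (pb - 1)).
      by ring.
    rewrite rnN rn_io ger0_norm // => h1; have := rnD sc (pa - 1) (pb - 1).
    by move: h1 pan pbn; clear; lra.
  rewrite E3 rnM rn_io ger0_norm // => h1.
  have h2 : 17 / 40 <= 1 / 4 * rn (pa + pb) by clear -h1; lra.
  apply: (@le_trans _ _ ((1 + 2 * k)^-1 * (1 / 4 * rn (pa + pb)))).
    by rewrite [leRHS]mulrC ler_pdivlMr //; clear -h2 kn4; lra.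
  by rewrite ler_peMl // mulr_ge0 ?mulr_ge0 ?rn_ge0 // invr_ge0 ltW.
have u1 : nx u <= 54 / 100.
  apply: le_trans (pge _ _) _; rewrite !rnM pa1 pb1 !mulr1 !rn_io normrN.
  by rewrite ger0_norm //; clear -dd1; lra.
have := Snear u n; have := cb_le_mnorm n (coords (S u) - coords (T u)).
have := goodB (coords (T u)) (coords (S u)) (good_cb sc n).
rewrite -(goodN (coords (T u) - _) (good_cb sc n)) opprB.
move: cbS cbT u1; have := cb_ge0 sc n (coords (S u)); clear.
move: (cb n (coords (S u))) (cb n (coords (T u))) (cb n _) (mnorm n _) (nx u).
move=> A B C D E *; nra.
Qed.

End StrictlyConvexTarget.

Section BlocksToMixed.
Variables (K : numFieldType) (R : realType) (sc : scalars K R).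
Local Notation io := (io sc).
Local Notation rn := (rn sc).
Local Notation nx := (nx sc).
Local Notation mnorm := (mnorm sc).
Local Notation X := (banach (blocks sc)).
Local Notation Y := (banach (mixed sc)).

                                                                                
                                                                                 
                                                                                 
(** Lindenstrauss perturbation inside one plane: the component T_k is replaced by T_k + s phi
    T_k(x), where phi is T_k followed by a support form at T_k(x). Weak compactness gives a point x0
    where the new component attains its norm; maximality forces phi to be large at x0, and rotundity
    at [x] brings a rotation of x0 close to [x]. *)
Lemma blocks_mixed_Lp : Lp K X Y.
Proof.
apply/(LpP sc) => e x e0 x1.
have [d d0 hd] := blocks_lur x1 e0.
pose s := Num.min (e / 8) 1.
have s0 : 0 < s by rewrite lt_min ltr01 andbT divr_gt0.
have se : s <= e / 8 by rewrite ge_min lexx.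
have s1 : s <= 1 by rewrite ge_min lexx orbT.
pose h := Num.min (Num.min (d / 8) (s * (d / 4))) (Num.min (1 / 4) (e / 8)).
have d4 : 0 < d / 4 by rewrite divr_gt0.
have h0 : 0 < h.
  by rewrite !lt_min (mulr_gt0 s0 d4) !divr_gt0.
have hd8 : h <= d / 8 by rewrite !ge_min lexx.
have hsd : h <= s * (d / 4) by rewrite !ge_min lexx !orbT.
have h4 : h <= 1 / 4 by rewrite !ge_min lexx !orbT.
have he : h <= e / 8 by rewrite !ge_min lexx !orbT.
exists h => // T T1 /snorm_gt[k hk].
have {}hk : 1 - h < mnorm k (coords (T x)) by [].
have qT j z : mnorm j (coords (T z)) <= nx z.
  by apply: le_trans (norm_one_le z T1); exact: (@fs_le_nx _ _ _ (mixed sc) (T z) j).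
have gk := good_mnorm sc k.
have [g [gl g1 gx]] := good_support gk (coords (T x)).
pose phi z := g (coords (T z)).
have phil : lin_form phi by move=> a y z; rewrite /phi linearP gl.
have phi1 z : rn (phi z) <= nx z by apply: le_trans (g1 _) (qT k z).
pose tx := mnorm k (coords (T x)).
have tx1 : tx <= 1 by rewrite -x1 qT.
have phix : rn (phi x) = tx.
  by rewrite /phi gx rn_io ger0_norm ?(good_ge0 _ gk).
pose G z : nat * bool -> K^o := coords (T z) + (io s * phi z) *: coords (T x).
have GZ a z : G (a *: z) = a *: G z.
  rewrite /G linearZ (lin_formZ _ _ phil) scalerDr scalerA mulrCA.
  by congr (_ + _).
have Gi_lin i : lin_form (fun z => G z i).
  move=> a y z; rewrite /G linearP phil.
  rewrite -[LHS]/((a * coords (T y) i + coords (T z) i) +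
    (io s * (a * phi y + phi z)) * coords (T x) i).
  rewrite -[RHS]/(a * (coords (T y) i + io s * phi y * coords (T x) i) +
    (coords (T z) i + io s * phi z * coords (T x) i)).
  ring.
have Gi_le i : exists c, forall z, rn (G z i) <= c * nx z.
  have [c c0 hc] := @coord_bound _ _ sc (mixed sc) i.
  exists (c + s * rn (coords (T x) i)) => z.
  rewrite -[G z i]/(coords (T z) i + io s * phi z * coords (T x) i).
  apply: le_trans (rnD _ _ _) _; rewrite !rnM rn_io (ger0_norm (ltW s0)) mulrDl.
  apply: lerD.
    apply: le_trans (hc (T z)) _; rewrite -nx_snorm ler_wpM2l //.
    exact: norm_one_le.
  by rewrite mulrAC ler_wpM2l // mulr_ge0 ?rn_ge0 // ltW.
pose m z := mnorm k (G z).
have mZ a z : m (a *: z) = rn a * m z by rewrite /m GZ (goodZ _ _ gk).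
have m_le z : m z <= mnorm k (coords (T z)) + s * rn (phi z) * tx.
  apply: le_trans (goodD _ _ gk) _; rewrite lerD2l (goodZ _ _ gk) rnM rn_io.
  by rewrite (ger0_norm (ltW s0)).
have m_le2 z : m z <= (1 + s) * nx z.
  apply: le_trans (m_le z) _; rewrite mulrDl mul1r lerD ?qT //.
  rewrite -mulrA ler_pM2l // -[leRHS]mulr1 ler_pM ?rn_ge0 ?(good_ge0 _ gk) //.
have [x0 [x01 hx0]] : exists x0, nx x0 <= 1 /\ forall z, m z <= m x0 * nx z.
  apply: (@homogeneous_attains _ _ sc _ m (1 + s)) => //.
    by move=> z; rewrite m_le2 andbT (good_ge0 _ gk).
  move=> u y u1 y1 uy; apply: good_ulim_val gk _ => i.
  have [c hc] := Gi_le i.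
  exact: (form_ulim (Gi_lin i) hc u1 y1 uy).
set r := m x0 in hx0.
have mx : (1 - h) * (1 + s * (1 - h)) <= m x.
  have -> : m x = (1 + s * tx) * tx.
    rewrite /m /G /phi gx -ioM -[X in X + _]scale1r -scalerDl -(io1 sc) -ioD.
    rewrite (goodZ _ _ gk) rn_io ger0_norm //.
    by rewrite addr_ge0 // mulr_ge0 ?(ltW s0) // (good_ge0 _ gk).
  rewrite mulrC; apply: ler_pM.
  - by rewrite addr_ge0 // mulr_ge0 ?(ltW s0) //; clear -h4; lra.
  - by clear -h4; lra.
  - by rewrite lerD2l ler_pM2l // ltW.
  - exact: ltW.
(* Against [rle] this gives |phi x0| >= 1 - 2h - h/s, and the choice [h <= s * (d / 4)] absorbs the
   division by [s]. *)
have rge : 1 - h + s * (1 - 2 * h) <= r.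
  have := hx0 x; rewrite x1 mulr1; apply: le_trans; apply: le_trans mx.
  by clear -s0 h0; have := sqr_ge0 h; nra.
have sh : 0 <= s * (1 - 2 * h) by rewrite mulr_ge0 ?(ltW s0) //; clear -h4; lra.
have rh : 1 - h <= r by clear -rge sh; lra.
have r0 : 0 < r by clear -rh h4; lra.
have nx01 : nx x0 = 1.
  apply/eqP; rewrite eq_le x01 /=.
  by have := hx0 x0; rewrite -/r -[leLHS]mulr1 ler_pM2l.
have rle : r <= 1 + s * rn (phi x0).
  apply: le_trans (m_le x0) _; apply: lerD; first by rewrite -nx01.
  by rewrite ler_piMr // mulr_ge0 ?rn_ge0 // ltW.
have rle2 : r <= 1 + s by have := m_le2 x0; rewrite nx01 mulr1.
have phis : 2 - d < rn (phi x) + rn (phi x0).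
  have : s * (1 - 2 * h - d / 4) <= s * rn (phi x0).
    by move: rge rle hsd; clear; lra.
  rewrite ler_pM2l // => p0; have : 1 - h < rn (phi x) by rewrite phix.
  by move: p0 hd8 d0; clear; lra.
have [t t1 ht] := lur_form phil phi1 phis.
have tx01 : nx (t *: x0) = 1 by rewrite nxZ t1 mul1r.
pose f z : nat * bool -> K^o :=
  fun i => if i.1 == k then io r^-1 * G z i else coords (T z) i.
have fk z : mnorm k (f z) = r^-1 * m z.
  rewrite (@mnorm_ext _ _ sc k (f z) (io r^-1 *: G z)).
    by rewrite (goodZ _ _ gk) rn_io ger0_norm // invr_ge0 ltW.
  by move=> b; rewrite /f /= eqxx.
have fj j z : j != k -> mnorm j (f z) = mnorm j (coords (T z)).
  by move=> jk; apply: mnorm_ext => b; rewrite /f /= (negPf jk).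
have rm z : r^-1 * m z <= nx z by rewrite mulrC ler_pdivrMr // mulrC.
have [||S [SE S1]] := @space_op_ex _ _ sc X (mixed sc) f 1.
- move=> a y z; apply/funext => -[j b].
  rewrite -[RHS]/(a * f y (j, b) + f z (j, b)) /f /=; case: eqP => _.
    by rewrite Gi_lin; ring.
  by rewrite linearP.
- move=> z j; rewrite mul1r; have [->|jk] := eqVneq j k.
    by rewrite [leLHS]fk.
  by rewrite [leLHS]fj.
have Sx : nx (S (t *: x0)) = 1.
  apply/eqP; rewrite eq_le; apply/andP; split.
    by apply: le_trans (S1 _) _; rewrite tx01 mulr1.
  have := @fs_le_nx _ _ _ (mixed sc) (S (t *: x0)) k.
  by rewrite SE [leLHS]fk mZ t1 mul1r -/r mulVf // gt_eqF.
exists S, (t *: x0); split=> //.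
- by apply: norm_oneP S1 _ Sx; rewrite tx01.
- by rewrite nxBC hd // tx01.
have e2 : 0 <= e / 2 by rewrite divr_ge0 // ltW.
exists (e / 2); first by clear -e0; lra.
move=> z; apply: nx_le => j.
rewrite [leLHS](_ : _ = mnorm j (f z - coords (T z))); last by rewrite -SE.
have [->|jk] := eqVneq j k; last first.
  rewrite mnorm_zero; first exact: mulr_ge0 e2 (nx_ge0 _ _).
  move=> b.
  rewrite -[LHS]/(f z (j, b) - coords (T z) (j, b)) /f /= (negPf jk).
  by rewrite subrr.
rewrite (@mnorm_ext _ _ sc k _ (io (r^-1 - 1) *: G z +
    (io s * phi z) *: coords (T x))); last first.
  move=> b; rewrite -[LHS]/(f z (k, b) - coords (T z) (k, b)) /f /= eqxx.
  rewrite -[RHS]/(io (r^-1 - 1) * G z (k, b) + io s * phi z * coords (T x) (k, b)).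
  rewrite -[G z (k, b)]/(coords (T z) (k, b) + io s * phi z * coords (T x) (k, b)).
  by rewrite ioB io1; ring.
apply: le_trans (goodD _ _ gk) _; rewrite !(goodZ _ _ gk) rnM !rn_io.
rewrite (ger0_norm (ltW s0)) -/(m z) -/tx.
(* Rescaling costs at most [s + h], since [r] lies between [1 - h] and [1 + s]; the perturbation
   itself costs [s]. *)
have P1 : `|r^-1 - 1| * m z <= (s + h) * nx z.
  have -> : `|r^-1 - 1| = `|1 - r| * r^-1.
    have r1 : 0 <= r^-1 by rewrite invr_ge0 ltW.
    rewrite -[X in _ = _ * X](ger0_norm r1) -normrM.
    by rewrite mulrBl mul1r divff ?gt_eqF.
  rewrite -mulrA; apply: ler_pM => //.
    by rewrite mulr_ge0 ?(good_ge0 _ gk) // invr_ge0 ltW.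
  by rewrite ler_norml; apply/andP; split; clear -rh rle2 s0 h0; lra.
have P2 : s * rn (phi z) * tx <= s * nx z.
  rewrite -mulrA ler_pM2l // -[leRHS]mulr1 ler_pM ?rn_ge0 ?(good_ge0 _ gk) //.
apply: le_trans (lerD P1 P2) _; rewrite -mulrDl ler_wpM2r ?nx_ge0 //.
by clear -se he e0; lra.
Qed.

Lemma blocks_mixed_not_BPBp : ~ BPBp K X Y.
Proof.
apply: planes_not_BPBp => n; have [a [b [e1 [e2 P]]]] := block_plane sc n.
by exists (dlt R n), a, b, e1, e2; rewrite lexx ltW ?dlt_gt0.
Qed.

Lemma ell1_mixed_not_BPBp : ~ BPBp K (banach (ell1 sc)) Y.
Proof.
apply: planes_not_BPBp => n; have [a [b [e1 [e2 [P _ _]]]]] := ell1_plane sc.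
by exists 0, a, b, e1, e2; rewrite lexx ltW ?dlt_gt0.
Qed.

End BlocksToMixed.

                                            

(** In a plane of distortion [q], the form a + (1 - 9q) b is almost norming at the direction of e2.
    Near it |b| is at least 1/2 and the form is at most 1 - 9q/2, below its norm, which is at least
    1/(1 + 2q) because of e1. *)
Lemma blocks_not_BPBop (K : numFieldType) (R : realType) (sc : scalars K R) :
  ~ BPBop K (banach (blocks sc)) (banach (linf sc tt)).
Proof.
set X := banach (blocks sc).
move=> /(BPBopP sc) hB.
have [|d d0 hd] := hB (1 / 4); first by rewrite divr_gt0.
pose d' := Num.min d (1 / 2).
have d'0 : 0 < d' by rewrite lt_min d0 divr_gt0.
have d'd : d' <= d by rewrite ge_min lexx.
have d'1 : d' <= 1 / 2 by rewrite ge_min lexx orbT.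
have [n kn] : exists n, kap R n < d' by apply: kap_pick.
have dk := dlt_le_kap R n; have q0 := dlt_gt0 R n; have q1 := dlt_le R n.
have [a [b [e1 [e2 P]]]] := block_plane sc n.
have [al bl a1 b1 a2 b2 ple pge pmv] := P.
set q := dlt R n in dk q0 q1 pge pmv.
have q9 : 0 <= 1 - 9 * q by clear -q1; lra.
have [||T0 [T0E T01]] := @linf_op_ex _ _ sc X _ tt
  (fun _ z => a z + io sc (1 - 9 * q) * b z) 1.
- by move=> _ c y z; rewrite al bl; ring.
- move=> _ z; rewrite mul1r; apply: le_trans (ple z).
  apply: le_trans (rnD _ _ _) _; rewrite lerD2l rnM rn_io ger0_norm //.
  by rewrite ler_piMl ?rn_ge0 //; clear -q0; lra.
have T0n z : nx sc (T0 z) = rn sc (a z + io sc (1 - 9 * q) * b z).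
  by rewrite linf_unit T0E.
have e11 : nx sc e1 <= 1 + 2 * q.
  by have := pge 1 0; rewrite scale1r scale0r addr0 rn1 rn0 addr0 mulr1.
have e21 : nx sc e2 <= 1 + 2 * q.
  by have := pge 0 1; rewrite scale1r scale0r add0r rn1 rn0 add0r mulr1.
have e12 : 1 <= nx sc e2 by have := ple e2; rewrite a2 b2 rn0 rn1 add0r.
have e20 : 0 < nx sc e2 by clear -e12; lra.
pose x := io sc (nx sc e2)^-1 *: e2.
have x1 : nx sc x = 1 by apply: nx_normalize; rewrite gt_eqF.
have ax : a x = 0 by rewrite (lin_formZ _ _ al) a2 mulr0.
have bx : b x = io sc (nx sc e2)^-1 by rewrite (lin_formZ _ _ bl) b2 mulr1.
have i0 : 0 <= (nx sc e2)^-1 by rewrite invr_ge0 ltW.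
have T0x : 1 - d' < nx sc (T0 x).
  rewrite T0n ax bx add0r -ioM rn_io ger0_norm ?mulr_ge0 //.
  rewrite ltr_pdivlMr //; apply: (@le_lt_trans _ _ ((1 - d') * (1 + 2 * q))).
    by rewrite ler_wpM2l //; clear -d'1; lra.
  by clear -kn dk d'0 q0; nra.
have d'1' : d' < 1 by clear -d'1; lra.
have [T [c [T1 TE c1 _]]] := normalize_op T01 x1 d'1' T0x.
have c0 : 0 <= c by clear -c1; lra.
have [|y [y1 Ty yx]] := hd T x T1 x1.
  rewrite TE nxZr //; apply: (@lt_le_trans _ _ (nx sc (T0 x))).
    by clear -T0x d'd; lra.
  by rewrite ler_peMl ?nx_ge0.
have Te1 := norm_one_le e1 T1; rewrite TE nxZr // T0n a1 b1 mulr0 addr0 rn1 in Te1.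
move: Ty; rewrite TE nxZr // T0n => Ty.
have by1 : 1 / 2 <= rn sc (b y).
  have := rnB sc (b x) (b y); rewrite {1}bx rn_io ger0_norm // -(lin_formB _ _ bl).
  have h1 : rn sc (b (x - y)) <= nx sc (y - x).
    by rewrite nxBC; apply: le_trans (ple _); rewrite lerDr rn_ge0.
  have h2 : 3 / 4 <= (nx sc e2)^-1.
    by rewrite -[leRHS]mul1r ler_pdivlMr //; clear -e21 q1 q0; nra.
  by move: h1 h2 yx; clear; lra.
have h3 := rnD sc (a y) (io sc (1 - 9 * q) * b y).
rewrite rnM rn_io ger0_norm // in h3.
have h4 := ple y; rewrite y1 in h4.
have h5 : rn sc (a y + io sc (1 - 9 * q) * b y) <= 1 - 9 / 2 * q.
  by clear -h3 h4 by1 q0; nra.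
have h6 : 1 <= c * (1 - 9 / 2 * q) by rewrite -[leLHS]Ty ler_wpM2l.
by move: Te1; rewrite mulr1; clear -h6 e11 c1 q0 q1 => Te1; nra.
Qed.

(** * Assembling the implications and the counterexamples *)

Theorem mainTheorem11 (R : realType) (K : numFieldType)
    (hK : K = R :> numFieldType \/ K = R[i] :> numFieldType) :
           
  ((pair_implies (BPBpp K) (Lpo K) /\
    pair_implies (BPBpp K) (Lpp K) /\
    pair_implies (BPBpp K) (BPBp K) /\
    pair_implies (Lpo K) (Lo K) /\
    pair_implies (Lpp K) (Lp K) /\
    pair_implies (BPBop K) (Loo K) /\
    pair_implies (BPBop K) (Lop K) /\
    pair_implies (Loo K) (Lo K) /\
    pair_implies (Lop K) (Lp K) /\
    pair_implies (BPBop K) (BPBp K) /\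
    pair_implies (BPBp K) (Lo K) /\
    pair_implies (BPBp K) (Lp K)) /\
   (~ pair_implies (Lpo K) (BPBpp K) /\
    ~ pair_implies (Lpp K) (BPBpp K) /\
    ~ pair_implies (BPBp K) (BPBpp K) /\
    ~ pair_implies (Lo K) (Lpo K) /\
    ~ pair_implies (Lp K) (Lpp K) /\
    ~ pair_implies (Loo K) (BPBop K) /\
    ~ pair_implies (Lop K) (BPBop K) /\
    ~ pair_implies (Lo K) (Loo K) /\
    ~ pair_implies (Lp K) (Lop K) /\
    ~ pair_implies (BPBp K) (BPBop K) /\
    ~ pair_implies (Lo K) (BPBp K) /\
    ~ pair_implies (Lp K) (BPBp K))) /\
            
  (~ pair_implies (BPBp K) (Lpp K) /\
   ~ pair_implies (BPBp K) (Lpo K) /\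
   ~ pair_implies (BPBp K) (Lop K) /\
   ~ pair_implies (BPBp K) (Loo K)) /\
             
  (~ pair_implies (Lop K) (Lpo K) /\
   ~ pair_implies (Lpo K) (Lop K)) /\
            
  ~ pair_implies (Lpp K) (Lpo K) /\
           
  ~ pair_implies (Loo K) (Lop K).
Proof.
have [sc] : inhabited (scalars K R).
  by case: hK => ->; split; [exact: real_scalars|exact: complex_scalars].
have uLpo : pair_implies (BPBpp K) (Lpo K) by move=> X Y; exact: uniform_operator.
have uLpp : pair_implies (BPBpp K) (Lpp K) by move=> X Y; exact: uniform_point.
have uLoo : pair_implies (BPBop K) (Loo K) by move=> X Y; exact: uniform_operator.
have uLop : pair_implies (BPBop K) (Lop K) by move=> X Y; exact: uniform_point.
have uLo : pair_implies (BPBp K) (Lo K) by move=> X Y; exact: uniform_operator.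
have uLp : pair_implies (BPBp K) (Lp K) by move=> X Y; exact: uniform_point.
have Bp1 := @rsup_BPBop _ _ sc; have Bp1' := BPBop_BPBp sc Bp1.
have Bp2 := @rsup_BPBp _ _ sc.
have nLpp : ~ pair_implies (BPBp K) (Lpp K).
  by move=> h; apply: (@rsup_not_Lpp _ _ sc (h _ _ Bp1')).
have nLpo : ~ pair_implies (BPBp K) (Lpo K).
  by move=> h; apply: (@rsup_not_Lpo _ _ sc (h _ _ Bp1')).
have nLop : ~ pair_implies (BPBp K) (Lop K).
  by move=> h; apply: (@rsup_not_Lop _ _ sc (h _ _ Bp2)).
have nLoo : ~ pair_implies (BPBp K) (Loo K).
  by move=> h; apply: (@rsup_not_Loo _ _ sc (h _ _ Bp2)).
have nLppLpo : ~ pair_implies (Lpp K) (Lpo K).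
  by move=> h; apply: (@ell1_not_Lpo _ _ sc (h _ _ (@ell1_Lpp _ _ sc))).
have nLooLop : ~ pair_implies (Loo K) (Lop K).
  by move=> h; apply: (@ell1_not_Lop _ _ sc (h _ _ (@ell1_Loo _ _ sc _))).
split; [split|].
  do !split => //.
  - exact: BPBpp_BPBp sc.
  - exact: Lpo_Lo.
  - exact: Lpp_Lp sc.
  - exact: Loo_Lo sc.
  - exact: Lop_Lp sc.
  - exact: BPBop_BPBp sc.
(* Where no pair of spaces is named, the supposed converse composes with a proved implication into
   one already refuted. *)
- do !split.
  + by move=> h; apply: (@blocks_not_BPBpp _ _ sc (h _ _ (@blocks_Lpo _ _ sc))).
  + by move=> h; apply: nLppLpo => X Y /h/uLpo.
  + by move=> h; apply: nLpp => X Y /h/uLpp.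
  + by move=> h; apply: nLpo => X Y /uLo/h.
  + by move=> h; apply: nLpp => X Y /uLp/h.
  + by move=> h; apply: nLooLop => X Y /h/uLop.
  + by move=> h; apply: (@blocks_not_BPBop _ _ sc (h _ _ (@blocks_Lop_unit _ _ sc))).
  + by move=> h; apply: nLoo => X Y /uLo/h.
  + by move=> h; apply: nLop => X Y /uLp/h.
  + by move=> h; apply: nLoo => X Y /h/uLoo.
  + move=> h; apply: (@ell1_mixed_not_BPBp _ _ sc); apply: h.
    exact: Loo_Lo sc _ _ (@ell1_Loo _ _ sc _).
  + by move=> h; apply: (@blocks_mixed_not_BPBp _ _ sc (h _ _ (@blocks_mixed_Lp _ _ sc))).
do !split => //.
- by move=> h; apply: (@rsup_not_Lpo _ _ sc (h _ _ (uLop _ _ Bp1))).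
- by move=> h; apply: (@blocks_not_Lop _ _ sc (h _ _ (@blocks_Lpo _ _ sc))).
Qed.
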